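(* Let $p$ be a prime, $m$ an even positive integer, $q=p^m$, and let $a\in\mathbf{F}_q^*$ with $a\notin(\mathbf{F}_q^* )^{\sqrt{q}-1}$. Then the curve $C_m$ defined over $\mathbf{F}_q$ by the equation $$y^{q-1}=-\frac{x^q-a x^{\sqrt{q}}}{a x^{\sqrt{q}}-x}$$ has genus $g(C_m)=(\sqrt{q}-1)(q-2)-\sqrt{q}+2$ and $\#C_m(\mathbf{F}_q)=(q-1)^2$.
   Context: $\mathbf{F}_q$ is the finite field with $q=p^m$ elements, and $(\mathbf{F}_q^* )^d$ denotes the set of $d$-th powers in $\mathbf{F}_q^*$. The curve ''defined by'' an affine equation $y^{q-1}=f(x)$ with $f\in\mathbf{F}_q(x)$ means the non-singular complete irreducible curve over $\mathbf{F}_q$ with function field $\mathbf{F}_q(x,y)$, $y^{q-1}=f(x)$. *)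

(* Defs.v *)
From HB Require Import structures.
From mathcomp Require Import all_boot all_order all_algebra all_field.
From mathcomp Require Import finmap.
From mathcomp Require Import boolp classical_sets cardinality.

Set Implicit Arguments.
Unset Strict Implicit.
Unset Printing Implicit Defensive.

Import Order.TTheory GRing.Theory Num.Theory.
Local Open Scope classical_set_scope.
Local Open Scope ring_scope.

(* The non-singular complete curve with function field K over k has as closed
   points the places of K / k, i.e. the normalized discrete valuations of K
   that are trivial on k.  Everything below is expressed on K, viewed over k
   through iota. *)

Section Curve.
Variables (k K : fieldType) (iota : {rmorphism k -> K}).

(* The order of 0 should be +oo; it is fixed to the dummy value 0 so that
   a place is determined by its values on K^*. *)
Record place := Place {
  ord :> K -> int;
  ord0 : ord 0 = 0;
  ordM : forall u w, u != 0 -> w != 0 -> ord (u * w) = ord u + ord w;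
  ordD : forall u w, u != 0 -> w != 0 -> u + w != 0 ->
    Num.min (ord u) (ord w) <= ord (u + w);
  ord_const : forall c : k, ord (iota c) = 0;
  ord_unif : exists t, t != 0 /\ ord t = 1 }.

HB.instance Definition _ := gen_eqMixin place.
HB.instance Definition _ := gen_choiceMixin place.

Definition ord_ge (P : place) (n : int) : set K :=
  [set z | z = 0 \/ n <= P z].

(* For k-subspaces W `<=` V of K: the quotient V / W has a k-basis of n
   elements, namely the classes of the b i. *)
Definition has_dimq (V W : set K) (n : nat) : Prop :=
  exists2 b : 'I_n -> K, (forall i, V (b i)) &
    forall z, V z ->
      exists! c : {ffun 'I_n -> k}, W (z - \sum_i iota (c i) * b i).

Definition dimq (V W : set K) : nat := xget 0%N [set n | has_dimq V W n].

(* Dimension over k of the residue field. *)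
Definition place_deg (P : place) : nat := dimq (ord_ge P 0) (ord_ge P 1).

Definition rational_points : set place := [set P | place_deg P = 1%N].

Definition divisor := {fsfun place -> int with 0}.

Definition div_deg (D : divisor) : int :=
  \sum_(P <- finsupp D) D P * (place_deg P)%:Z.

Definition RRspace (D : divisor) : set K :=
  [set z | forall P : place, ord_ge P (- D P) z].

Definition ell (D : divisor) : nat := dimq (RRspace D) [set 0].

(* g = max_D (deg D - ell D + 1), Riemann's definition of the genus. *)
Definition is_genus (g : int) : Prop :=
  (forall D : divisor, div_deg D - (ell D)%:Z + 1 <= g) /\
  (exists D : divisor, div_deg D - (ell D)%:Z + 1 = g).

End Curve.

Arguments rational_points {k K} iota.
Arguments is_genus {k K} iota g.

Section PlaneModel.
Variable k : fieldType.

(* k(x) is {fraction {poly k}}; x is ratX, and c in k is ratC c. *)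
Definition ratX : {fraction {poly k}} := tofrac 'X.
Definition ratC : {rmorphism k -> {fraction {poly k}}} :=
  @tofrac {poly k} \o polyC.

Variable L : fieldExtType {fraction {poly k}}.

Definition const_emb : {rmorphism k -> L} := in_alg L \o ratC.

(* L = k(x, y) with y ^ n = f(x). *)
Definition is_function_field (n : nat) (f : {fraction {poly k}}) (y : L) : Prop :=
  y ^+ n = f%:A /\ <<1; y>>%VS = fullv.

End PlaneModel.

(* Main.v *)
(* Put [s = sqrt q], [n = q - 1] and [Y = 1 / y].  Then
   [Y ^ n = - c / (x ^ (s - 1) * b ^ s)] with [b = x ^ (s - 1) - a ^ s] and
   [c = a * x ^ (s - 1) - 1]; since [a ^ (s + 1) <> 1], the zeros of [x], [b] and [c]
   are simple and disjoint.

   Genus.  The field [F] contains the [n]-th roots of unity, so the functions with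
   poles bounded by [M] times the poles of [x] split into components [u * Y ^ i]
   with [u] in [F(x)], and the orders of [u] at the places of [F(x)] force
   [u = x ^ A_i * b ^ B_i * r], where [A_i] and [B_i] are the ceilings of
   [i / (s + 1)] and [i * s / n] and [r] is any polynomial of bounded degree.  This
   gives the dimension [n * M + 1 - g] for large [M].  By monotonicity of
   [deg D - ell D], it remains to bound every divisor by the zeros of some [z ^ N]
   with [z] in [F(x)]: Riemann's inequality then follows from
   [deg (z)_0 <= n * deg z] (weak approximation, and comparison of the number of
   combinations of [z ^ l * v_j] with that of polynomials of bounded degree).  The
   equality is reached on the fibre [x = 1], which consists of [n] places.

   Rational points.  Above each [x = c] with [c <> 0] in [F] one has [Y ^ n = 1] and
   the automorphisms [Y |-> z * Y] produce [n] distinct places, which exhaust the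
   fibre by the same inequality.  A rational place above [x = 0] or at infinity would
   make [- a], hence [a], an [(s - 1)]-th power. *)

Require Import Defs.
From HB Require Import structures.
From mathcomp Require Import all_boot all_order all_algebra all_field.
From mathcomp Require Import finmap.
From mathcomp Require Import boolp classical_sets cardinality.
From mathcomp Require Import zify ring lra.

Set Implicit Arguments.
Unset Strict Implicit.
Unset Printing Implicit Defensive.

Import Order.TTheory GRing.Theory Num.Theory.
Local Open Scope classical_set_scope.
Local Open Scope card_scope.
Local Open Scope ring_scope.

(** * Free families modulo a subspace *)

(** The identity sum e f = n is not proved in general. Only sum e f <= n is available, so wherever
    equality matters n places are produced explicitly. The degree of L over F(z) is likewise
    replaced by a bound on the dimension of R / zR for subspaces R stable under z
    ([bounded_growth]), which applies both to valuation rings and to semilocal rings.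

    [dimq] returns 0 when there is no finite basis, so nothing can be said of [place_deg] or [ell]
    before finiteness is known; the arguments therefore run on the relation [has_dimq].

    Nothing tells beforehand that L has degree n over F(x), nor that a given point of the line has
    places above it. Places come from Zorn's lemma, applied to subrings that avoid 1/t. A place
    above a zero of c, where Y^n has a simple zero, is totally ramified, and this makes the powers
    of Y independent; only then do the automorphisms of L over F(x) exist. *)

Section FreeModulo.
Variables (F : finFieldType) (L : fieldType) (iota : {rmorphism F -> L}).

Definition subsp (V : set L) :=
  V 0 /\ forall c u v, V u -> V v -> V (iota c * u + v).

Definition free_mod (W : set L) (I : finType) (b : I -> L) :=
  forall c : I -> F, W (\sum_i iota (c i) * b i) -> forall i, c i = 0.

Lemma subsp_sum V (I : finType) (P : pred I) (c : I -> F) (b : I -> L) :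
  subsp V -> (forall i, V (b i)) -> V (\sum_(i | P i) iota (c i) * b i).
Proof.
by move=> [V0 VD] Vb; elim/big_rec: _ => // i u _ Vu; apply: VD.
Qed.

Lemma subspD V u v : subsp V -> V u -> V v -> V (u + v).
Proof. by move=> [_ VD] Vu Vv; have := VD 1 u v Vu Vv; rewrite rmorph1 mul1r. Qed.

Lemma subspN V u : subsp V -> V u -> V (- u).
Proof.
by move=> [V0 VD] Vu; have := VD (-1) u 0 Vu V0; rewrite rmorphN1 mulN1r addr0.
Qed.

Lemma subspB V u v : subsp V -> V u -> V v -> V (u - v).
Proof. by move=> sV Vu Vv; apply/(subspD sV)/(subspN sV). Qed.

Lemma subspZ V c u : subsp V -> V u -> V (iota c * u).
Proof. by move=> [V0 VD] Vu; have := VD c u 0 Vu V0; rewrite addr0. Qed.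

Lemma subsp_zero : subsp [set 0].
Proof. by split=> // c u v /= -> ->; rewrite mulr0 addr0. Qed.

Lemma leq_card_ffun (I J : finType) (f : {ffun I -> F} -> {ffun J -> F}) :
  injective f -> (#|I| <= #|J|)%N.
Proof.
move=> /leq_card; rewrite !card_ffun leq_exp2l //.
exact: finNzRing_gt1.
Qed.

Lemma combB (I : finType) (c d : I -> F) (b : I -> L) :
  \sum_i iota (c i) * b i - \sum_i iota (d i) * b i =
  \sum_i iota (c i - d i) * b i.
Proof.
by rewrite -sumrB; apply: eq_bigr => i _; rewrite rmorphB mulrBl.
Qed.

(** Counting over the finite field: sending the coefficients of a combination of [b] to those of a
    congruent combination of [e] is injective because [b] is free, and this compares [#|F| ^ #|I|]
    with [#|F| ^ #|J|]. *)
Lemma span_free_leq V W (I J : finType) (b : I -> L) (e : J -> L) :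
  subsp V -> subsp W ->
  (forall i, V (b i)) -> free_mod W b ->
  (forall z, V z -> exists c : J -> F, W (z - \sum_j iota (c j) * e j)) ->
  (#|I| <= #|J|)%N.
Proof.
move=> sV sW Vb fb span.
have /choice[f Pf] (c : {ffun I -> F}) : exists d : {ffun J -> F},
    W (\sum_i iota (c i) * b i - \sum_j iota (d j) * e j).
  have [|d Wd] := span (\sum_i iota (c i) * b i); first exact: subsp_sum.
  exists (finfun d); rewrite (eq_bigr (fun j => iota (d j) * e j)) // => j _.
  by rewrite ffunE.
apply: (leq_card_ffun (f := f)) => c d efcd; apply/ffunP => i.
apply/eqP; rewrite -subr_eq0; apply/eqP; move: i.
apply: fb; rewrite -combB; have := subspB sW (Pf c) (Pf d).
by rewrite efcd opprB addrA subrK.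
Qed.

Lemma has_dimqP V W n : subsp W ->
  has_dimq iota V W n <-> exists b : 'I_n -> L,
   [/\ forall i, V (b i), free_mod W b &
     forall z, V z -> exists c : 'I_n -> F, W (z - \sum_j iota (c j) * b j)].
Proof.
move=> sW; split=> [[b Vb Pb]|[b [Vb fb span]]].
  exists b; split=> // [c Wc i|z /Pb[c [Wc _]]]; last by exists c.
  have [c0 [W0 uc]] := Pb _ (Vb i).
  pose d := [ffun i => c0 i + c i].
  have /uc/ffunP/(_ i) : W (b i - \sum_i iota (d i) * b i).
    have := subspB sW W0 Wc; rewrite -addrA -opprD -big_split /=.
    by under eq_bigr do rewrite -mulrDl -rmorphD;
       under [X in _ -> W (_ - X)]eq_bigr do rewrite ffunE.
  by rewrite ffunE => /eqP; rewrite -subr_eq0 opprD addrA subrr add0r oppr_eq0 => /eqP.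
exists b => // z /span[c Wc]; exists (finfun c); split.
  by under eq_bigr do rewrite ffunE.
move=> d Wd; apply/ffunP => i; rewrite ffunE; apply/eqP; rewrite -subr_eq0; apply/eqP.
apply: (fb (fun i => c i - d i)); rewrite -combB.
by have := subspB sW Wd Wc; rewrite opprB addrC addrA subrK.
Qed.

Lemma has_dimq_free V W n (I : finType) (b : I -> L) :
  subsp V -> subsp W -> has_dimq iota V W n ->
  (forall i, V (b i)) -> free_mod W b -> (#|I| <= n)%N.
Proof.
move=> sV sW /(has_dimqP _ _ sW)[e [_ _ span]] Vb fb.
by rewrite -[X in (_ <= X)%N]card_ord; exact: (span_free_leq sV sW Vb fb span).
Qed.

Lemma has_dimq_inj V W m n :
  subsp V -> subsp W -> has_dimq iota V W m -> has_dimq iota V W n -> m = n.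
Proof.
move=> sV sW dm dn; have /(has_dimqP _ _ sW)[b [Vb fb _]] := dm.
have /(has_dimqP _ _ sW)[e [Ve fe _]] := dn.
have := has_dimq_free sV sW dm Ve fe.
have := has_dimq_free sV sW dn Vb fb.
by rewrite !card_ord => h1 h2; apply/eqP; rewrite eqn_leq h1.
Qed.

(** [dimq] picks some admissible dimension, or the default 0; existence and uniqueness of the
    dimension make the choice harmless. *)
Lemma dimqE V W n : subsp V -> subsp W -> has_dimq iota V W n -> dimq iota V W = n.
Proof.
move=> sV sW dn; apply: (has_dimq_inj sV sW) (dn).
by rewrite /dimq; apply: xgetPex; exists n.
Qed.

(** A free family of maximal size spans: a vector outside its span modulo [W] could be adjoined.
    Residue fields and subspaces get their finite dimension in this way. *)
Lemma bounded_has_dimq V W B : subsp V -> subsp W ->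
  (forall m (b : 'I_m -> L), (forall i, V (b i)) -> free_mod W b -> (m <= B)%N) ->
  exists2 n, has_dimq iota V W n & (n <= B)%N.
Proof.
move=> sV sW bd.
pose P m := `[< exists b : 'I_m -> L, (forall i, V (b i)) /\ free_mod W b >].
have exP : exists m, P m.
  by exists 0%N; apply/asboolP; exists (fun=> 0); split; [case | move=> ? _ []].
have bdP m : P m -> (m <= B)%N by move=> /asboolP[b [Vb fb]]; exact: (bd m b).
case: (ex_maxnP exP bdP) => m Pm maxm; exists m; last exact: bdP.
have {Pm}/asboolP[b [Vb fb]] := Pm; apply/has_dimqP => //; exists b; split=> // z Vz.
apply: contrapT => nspan.
suff /maxm : P m.+1 by rewrite ltnn.
apply/asboolP; exists (fun i => if unlift ord0 i is Some j then b j else z); split.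
  by move=> i; case: unliftP.
move=> c; rewrite big_ord_recl unlift_none.
under eq_bigr do rewrite liftK; move=> Wc.
have c0 : c ord0 = 0.
  apply/eqP/negPn/negP => c0; apply: nspan.
  exists (fun j => - (c ord0)^-1 * c (lift ord0 j)).
  have := subspZ (c ord0)^-1 sW Wc; rewrite mulrDr mulrA -rmorphM mulVf // rmorph1 mul1r.
  rewrite mulr_sumr -sumrN; congr (W (_ + _)); apply: eq_bigr => i _.
  by rewrite mulrA -rmorphM -mulNr -rmorphN mulNr opprK.
move=> i; case: (unliftP ord0 i) => [j ->|-> //].
apply: (fb (fun j => c (lift ord0 j))).
by move: Wc; rewrite c0 rmorph0 mul0r add0r.
Qed.

Lemma has_dimq_trans U W V m n :
  subsp U -> subsp W -> subsp V -> U `<=` W -> W `<=` V ->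
  has_dimq iota V W m -> has_dimq iota W U n -> has_dimq iota V U (m + n).
Proof.
move=> sU sW sV UW WV /(has_dimqP _ _ sW)[b [Vb fb spb]].
move=> /(has_dimqP _ _ sU)[e [We fe spe]]; apply/has_dimqP => //.
exists (fun i => match split i with inl j => b j | inr k => e k end).
have sumE (c : 'I_(m + n) -> F) : \sum_i iota (c i) *
    match split i with inl j => b j | inr k => e k end =
    \sum_j iota (c (lshift n j)) * b j + \sum_k iota (c (rshift m k)) * e k.
  rewrite big_split_ord /=; congr (_ + _); apply: eq_bigr => i _.
    by case: split_ordP => j; [move=> /lshift_inj -> | move=> /eqP; rewrite eq_lrshift].
  by case: split_ordP => j; [move=> /eqP; rewrite eq_rlshift | move=> /rshift_inj ->].
split=> [i|c|z Vz].
- by case: split_ordP => j _; [exact: Vb | exact/WV/We].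
- rewrite sumE => Uc.
  have Wb : W (\sum_j iota (c (lshift n j)) * b j).
    have := subspB sW (UW _ Uc) (subsp_sum xpredT (fun k => c (rshift m k)) sW We).
    by rewrite addrK.
  have cb := fb _ Wb.
  have ce : forall k, c (rshift m k) = 0.
    apply: (fe (fun k => c (rshift m k))); move: Uc.
    by rewrite big1 ?add0r // => j _; rewrite cb rmorph0 mul0r.
  by move=> i; case: (split_ordP i) => j ->.
have [c Wc] := spb z Vz; have [d Ud] := spe _ Wc.
pose h i := match split i with inl j => c j | inr k => d k end.
have hl j : h (lshift n j) = c j.
  by rewrite /h; case: split_ordP => k; [move=> /lshift_inj -> | move=> /eqP; rewrite eq_lrshift].
have hr j : h (rshift m j) = d j.
  by rewrite /h; case: split_ordP => k; [move=> /eqP; rewrite eq_rlshift | move=> /rshift_inj ->].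
exists h; rewrite sumE opprD addrA.
under eq_bigr do rewrite hl.
by under [X in U (_ - X)]eq_bigr do rewrite hr.
Qed.

Lemma has_dimq_refl V : subsp V -> has_dimq iota V V 0.
Proof.
move=> sV; apply/has_dimqP => //; exists (fun=> 0); split=> [[]//|c _ []//|z Vz].
by exists (fun=> 0); rewrite big_ord0 subr0.
Qed.

End FreeModulo.

(** * Places and weak approximation *)

Section Places.
Variables (F : finFieldType) (L : fieldType) (iota : {rmorphism F -> L}).
Implicit Types (P Q : place iota) (u v z : L).

Lemma place_inj P Q : (forall z, P z = Q z) -> P = Q.
Proof.
case: P Q => [f f1 f2 f3 f4 f5] [g g1 g2 g3 g4 g5] /= efg.
have {efg} fg : f = g by apply/funext.
by case: g / fg g1 g2 g3 g4 g5 => *; congr Place; exact: Prop_irrelevance.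
Qed.

Lemma ord_1 P : P 1 = 0.
Proof. by have := ord_const P 1; rewrite rmorph1. Qed.

Lemma ordV P u : P u^-1 = - P u.
Proof.
have [->|u0] := eqVneq u 0; first by rewrite invr0 Defs.ord0 oppr0.
apply/eqP; rewrite -subr_eq0 opprK addrC -ordM ?invr_eq0 //.
by rewrite divff // ord_1.
Qed.

Lemma ordN P u : P (- u) = P u.
Proof.
have [->|u0] := eqVneq u 0; first by rewrite oppr0.
rewrite -mulN1r ordM ?oppr_eq0 ?oner_eq0 //.
by have := ord_const P (-1); rewrite rmorphN1 => ->; rewrite add0r.
Qed.

Lemma ordX P u (n : nat) : P (u ^+ n) = n%:Z * P u.
Proof.
have [->|u0] := eqVneq u 0.
  by case: n => [|n]; rewrite ?expr0 ?ord_1 ?mul0r // expr0n /= Defs.ord0 mulr0.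
elim: n => [|n IHn]; first by rewrite expr0 ord_1 mul0r.
by rewrite exprS ordM ?expf_neq0 // IHn intS mulrDl mul1r.
Qed.

Lemma ordXz P u (n : int) : P (u ^ n) = n * P u.
Proof.
case: n => n; first exact: ordX.
by rewrite NegzE -exprz_inv -[_ ^ _]/(_ ^+ n.+1) ordX ordV mulrN mulNr.
Qed.

Lemma ord_div P u v : u != 0 -> v != 0 -> P (u / v) = P u - P v.
Proof. by move=> u0 v0; rewrite ordM ?invr_eq0 // ordV. Qed.

Lemma ord_prod P (I : Type) (r : seq I) (C : pred I) (h : I -> L) :
  (forall i, C i -> h i != 0) ->
  P (\prod_(i <- r | C i) h i) = \sum_(i <- r | C i) P (h i).
Proof.
move=> h0; suff [] : \prod_(i <- r | C i) h i != 0 /\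
  P (\prod_(i <- r | C i) h i) = \sum_(i <- r | C i) P (h i) by [].
elim/big_rec2: _ => [|i a u Ci [u0 <-]]; first by rewrite oner_neq0 ord_1.
by rewrite mulf_neq0 ?h0 // ordM ?h0.
Qed.

Lemma ord_ge_nz P n z : z != 0 -> ord_ge P n z -> n <= P z.
Proof. by move=> z0 [/eqP|//]; rewrite (negPf z0). Qed.

Lemma ord_ge0 P n : ord_ge P n 0. Proof. by left. Qed.

Lemma ord_geD P n u v : ord_ge P n u -> ord_ge P n v -> ord_ge P n (u + v).
Proof.
move=> gu gv; have [->|u0] := eqVneq u 0; first by rewrite add0r.
have [->|v0] := eqVneq v 0; first by rewrite addr0.
have [->|uv0] := eqVneq (u + v) 0; first by left.
right; apply: le_trans (ordD P u0 v0 uv0).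
by rewrite le_min !ord_ge_nz.
Qed.

Lemma ord_geN P n u : ord_ge P n u -> ord_ge P n (- u).
Proof. by case=> [->|h]; [left; rewrite oppr0 | right; rewrite ordN]. Qed.

Lemma ord_geB P n u v : ord_ge P n u -> ord_ge P n v -> ord_ge P n (u - v).
Proof. by move=> gu gv; apply/ord_geD/ord_geN. Qed.

Lemma ord_geM P m n u v : ord_ge P m u -> ord_ge P n v -> ord_ge P (m + n) (u * v).
Proof.
case=> [->|hu]; first by left; rewrite mul0r.
case=> [->|hv]; first by left; rewrite mulr0.
have [->|u0] := eqVneq u 0; first by left; rewrite mul0r.
have [->|v0] := eqVneq v 0; first by left; rewrite mulr0.
by right; rewrite ordM // lerD.
Qed.

Lemma ord_geW P m n u : n <= m -> ord_ge P m u -> ord_ge P n u.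
Proof. by move=> nm [->|h]; [left | right; apply: le_trans h]. Qed.

Lemma ord_ge_const P c : ord_ge P 0 (iota c).
Proof. by right; rewrite ord_const. Qed.

Lemma ord_ge_ord P u : ord_ge P (P u) u. Proof. by right. Qed.

Lemma ord_geM_eq P n u z : u != 0 -> ord_ge P n (z * u) <-> ord_ge P (n - P u) z.
Proof.
move=> u0; split=> [h|h].
  rewrite -[z](mulfK u0) -ordV; exact: ord_geM h (ord_ge_ord P _).
by rewrite -(subrK (P u) n); apply: ord_geM h (ord_ge_ord P _).
Qed.

Lemma ord_geX P u (n : nat) m : ord_ge P m u -> ord_ge P (n%:Z * m) (u ^+ n).
Proof.
have [->|u0 h] := eqVneq u 0.
  by case: n => [_|n _]; [rewrite mul0r; right; rewrite expr0 ord_1 |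
     left; rewrite expr0n].
by right; rewrite ordX ler_wpM2l // ord_ge_nz.
Qed.

Lemma ord_ge_sum P n (I : Type) (r : seq I) (C : pred I) (h : I -> L) :
  (forall i, C i -> ord_ge P n (h i)) -> ord_ge P n (\sum_(i <- r | C i) h i).
Proof.
move=> gh; elim/big_rec: _ => [|i u Ci gu]; first by left.
exact/ord_geD/gu/gh.
Qed.

Lemma subsp_ord_ge P n : subsp iota (ord_ge P n).
Proof.
split=> [|c u v gu gv]; first exact: ord_ge0.
by apply: ord_geD => //; rewrite -[n]add0r; apply: ord_geM (ord_ge_const _ _) gu.
Qed.

(** Strict triangle inequality: if [u + v] had larger order than [u], so would [u = (u + v) - v].
    Stating the hypothesis with [ord_ge] covers [v = 0], whose order is a dummy. *)
Lemma ord_addl P u v : u != 0 -> ord_ge P (P u + 1) v -> u + v != 0 /\ P (u + v) = P u.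
Proof.
move=> u0 gv.
have nlt : ~ ord_ge P (P u + 1) u.
  by move=> /(ord_ge_nz u0); rewrite lezD1 ltxx.
have uv0 : u + v != 0.
  apply/eqP => uv; apply: nlt; rewrite -[X in ord_ge P _ X](addrK v) uv sub0r.
  exact: ord_geN.
split=> //; apply/eqP; rewrite eq_le; apply/andP; split; last first.
  apply: ord_ge_nz => //; apply: ord_geD; first exact: ord_ge_ord.
  by apply: ord_geW gv; rewrite lerDl.
rewrite leNgt -lezD1; apply/negP => h; apply: nlt; rewrite -[X in ord_ge P _ X](addrK v).
by apply: ord_geB gv; right.
Qed.

Lemma ord_ge1_addl P u v : u != 0 -> P u = 0 -> ord_ge P 1 v -> u + v != 0 /\ P (u + v) = 0.
Proof. by move=> u0 Pu gv; have := @ord_addl P u v u0; rewrite Pu add0r => /(_ gv). Qed.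

(** A discrete valuation ring is a maximal subring. Dividing [z] by a power of a uniformizer [t] of
    [P] leaves a unit for [P], hence for [Q], so [Q] is [Q t] times [P]; normalization of [Q] forces
    [Q t = 1]. *)
Lemma place_eq_of_le P Q :
  (forall z, z != 0 -> 0 <= P z -> 0 <= Q z) -> P = Q.
Proof.
move=> PQ; have [t [t0 Pt]] := ord_unif P; have [t' [t'0 Qt']] := ord_unif Q.
have unitQ u : u != 0 -> P u = 0 -> Q u = 0.
  move=> u0 Pu; apply/eqP; rewrite eq_le PQ ?Pu // andbT.
  by rewrite -oppr_ge0 -ordV PQ ?invr_eq0 // ordV Pu oppr0.
have QE z : z != 0 -> Q z = P z * Q t.
  move=> z0; have := unitQ (z / t ^ (P z)).
  rewrite mulf_neq0 ?invr_eq0 ?expfz_neq0 // !ord_div ?expfz_neq0 // !ordXz Pt mulr1 subrr.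
  by move=> /(_ isT erefl)/eqP; rewrite subr_eq0 => /eqP.
have Qt : Q t = 1.
  have Qt_ge0 : 0 <= Q t by rewrite PQ // Pt.
  have := QE t' t'0; rewrite Qt'; move: (P t') (Q t) Qt_ge0 => m n n0 e.
  have m0 : 0 < m by nia.
  have n1 : 0 < n by nia.
  nia.
apply: place_inj => z; have [->|z0] := eqVneq z 0; first by rewrite !Defs.ord0.
by rewrite QE // Qt mulr1.
Qed.

Lemma place_sep P Q : P <> Q -> exists w, [/\ w != 0, 0 < P w & Q w < 0].
Proof.
have half P' Q' : P' <> Q' -> exists w, [/\ w != 0, 0 <= P' w & Q' w < 0].
  move=> PQ; apply: contrapT => h; apply/PQ/place_eq_of_le => z z0 Pz.
  by rewrite leNgt; apply/negP => Qz; apply: h; exists z.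
move=> PQ; have [w [w0 Pw Qw]] := half _ _ PQ.
have [w' [w'0 Qw' Pw']] := half _ _ (nesym PQ).
exists (w / w'); rewrite mulf_neq0 ?invr_eq0 // !ord_div //; split=> //; lia.
Qed.

Lemma place_sep_seq P (S : seq (place iota)) : P \notin S ->
  exists w, [/\ w != 0, 0 < P w & forall Q, Q \in S -> Q w < 0].
Proof.
elim: S => [|Q S IHS].
  by have [t [t0 Pt]] := ord_unif P; exists t; rewrite Pt; split.
rewrite inE negb_or => /andP[/eqP PQ /IHS[w [w0 Pw Sw]]].
have [Qw|Qw] := ltP (Q w) 0.
  by exists w; split=> // Q'; rewrite inE => /orP[/eqP->//|/Sw].
have [w' [w'0 Pw' Qw']] := place_sep PQ.
(* With this [N] the power [w ^+ N.+1] dominates [w'] at the places of [S], where [w] has a pole,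
   while at [Q], where [w] is regular, the pole of [w'] survives. *)
pose N := \sum_(Q' <- S) `|Q' w'|%N.
have NP Q' : Q' \in S -> (`|Q' w'| <= N)%N.
  by move=> Q'S; rewrite /N (big_rem Q') //= leq_addr.
have [w1 Qw1] : w' + w ^+ N.+1 != 0 /\ Q (w' + w ^+ N.+1) = Q w'.
  by apply: ord_addl => //; right; rewrite ordX; nia.
exists (w' + w ^+ N.+1); split=> [//||Q'].
  have : ord_ge P 1 (w' + w ^+ N.+1).
    by apply: ord_geD; right; rewrite ?ordX; nia.
  by move=> /(ord_ge_nz w1).
rewrite inE => /orP[/eqP->|Q'S]; first by rewrite Qw1.
have Q'w := Sw _ Q'S; have leN := NP _ Q'S; rewrite addrC.
have [_ ->] : w ^+ N.+1 + w' != 0 /\ Q' (w ^+ N.+1 + w') = Q' (w ^+ N.+1).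
  by apply: ord_addl; rewrite ?expf_neq0 //; right; rewrite ordX; nia.
rewrite ordX; nia.
Qed.

(** [e = 1 / (1 + w ^+ N.+1)], where [w] vanishes at [P] and has poles on [S], is close to 1 at [P]
    and close to 0 on [S]. *)
Lemma approx_unit P (S : seq (place iota)) (N : nat) : P \notin S ->
  exists e, [/\ e != 0, P e = 0, ord_ge P N (e - 1) &
    forall Q, Q \in S -> N%:Z <= Q e].
Proof.
move=> /place_sep_seq[w [w0 Pw Sw]].
have wN0 : w ^+ N.+1 != 0 by rewrite expf_neq0.
have [d0 Pd] : 1 + w ^+ N.+1 != 0 /\ P (1 + w ^+ N.+1) = 0.
  by apply: ord_ge1_addl; rewrite ?oner_eq0 ?ord_1 //; right; rewrite ordX; nia.
exists (1 + w ^+ N.+1)^-1; split=> [||| Q QS]; rewrite ?invr_eq0 ?ordV ?Pd //.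
  have -> : (1 + w ^+ N.+1)^-1 - 1 = - (w ^+ N.+1 / (1 + w ^+ N.+1)).
    by field.
  by right; rewrite ordN ord_div // Pd ordX; nia.
have Qw := Sw _ QS.
have [_] : w ^+ N.+1 + 1 != 0 /\ Q (w ^+ N.+1 + 1) = Q (w ^+ N.+1).
  by apply: ord_addl => //; right; rewrite ord_1 ordX; nia.
rewrite addrC => ->; rewrite ordX; nia.
Qed.

End Places.

(** * Semilocal rings and the inequality sum e f <= n *)

Section SemiLocal.
Variables (F : finFieldType) (L : fieldType) (iota : {rmorphism F -> L}).
Implicit Types (P Q : place iota) (z : L) (N : place iota -> int).

Definition val_ge (S : set (place iota)) N : set L :=
  [set z | forall P, S P -> ord_ge P (N P) z].

Definition add_places N (l : seq (place iota)) : place iota -> int :=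
  fun Q => N Q + (count_mem Q l)%:Z.

(** Relational form of [place_deg], which also asserts that a finite basis exists; the value 0 of
    [place_deg] may be a mere default. *)
Definition has_res_deg P d := has_dimq iota (ord_ge P 0) (ord_ge P 1) d.

Lemma subsp_val_ge S N : subsp iota (val_ge S N).
Proof.
split=> [P _|c u v gu gv P SP]; first exact: ord_ge0.
by have [_] := subsp_ord_ge P (N P); apply; [apply: gu | apply: gv].
Qed.

Lemma add_places_cons N P l :
  add_places N (P :: l) = add_places (add_places N l) [:: P].
Proof.
apply/funext => Q; rewrite /add_places /= addn0 -addrA; congr (_ + _).
by rewrite -PoszD addnC.
Qed.

Lemma val_geS S N l : val_ge S (add_places N l) `<=` val_ge S N.
Proof. by move=> z gz P SP; apply: ord_geW (gz P SP); rewrite lerDl. Qed.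

Lemma has_res_degE P d : has_res_deg P d -> place_deg P = d.
Proof. by apply: dimqE; exact: subsp_ord_ge. Qed.

Lemma res_deg_gt0 P d : has_res_deg P d -> (0 < d)%N.
Proof.
move=> dd; have := has_dimq_free (subsp_ord_ge P 0) (subsp_ord_ge P 1) dd
  (I := 'I_1) (b := fun=> 1).
rewrite card_ord; apply=> [_|c]; first by right; rewrite ord_1.
rewrite big_ord1 mulr1 => h i; rewrite (ord1 i); apply/eqP/negPn/negP => c0.
have := ord_ge_nz (_ : iota (c ord0) != 0) h.
by rewrite fmorph_eq0 c0 ord_const => /(_ isT).
Qed.

(** Multiplication by [t ^ (- N P)] embeds the quotient into the residue field at [P], the
    conditions at the other places being the same on both sides. *)
Lemma val_ge_step_le S N P d : S P -> has_res_deg P d ->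
  exists2 e, has_dimq iota (val_ge S N) (val_ge S (add_places N [:: P])) e &
    (e <= d)%N.
Proof.
move=> SP dd; have [t [t0 Pt]] := ord_unif P.
have tN0 : t ^ (- N P) != 0 by rewrite expfz_neq0.
have PtN : P (t ^ (- N P)) = - N P by rewrite ordXz Pt mulr1.
apply: bounded_has_dimq; [exact: subsp_val_ge | exact: subsp_val_ge |].
move=> m b Vb fb; rewrite -[m]card_ord.
apply: (has_dimq_free (subsp_ord_ge P 0) (subsp_ord_ge P 1) dd
  (b := fun i => b i * t ^ (- N P))) => [i|c].
  by apply/(ord_geM_eq _ _ _ tN0); rewrite PtN sub0r opprK; exact: Vb.
under eq_bigr do rewrite mulrA; rewrite -mulr_suml => /(ord_geM_eq _ _ _ tN0).
rewrite PtN opprK => h; apply: fb => Q SQ.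
rewrite /add_places /= addn0; case: eqVneq => [<-|_]; first by rewrite addrC.
by rewrite addr0; apply: ord_ge_sum => i _; rewrite -[N Q]add0r;
   apply: ord_geM (ord_ge_const _ _) _; apply: Vb.
Qed.

(** For finite [S] the embedding into the residue field is onto: weak approximation provides [e]
    close to 1 at [P] and small elsewhere on [S], and [e * t ^ N P] lifts a residue basis. *)
Lemma val_ge_step_eq (S : seq (place iota)) N P d : uniq S -> P \in S ->
  has_res_deg P d ->
  has_dimq iota (val_ge [set` S] N) (val_ge [set` S] (add_places N [:: P])) d.
Proof.
move=> uS PS /(has_dimqP _ _ (subsp_ord_ge P 1))[b [Ob fb spb]].
have [t [t0 Pt]] := ord_unif P.
have tN0 : t ^ (N P) != 0 by rewrite expfz_neq0.
have PtN : P (t ^ (N P)) = N P by rewrite ordXz Pt mulr1.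
(* Exceeds every deficit [N Q - Q (t ^ N P * b i)]; an [e] of larger order at the other places makes
   the lifts meet the conditions there. *)
pose bound := (\sum_(Q <- S) \sum_i `|(N Q - Q (t ^ N P * b i))%R|)%N.
have PSr : P \notin rem P S by rewrite mem_rem_uniq // inE eqxx.
have [e [e0 Pe Pe1 Qe]] := approx_unit bound.+1 PSr.
have et0 : e * t ^ N P != 0 by rewrite mulf_neq0.
have Pet : P (e * t ^ N P) = N P by rewrite ordM // Pe add0r.
have memS Q : Q \in S -> Q = P \/ (Q \in rem P S).
  by move=> QS; rewrite mem_rem_uniq // inE QS andbT; case: eqVneq; [left | right].
have bN Q i : Q \in rem P S -> ord_ge Q (N Q) (e * t ^ N P * b i).
  move=> QS; have [->|bi0] := eqVneq (b i) 0; first by left; rewrite mulr0.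
  right; rewrite -mulrA ordM ?mulf_neq0 //.
  have /memS := mem_rem QS; have := Qe _ QS => Q1 _.
  have Q2 : (`|(N Q - Q (t ^ N P * b i))%R| <= bound)%N.
    rewrite /bound (big_rem Q) ?(mem_rem QS) //= (bigD1 i) //= -addnA.
    exact: leq_addr.
  move: Q1 Q2; move: (Q e) (N Q) (Q (t ^ N P * b i)) => x1 x2 x3; lia.
have sumE (c : 'I_d -> F) : \sum_i iota (c i) * (e * t ^ N P * b i) =
    (\sum_i iota (c i) * b i) * (e * t ^ N P).
  by rewrite mulr_suml; apply: eq_bigr => i _; rewrite -!mulrA [b i * _]mulrCA (mulrC _ (b i)).
have addE Q : Q \in rem P S -> add_places N [:: P] Q = N Q.
  move=> QS; rewrite /add_places /= addn0; case: eqVneq QS => [<-|_ _].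
    by rewrite (negPf PSr).
  by rewrite addr0.
have addPE : add_places N [:: P] P = N P + 1 by rewrite /add_places /= eqxx.
apply/has_dimqP; first exact: subsp_val_ge.
exists (fun i => e * t ^ N P * b i); split=> [i Q /memS[->|QS]|c h|z Vz].
- rewrite mulrC; apply/(ord_geM_eq _ _ _ et0); rewrite Pet subrr; exact: Ob.
- exact: bN.
- apply: fb; have := h P PS; rewrite sumE => /(ord_geM_eq _ _ _ et0).
  by rewrite Pet addPE addrAC subrr add0r.
have [|c Pc] := spb (z / t ^ N P).
  by apply/(ord_geM_eq _ _ _ _); rewrite ?invr_eq0 // ordV PtN add0r opprK; exact: Vz.
exists c => Q /memS[->|QS]; last first.
  rewrite addE //; apply: ord_geB; first exact/Vz/(mem_rem QS).
  apply: ord_ge_sum => i _; rewrite -[N Q]add0r.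
  apply: ord_geM (ord_ge_const _ _) _; exact: bN.
rewrite sumE addPE; set w := \sum_i _ in Pc *.
(* The first term is small at [P] because [w] has the residue of [z / t ^ N P], the second because
   [e - 1] is small. *)
have -> : z - w * (e * t ^ N P) = (z / t ^ N P - w) * t ^ N P - (e - 1) * (w * t ^ N P).
  by rewrite mulrBl divfK //; ring.
apply: ord_geB; first by apply/(ord_geM_eq _ _ _ tN0); rewrite PtN addrAC subrr add0r.
rewrite addrC; apply: ord_geM; first by apply: ord_geW Pe1; lia.
apply/(ord_geM_eq _ _ _ tN0); rewrite PtN subrr; apply: ord_ge_sum => i _.
by rewrite -[0]add0r; apply: ord_geM (ord_ge_const _ _) (Ob i).
Qed.

Lemma semilocal_dim (S : seq (place iota)) N l : uniq S ->
  (forall P, P \in l -> P \in S /\ has_res_deg P (place_deg P)) ->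
  has_dimq iota (val_ge [set` S] N) (val_ge [set` S] (add_places N l))
    (\sum_(P <- l) place_deg P).
Proof.
move=> uS; elim: l => [_|P l IHl Pl].
  rewrite big_nil (_ : add_places N [::] = N); last first.
    by apply/funext => Q; rewrite /add_places addr0.
  exact/has_dimq_refl/subsp_val_ge.
rewrite big_cons addnC add_places_cons.
have [PS dP] := Pl P (mem_head _ _).
apply: (@has_dimq_trans _ _ _ _ (val_ge [set` S] (add_places N l)));
  try exact: subsp_val_ge; try exact: val_geS.
  by apply: IHl => Q Ql; apply: Pl; rewrite inE Ql orbT.
exact: val_ge_step_eq.
Qed.

Lemma subspace_has_dimq V W n : subsp iota V -> subsp iota W -> W `<=` V ->
  has_dimq iota V [set 0] n -> exists m, has_dimq iota W [set 0] m.
Proof.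
move=> sV sW WV dV.
have [||m b Wb fb|m dm _] := @bounded_has_dimq _ _ iota W [set 0] n => //.
- exact: subsp_zero.
- rewrite -[m]card_ord; apply: (has_dimq_free sV (subsp_zero _) dV _ fb).
  by move=> i; apply/WV/Wb.
by exists m.
Qed.

(** [S] may be infinite here, so each step is only bounded by the residue degree. Taken over all
    places, this controls the drop of [ell] when a divisor shrinks. *)
Lemma val_ge_chain_le S N l n :
  (forall P, P \in l -> S P /\ has_res_deg P (place_deg P)) ->
  has_dimq iota (val_ge S N) [set 0] n ->
  exists2 m, has_dimq iota (val_ge S (add_places N l)) [set 0] m &
    (n <= m + \sum_(P <- l) place_deg P)%N.
Proof.
move=> Pl dn; elim: l Pl => [_|P l IHl Pl].
  exists n; last by rewrite big_nil addn0.
  by rewrite (_ : add_places N [::] = N) //; apply/funext => Q; rewrite /add_places addr0.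
have [|m dm nm] := IHl; first by move=> Q Ql; apply: Pl; rewrite inE Ql orbT.
have [SP dP] := Pl P (mem_head _ _).
have [e de ed] := val_ge_step_le (add_places N l) SP dP.
have [m' dm'] := subspace_has_dimq (subsp_val_ge _ _) (subsp_val_ge _ _)
  (@val_geS S (add_places N l) [:: P]) dm.
have := has_dimq_inj (subsp_val_ge _ _) (subsp_zero _) dm
  (has_dimq_trans (subsp_zero _) (subsp_val_ge _ _) (subsp_val_ge _ _) _ _ de dm').
move=> mE; exists m'; first by rewrite add_places_cons.
rewrite big_cons; have {}mE : m = (e + m')%N.
  apply: mE; last exact: val_geS.
  by move=> _ -> Q _; exact: ord_ge0.
lia.
Qed.

Definition multiset (S : seq (place iota)) (k : place iota -> nat) :=
  flatten [seq nseq (k P) P | P <- S].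

Lemma sum_multiset S k (d : place iota -> nat) :
  (\sum_(P <- multiset S k) d P = \sum_(P <- S) k P * d P)%N.
Proof.
rewrite big_flatten big_map; apply: eq_bigr => P _.
by rewrite big_nseq iter_addn_0 mulnC.
Qed.

Lemma count_multiset S k Q : uniq S ->
  count_mem Q (multiset S k) = if Q \in S then k Q else 0%N.
Proof.
rewrite /multiset; elim: S => //= P S IHS /andP[PS /IHS].
rewrite count_cat => ->; rewrite inE count_nseq /= [P == Q]eq_sym.
by case: eqVneq => [->|_] /=; rewrite ?(negPf PS) ?mul1n ?addn0 ?mul0n.
Qed.

Lemma mem_multiset S k P : P \in multiset S k -> (P \in S) && (0 < k P)%N.
Proof.
move=> /flatten_mapP[Q QS]; rewrite mem_nseq => /andP[kQ /eqP->].
by rewrite QS kQ.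
Qed.

(** Substitute for [L : F(z)] <= B: as [[set w | R (w / z)]] is zR, it bounds the dimension of R /
    zR for every subspace [R] stable under [z]. *)
Definition bounded_growth (z : L) (B : nat) :=
  forall (R : set L) m (v : 'I_m -> L), subsp iota R ->
  (forall u, R u -> R (z * u)) -> (forall i, R (v i)) ->
  free_mod iota [set w | R (w / z)] v -> (m <= B)%N.

(** Take for [R] the valuation ring of [P]: since [P z > 0], zR lies in the maximal ideal, so the
    residue field is a quotient of R / zR. *)
Lemma growth_res_deg z B P : bounded_growth z B -> z != 0 -> 0 < P z ->
  has_res_deg P (place_deg P).
Proof.
move=> gz z0 Pz; have [||m b Vb fb|d dd _] :=
  @bounded_has_dimq _ _ iota (ord_ge P 0) (ord_ge P 1) B.
- exact: subsp_ord_ge.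
- exact: subsp_ord_ge.
- apply: (gz _ _ b (subsp_ord_ge P 0)) => // [u gu|c].
    by rewrite -[0]add0r; apply: ord_geM gu; right; exact: ltW.
  move=> /(ord_geM_eq _ _ _ _); rewrite invr_eq0 => /(_ z0); rewrite ordV opprK add0r.
  by move=> h; apply: fb; apply: ord_geW h.
by rewrite (has_res_degE dd).
Qed.

(** Take for [R] the semilocal ring of [S]: zR is cut out by the orders of [z], and [semilocal_dim]
    computes the dimension of R / zR as the weighted sum. *)
Lemma fundamental_ineq z B (S : seq (place iota)) : bounded_growth z B -> z != 0 ->
  uniq S -> (forall P, P \in S -> 0 <= P z) ->
  (\sum_(P <- S) `|P z| * place_deg P <= B)%N.
Proof.
move=> gz z0 uS Sz; rewrite -(sum_multiset S (fun P => `|P z|)%N); set l := multiset _ _.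
have lP P : P \in l -> P \in S /\ has_res_deg P (place_deg P).
  move=> /mem_multiset/andP[PS Pz]; split=> //.
  by apply: growth_res_deg gz z0 _; have := Sz _ PS; lia.
have [b [Vb fb _]] := (has_dimqP _ _ (subsp_val_ge _ _)).1 (semilocal_dim (fun=> 0) uS lP).
apply: (gz _ _ b (subsp_val_ge _ _) _ Vb) => [u Ru P PS|c h].
  by rewrite -[0]add0r; apply: ord_geM (Ru P PS); right; exact: Sz.
apply: fb => P PS; have := h P PS; move=> /(ord_geM_eq _ _ _ _).
rewrite invr_eq0 => /(_ z0); rewrite ordV opprK.
by rewrite /add_places count_multiset // (_ : P \in S) // gez0_abs // Sz.
Qed.

End SemiLocal.

(** * Finite extensions of the rational function field *)

Section RationalBase.
Variables (F : finFieldType) (L : fieldExtType {fraction {poly F}}).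
Local Notation K := {fraction {poly F}}.
Local Notation "h %:F" := (@tofrac _ h).

Definition polyL (h : {poly F}) : L := (h%:F)%:A.
Arguments polyL : simpl never.

HB.instance Definition _ :=
  GRing.RMorphism.copy polyL (in_alg L \o @tofrac {poly F}).

Lemma polyL_eq0 h : (polyL h == 0) = (h == 0).
Proof. by rewrite -[polyL h]/(in_alg L h%:F) fmorph_eq0 tofrac_eq0. Qed.

Lemma polyL0 : polyL 0 = 0. Proof. exact: rmorph0. Qed.
Lemma polyLN h : polyL (- h) = - polyL h. Proof. exact: rmorphN. Qed.
Lemma polyLM h g : polyL (h * g) = polyL h * polyL g. Proof. exact: rmorphM. Qed.
Lemma polyLX h n : polyL (h ^+ n) = polyL h ^+ n. Proof. exact: rmorphXn. Qed.

Lemma const_embE c : const_emb L c = polyL c%:P. Proof. by []. Qed.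

Lemma polyL_frac (a b : {poly F}) : (a%:F / b%:F)%:A = polyL a / polyL b :> L.
Proof. by rewrite -[LHS]/(in_alg L _) fmorph_div. Qed.

Lemma frac_num_den (r : K) : exists a b : {poly F}, b != 0 /\ r = a%:F / b%:F.
Proof.
elim/quotW: r => x; exists (\n_x), (\d_x); split; first exact: denom_ratioP.
have d0 : (\d_x)%:F != 0 by rewrite tofrac_eq0 denom_ratioP.
apply: (mulIf d0); rewrite divfK //; unlock tofrac.
rewrite -[LHS]FracField.pi_mul; apply/eqmodP; rewrite /= FracField.equivfE /FracField.mulf.
rewrite !numden_Ratio ?(oner_neq0, mulf_neq0, denom_ratioP) //.
by apply/eqP; ring.
Qed.

Lemma common_den (I : finType) (r : I -> K) :
  exists (d : {poly F}) (N : I -> {poly F}), d != 0 /\ forall i, r i = (N i)%:F / d%:F.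
Proof.
have /choice[a /choice[b ab]] := fun i => frac_num_den (r i).
exists (\prod_i b i), (fun i => a i * \prod_(j | j != i) b j).
split; first by apply/prodf_neq0 => i _; case: (ab i).
move=> i; have [bi0 ->] := ab i.
rewrite (_ : \prod_i b i = b i * \prod_(j | j != i) b j); last by rewrite (bigD1 i).
rewrite !tofracM.
rewrite -mulf_div divff ?mulr1 //.
by rewrite tofrac_eq0; apply/prodf_neq0 => j _; case: (ab j).
Qed.

(** In a relation, the term [l = 0] is minus [z] times an element of [R], so its coefficients vanish
    by freeness modulo zR; then divide by [z] and repeat. *)
Lemma free_powers (R : set L) m (v : 'I_m -> L) z M (c : 'I_M -> 'I_m -> F) :
  subsp (const_emb L) R -> z != 0 ->
  (forall u, R u -> R (z * u)) -> (forall i, R (v i)) ->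
  free_mod (const_emb L) [set w | R (w / z)] v ->
  \sum_(l < M) z ^+ l * \sum_j const_emb L (c l j) * v j = 0 -> forall l j, c l j = 0.
Proof.
move=> sR z0 Rz Rv fv; elim: M c => [c _ []//|M IHM c].
rewrite big_ord_recl expr0 mul1r.
under [X in _ + X]eq_bigr do rewrite lift0 exprS -mulrA; rewrite -mulr_sumr.
set u0 := \sum_j _; set w := \sum_l _ => /eqP; rewrite addr_eq0 => /eqP u0E.
have Rw : R w.
  rewrite /w; elim/big_rec: _ => [|l u _ Ru]; first by case: sR.
  apply: (subspD sR) Ru; elim: (nat_of_ord l) => [|k IHk].
    by rewrite expr0 mul1r; apply: subsp_sum.
  by rewrite exprS -mulrA; apply: Rz.
have c0 : forall j, c ord0 j = 0.
  by apply: fv; rewrite /= -/u0 u0E mulrC mulrN mulKf //; apply: subspN sR Rw.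
have w0 : w = 0.
  have u00 : u0 = 0 by rewrite /u0 big1 // => j _; rewrite c0 rmorph0 mul0r.
  by move/eqP: u0E; rewrite u00 eq_sym oppr_eq0 mulf_eq0 (negPf z0) => /eqP.
have cS := IHM (fun l => c (lift ord0 l)) w0.
by move=> l; case: (unliftP ord0 l) => [l' ->|->].
Qed.

Lemma size_sum_leq (I : finType) (p : I -> {poly F}) n :
  (forall i, (size (p i) <= n)%N) -> (size (\sum_i p i)%R <= n)%N.
Proof.
move=> pn; apply: leq_trans (size_sum _ _ _) _; apply/bigmax_leqP => i _; exact: pn.
Qed.

Lemma size_exp_degree (p : {poly F}) m k :
  (size p <= m.+1)%N -> (size (p ^+ k)%R <= (k * m).+1)%N.
Proof.
move=> pm; apply: leq_trans (size_poly_exp_leq _ _) _; rewrite ltnS mulnC leq_mul2l.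
by rewrite (_ : (size p).-1 <= m)%N ?orbT //; move: pm; case: size.
Qed.

(* Over the field [k(z)], which has degree [m] below [k(x)], the family would be
   free; this is expressed by comparing the number of combinations
   [sum c_lj z^l v_j], [l < M], with the number of polynomials of bounded
   degree, as [M] tends to infinity. *)
Lemma rational_growth n (e : 'I_n -> L) (h g : {poly F}) m :
  (forall w : L, exists c : 'I_n -> K, w = \sum_i c i *: e i) ->
  h != 0 -> g != 0 -> (size h <= m.+1)%N -> (size g <= m.+1)%N ->
  bounded_growth (const_emb L) (polyL h / polyL g) (n * m).
Proof.
move=> span h0 g0 sh sg R D v sR Rz Rv fv; set z := polyL h / polyL g in Rz fv *.
have hL0 : polyL h != 0 by rewrite polyL_eq0.
have gL0 : polyL g != 0 by rewrite polyL_eq0.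
have z0 : z != 0 by rewrite mulf_neq0 ?invr_eq0.
have /choice[r rE] := fun j => span (v j).
have [d [N [d0 NE]]] := common_den (fun ji : 'I_D * 'I_n => r ji.1 ji.2).
have dL0 : polyL d != 0 by rewrite polyL_eq0.
have vE j : polyL d * v j = \sum_i polyL (N (j, i)) * e i.
  rewrite rE mulr_sumr; apply: eq_bigr => i _.
  rewrite (NE (j, i)) -mulr_algl polyL_frac mulrA mulrCA divff //.
  by rewrite mulr1.
(* [C] is independent of the number [M] of powers of [z]. If [D > n * m], then [M = n * C + 1] gives
   [M * D > n * (M * m + C)], against the injectivity below. *)
pose C := (\max_ji size (N ji))%N.
rewrite leqNgt; apply/negP => ltD; pose M := (n * C).+1.
(* Coordinates on [e] of the combination of the [z ^ l * v_j], after multiplication by [g ^ M * d]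
   to clear denominators. *)
pose p (c : 'I_M * 'I_D -> F) i : {poly F} :=
  \sum_lj c lj *: (h ^+ lj.1 * g ^+ (M - lj.1) * N (lj.2, i)).
have size_p c i : (size (p c i) <= M * m + C)%N.
  apply: size_sum_leq => -[l j] /=.
  have s1 := size_exp_degree l sh; have s2 := size_exp_degree (M - l) sg.
  have s3 : (size (N (j, i)) <= C)%N by exact: (leq_bigmax (j, i)).
  apply: leq_trans (size_scale_leq _ _) _.
  apply: leq_trans (size_polyMleq _ _) _.
  have := size_polyMleq (h ^+ l) (g ^+ (M - l)).
  have -> : (M * m = l * m + (M - l) * m)%N by rewrite -mulnDl subnKC // ltnW.
  move: s1 s2 s3; move: (size _) (size (h ^+ l)) (size (g ^+ (M - l))) (size (N (j, i))).
  move: (l * m)%N ((M - l) * m)%N => u1 u2 u3 u4 u5 u6 *.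
  apply: leq_trans (_ : (u3 + u6).-1 <= _)%N; [done | lia].
pose f (c : {ffun 'I_M * 'I_D -> F}) : {ffun 'I_n * 'I_(M * m + C) -> F} :=
  [ffun ik : 'I_n * 'I_(M * m + C) => (p c ik.1)`_ik.2].
have pB c c' i : p c i - p c' i = p (fun lj => c lj - c' lj) i.
  by rewrite -sumrB; apply: eq_bigr => lj _; rewrite scalerBl.
have finj : injective f.
  move=> c c' fcc'; apply/ffunP => -[l j]; apply/eqP; rewrite -subr_eq0; apply/eqP.
  move: l j; apply: (free_powers (c := fun l j => c (l, j) - c' (l, j)) sR z0 Rz Rv fv).
  have p0 i : p (fun lj => c lj - c' lj) i = 0.
    rewrite -pB; apply/eqP; rewrite subr_eq0; apply/eqP/polyP => k.
    have [kC|Ck] := ltnP k (M * m + C).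
      by have /ffunP/(_ (i, Ordinal kC)) := fcc'; rewrite !ffunE.
    by rewrite !nth_default // (leq_trans _ Ck).
  have key : \sum_(l < M) \sum_(j < D) (polyL g ^+ M * polyL d *
      (z ^+ l * (polyL (c (l, j) - c' (l, j))%:P * v j))) = 0.
    have sum0 : \sum_i polyL (p (fun lj => c lj - c' lj) i) * e i = 0.
      by rewrite big1 // => i _; rewrite p0 rmorph0 mul0r.
    rewrite -[RHS]sum0 /p; under [RHS]eq_bigr do rewrite rmorph_sum mulr_suml.
    rewrite [RHS]exchange_big [LHS]pair_big; apply: eq_bigr => -[l j] _ /=.
    have -> : polyL g ^+ M * polyL d * (z ^+ l * (polyL (c (l, j) - c' (l, j))%:P * v j)) =
      polyL (c (l, j) - c' (l, j))%:P * (z ^+ l * polyL g ^+ M) * (polyL d * v j) by ring.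
    rewrite vE mulr_sumr; apply: eq_bigr => i _.
    rewrite -[(_ *: _)%R]mul_polyC !polyLM !polyLX.
    have gME : polyL g ^+ M = polyL g ^+ l * polyL g ^+ (M - l).
      by rewrite -exprD subnKC // ltnW.
    rewrite gME /z expr_div_n.
    have gl0 : polyL g ^+ l != 0 by rewrite expf_neq0.
    by field.
  have gd0 : polyL g ^+ M * polyL d != 0 by rewrite mulf_neq0 ?expf_neq0.
  apply/eqP; rewrite -(mulrI_eq0 _ (mulfI gd0)); apply/eqP; rewrite -[RHS]key mulr_sumr.
  by apply: eq_bigr => l _; rewrite !mulr_sumr; apply: eq_bigr => j _; rewrite const_embE.
have := leq_card_ffun finj; rewrite !card_prod !card_ord.
rewrite /M; nia.
Qed.

End RationalBase.

(** * Existence of places *)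

Section MaximalSubring.
Variable (L : fieldType).
Implicit Types (R O : set L) (t u v w z : L).

Definition is_subring R :=
  [/\ R 1, forall u v, R u -> R v -> R (u - v) & forall u v, R u -> R v -> R (u * v)].

Lemma subring0 R : is_subring R -> R 0.
Proof. by case=> R1 RB _; rewrite -(subrr 1); apply: RB. Qed.

Lemma subringN R u : is_subring R -> R u -> R (- u).
Proof. by move=> sR Ru; rewrite -sub0r; case: (sR) => _ RB _; apply: RB => //; apply: subring0. Qed.

Lemma subringD R u v : is_subring R -> R u -> R v -> R (u + v).
Proof.
by move=> sR Ru Rv; rewrite -[v]opprK; case: (sR) => _ RB _; apply: RB => //; apply: subringN.
Qed.

Lemma subringM R u v : is_subring R -> R u -> R v -> R (u * v).
Proof. by case=> _ _; apply. Qed.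

Lemma subringX R u n : is_subring R -> R u -> R (u ^+ n).
Proof.
move=> sR Ru; elim: n => [|n IHn]; first by case: sR.
by rewrite exprS; apply: subringM.
Qed.

Lemma subring_sum R (I : Type) (r : seq I) (C : pred I) (h : I -> L) :
  is_subring R -> (forall i, C i -> R (h i)) -> R (\sum_(i <- r | C i) h i).
Proof.
move=> sR Rh; elim/big_rec: _ => [|i u Ci Ru]; first exact: subring0.
by apply: subringD => //; apply: Rh.
Qed.

Definition maximal_avoiding t R := [/\ is_subring R, R t, ~ R t^-1 &
  forall R', is_subring R' -> R `<=` R' -> ~ R' t^-1 -> R' `<=` R].

Lemma maximal_subring O t : is_subring O -> O t -> ~ O t^-1 ->
  exists2 R, maximal_avoiding t R & O `<=` R.
Proof.
move=> sO Ot OtV.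
pose good X := [/\ is_subring X, O `<=` X & ~ X t^-1].
have [F|A [PA maxA]] := @Zorn_bigcup L [set X | X = set0 \/ good X].
  move=> FP tF; have [[X FX X0]|allE] := pselect (exists2 X, F X & X !=set0).
    have goodX Y : F Y -> Y !=set0 -> good Y.
      by move=> FY [y Yy]; case: (FP _ FY) => // Y0; move: Yy; rewrite Y0.
    have [sX OX Xt] := goodX X FX X0.
    have two u v : (\bigcup_(Y in F) Y) u -> (\bigcup_(Y in F) Y) v ->
        exists Y, [/\ F Y, is_subring Y, Y u & Y v].
      move=> [Y FY Yu] [Y' FY' Yv].
      have [sY _ _] := goodX Y FY (ex_intro _ u Yu).
      have [sY' _ _] := goodX Y' FY' (ex_intro _ v Yv).
      by have [h|h] := tF Y Y' FY FY'; [exists Y' | exists Y]; split=> //; apply: h.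
    right; split.
    - split; first by exists X => //; case: sX.
        by move=> u v /two h /h[Y [FY [_ YB _] Yu Yv]]; exists Y => //; apply: YB.
      by move=> u v /two h /h[Y [FY [_ _ YM] Yu Yv]]; exists Y => //; apply: YM.
    - by move=> u Ou; exists X => //; apply: OX.
    - by move=> [Y FY Yt]; have [] := goodX Y FY (ex_intro _ _ Yt).
  left; rewrite -subset0 => u [Y FY Yu]; apply: allE; exists Y => //; by exists u.
have {PA}[sA OA At] : good A.
  case: PA => [A0|//]; exfalso; apply: (maxA O); last by right; split.
  split; first by rewrite A0.
  by rewrite A0 => /(_ 1); apply; case: sO.
exists A => //; split=> // [|R' sR' AR' R't]; first exact: OA.
apply: contrapT => R'A; apply: (maxA R'); first by split.
by right; split=> //; apply: subset_trans AR'.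
Qed.

Variables (t : L) (R : set L).
Hypothesis maxR : maximal_avoiding t R.

Let sR : is_subring R. Proof. by case: maxR. Qed.
Let Rt : R t. Proof. by case: maxR. Qed.
Let RtV : ~ R t^-1. Proof. by case: maxR. Qed.
Let t0 : t != 0.
Proof. by apply/eqP => t0; apply: RtV; rewrite t0 invr0 -t0. Qed.

Let not_tR b : R b -> t * b <> 1.
Proof. by move=> Rb tb; apply: RtV; rewrite -[t^-1]mulr1 -tb mulKf. Qed.

(** Inverting [w = 1 - t * b] cannot create [t^-1]: every [w ^ k] is [1 - t * c] with [c] in [R], so
    [t^-1 * w ^ k] in [R] would put [t^-1] in [R]. Maximality then absorbs [w^-1]. *)
Lemma max_subring_unit b : R b -> R (1 - t * b)^-1.
Proof.
have R1 : R 1 by case: sR.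
move=> Rb; set w := 1 - t * b.
have Rw : R w by case: (sR) => _ RB _; apply: RB => //; apply: subringM.
have w0 : w != 0 by rewrite subr_eq0; apply/eqP => h; apply: (not_tR Rb).
pose R' := [set z | exists k, R (z * w ^+ k)].
have R'R : R `<=` R' by move=> z Rz; exists 0%N; rewrite mulr1.
have sR' : is_subring R'.
  split; first exact: R'R.
    move=> u v [k Ru] [l Rv]; exists (k + l)%N.
    have -> : (u - v) * w ^+ (k + l) = u * w ^+ k * w ^+ l - v * w ^+ l * w ^+ k.
      by rewrite exprD; ring.
    by case: (sR) => _ RB _; apply: RB; apply: subringM => //; apply: subringX.
  move=> u v [k Ru] [l Rv]; exists (k + l)%N; rewrite exprD mulrACA.
  exact: subringM.
have R't : ~ R' t^-1.
  have wk k : exists2 c, R c & w ^+ k = 1 - t * c.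
    elim: k => [|k [c Rc wk]]; first by exists 0; [exact: subring0 | rewrite mulr0 subr0].
    exists (b + c - t * b * c); last by rewrite exprS wk /w; ring.
    by case: (sR) => _ RB _; apply: RB; [apply: subringD | do 2?apply: subringM].
  move=> [k]; have [c Rc ->] := wk k => h.
  apply: (not_tR (subringD sR h Rc)); rewrite mulrDr mulrA divff //; ring.
have [_ _ _ /(_ R' sR' R'R R't)] := maxR; apply; exists 1%N.
by rewrite expr1 mulVf.
Qed.

Definition coef_in (p : {poly L}) := forall i, R p`_i.

Let adjoin z := [set w | exists2 p, coef_in p & w = p.[z]].

Let adjoin_subring z : is_subring (adjoin z).
Proof.
split.
- exists 1; last by rewrite hornerC.
  by move=> i; rewrite coef1; case: (i == 0)%N; [case: sR | apply: subring0].
- move=> _ _ [p Rp ->] [q Rq ->]; exists (p - q); last by rewrite hornerD hornerN.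
  by move=> i; rewrite coefB; case: (sR) => _ RB _; apply: RB.
- move=> _ _ [p Rp ->] [q Rq ->]; exists (p * q); last by rewrite hornerM.
  by move=> i; rewrite coefM; apply: subring_sum => // j _; apply: subringM.
Qed.

(** By maximality, R[z] contains [t^-1] as soon as [z] is outside [R]. *)
Let adjoin_inv z : ~ R z -> exists2 p, coef_in p & t * p.[z] = 1.
Proof.
move=> Rz; apply: contrapT => h; apply: Rz.
have [_ _ _ /(_ (adjoin z) (adjoin_subring z))] := maxR; apply.
- move=> u Ru; exists u%:P; last by rewrite hornerC.
  by move=> i; rewrite coefC; case: (i == 0)%N => //; apply: subring0.
- by move=> [p Rp tp]; apply: h; exists p => //; rewrite -tp divff.
- exists 'X; last by rewrite hornerX.
  by move=> i; rewrite coefX; case: (i == 1)%N; [case: sR | apply: subring0].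
Qed.

(* A relation [1 = t q(1/z)] has the unit [1 - t q_0] in front of its constant
   term, so it rewrites the leading monomial of [p]. *)
Let no_two_relations N z (p q : {poly L}) : z != 0 -> (size p + size q <= N)%N ->
  coef_in p -> coef_in q -> t * p.[z] = 1 -> t * q.[z^-1] = 1 -> False.
Proof.
elim: N z p q => [|N IHN] z p q z0 spq Rp Rq tp tq.
  move: tp; rewrite (_ : p = 0) ?horner0 ?mulr0; last by apply/eqP; rewrite -size_poly_eq0; lia.
  by move/esym/eqP; rewrite oner_eq0.
wlog sqp : z p q z0 spq Rp Rq tp tq / (size q <= size p)%N.
  move=> wl; have [h|h] := leqP (size q) (size p); first exact: (wl z p q).
  by apply: (wl z^-1 q p); rewrite ?invr_eq0 ?invrK // 1?addnC // ltnW.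
have [s1|s1] := leqP (size p) 1.
  by move: tp; rewrite (size1_polyC s1) hornerC; apply: not_tR.
case m1E : (size p) s1 => [//|[//|m]] _.
set u := (1 - t * q`_0)^-1; have Ru : R u by apply: max_subring_unit.
pose q1 : {poly L} := \poly_(i < m.+1) q`_i.+1.
have uq0 : 1 - t * q`_0 != 0 by rewrite subr_eq0; apply/eqP => h; apply: (not_tR (Rq 0%N)).
have qE : q = q1 * 'X + (q`_0)%:P.
  apply/polyP => -[|i]; rewrite coefD coefMX coefC /= ?add0r // addr0 coef_poly.
  by case: ltnP => // mi; rewrite nth_default //; apply: leq_trans sqp _; rewrite m1E.
have relE : u * t * q1.[z^-1] / z = 1.
  have h : t * q1.[z^-1] * z^-1 = 1 - t * q`_0.
    by have := tq; rewrite {1}qE hornerD hornerC hornerM hornerX => e; rewrite -[X in X - _]e; ring.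
  by rewrite -!mulrA [t * _]mulrA h mulVf.
pose r : {poly L} := \poly_(i < m.+1) (p`_m.+1 * t * u * q1`_(m - i)).
have rE : r.[z] = p`_m.+1 * z ^+ m.+1.
  have -> : p`_m.+1 * z ^+ m.+1 = p`_m.+1 * t * u * (z ^+ m * q1.[z^-1]).
    rewrite -[LHS]mulr1 -[X in _ * X = _]relE exprS; field.
    exact: z0.
  rewrite /r horner_poly /q1 horner_poly mulr_sumr mulr_sumr.
  rewrite (reindex_inj rev_ord_inj) /=; apply: eq_bigr => i _.
  have im : (i <= m)%N by rewrite -ltnS.
  have zm : z ^+ m = z ^+ (m - i) * z ^+ i by rewrite -exprD subnK.
  rewrite subSS subKn // coef_poly ltnS im zm exprVn.
  have zi0 : z ^+ i != 0 by rewrite expf_neq0.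
  by field.
pose p' := \poly_(i < m.+1) p`_i + r.
have sp' : (size p' <= m.+1)%N.
  by apply: leq_trans (size_polyD _ _) _; rewrite geq_max !size_poly.
apply: (IHN z p' q) => //; first by apply: leq_trans (_ : (size p + size q).-1 <= N)%N; lia.
  move=> i; rewrite coefD !coef_poly; case: ltnP => _; last by rewrite addr0; apply: subring0.
  apply: subringD => //; do 3?apply: subringM => //.
  by case: ifP => _ //; apply: subring0.
rewrite -tp hornerD rE; congr (t * _).
rewrite horner_poly [in RHS]horner_coef m1E.
by rewrite [RHS]big_ord_recr.
Qed.

Lemma max_subring_total z : R z \/ R z^-1.
Proof.
have [->|z0] := eqVneq z 0; first by left; apply: subring0.
apply: contrapT => /not_orP[/adjoin_inv[p Rp tp] /adjoin_inv[q Rq tq]].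
exact: (no_two_relations z0 (leqnn _) Rp Rq tp tq).
Qed.

End MaximalSubring.

Definition unit_of (E : fieldType) (R : set E) (u : E) := [/\ u != 0, R u & R u^-1].

(** * Discreteness of a valuation ring in a finite extension *)

Section Discrete.
Variables (k K : fieldType) (L : fieldExtType K) (iota : {rmorphism k -> L}).
Variables (R : set L) (t : L).
Implicit Types (u v w z : L).
Hypotheses (sR : is_subring R) (Rtot : forall z, R z \/ R z^-1).
Hypotheses (Rt : R t) (RtV : ~ R t^-1).
Hypothesis Riota : forall c, R (iota c).

Hypothesis base_disc : forall c : K, c != 0 ->
  exists n : int, unit_of R (c%:A / t ^ n).

Let t0 : t != 0.
Proof. by apply/eqP => t0; apply: RtV; rewrite t0 invr0 -t0. Qed.

Lemma unit_of1 : unit_of R 1.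
Proof. by split; rewrite ?invr1 ?oner_eq0 //; case: sR. Qed.

Lemma unit_ofM u v : unit_of R u -> unit_of R v -> unit_of R (u * v).
Proof.
move=> [u0 Ru RuV] [v0 Rv RvV]; split; rewrite ?mulf_neq0 ?invfM //;
  exact: subringM.
Qed.

Lemma unit_ofV u : unit_of R u -> unit_of R u^-1.
Proof. by move=> [u0 Ru RuV]; split; rewrite ?invr_eq0 ?invrK. Qed.

Lemma unit_ofX u n : unit_of R u -> unit_of R (u ^+ n).
Proof.
move=> uu; elim: n => [|n IHn]; first exact: unit_of1.
by rewrite exprS; apply: unit_ofM.
Qed.

(** One of [v / u], [u / v] lies in [R], so the sum is a multiple of [u] or of [v] and cannot be a
    unit. *)
Lemma nonunitD u v : R u -> R v -> ~ unit_of R u -> ~ unit_of R v -> ~ unit_of R (u + v).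
Proof.
have half a b : a != 0 -> b != 0 -> R a -> ~ unit_of R a -> R (b / a) -> ~ unit_of R (a + b).
  move=> a0 b0 Ra na Rba [ab0 Rab RabV]; apply: na; split=> //.
  have -> : a^-1 = (1 + b / a) * (a + b)^-1 by field; rewrite ab0 a0.
  by apply: subringM => //; apply: subringD => //; case: sR.
move=> Ru Rv nu nv; have [->|u0] := eqVneq u 0; first by rewrite add0r.
have [->|v0] := eqVneq v 0; first by rewrite addr0.
have [h|h] := Rtot (v / u); first exact: half.
by rewrite addrC; apply: half => //; move: h; rewrite invfM invrK mulrC.
Qed.

Lemma min_ratio (I : eqType) (s : seq I) (a : I -> L) :
  s != [::] -> (forall i, i \in s -> a i != 0) ->
  exists2 i0, i0 \in s & forall i, i \in s -> R (a i / a i0).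
Proof.
have R1 : R 1 by case: sR.
elim: s => // i s IHs _ sa; have [->|sn0] := eqVneq s [::].
  exists i; first exact: mem_head.
  by move=> j; rewrite inE => /eqP->; rewrite divff // sa ?mem_head.
have [|i0 i0s i0min] := IHs sn0; first by move=> j js; rewrite sa // inE js orbT.
have ai0 : a i != 0 by rewrite sa ?mem_head.
have ai00 : a i0 != 0 by rewrite sa // inE i0s orbT.
have [h|h] := Rtot (a i / a i0).
  exists i0; first by rewrite inE i0s orbT.
  by move=> j; rewrite inE => /orP[/eqP->|/i0min].
exists i; first exact: mem_head.
move=> j; rewrite inE => /orP[/eqP->|/i0min hj]; first by rewrite divff.
have -> : a j / a i = a j / a i0 * (a i / a i0)^-1 by field; rewrite ?ai0 ?ai00.
exact: subringM.
Qed.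

(* Two terms of an algebraic equation of [z] over [K] have the same value. *)
Lemma pow_disc z : z != 0 -> exists d, [/\ (0 < d)%N, (d <= \dim {:L})%N &
  exists n : int, unit_of R (z ^+ d / t ^ n)].
Proof.
move=> z0; pose p := minPoly 1%AS z.
have pn0 : p != 0 by rewrite monic_neq0 ?monic_minPoly.
have /polyOver1P[c pE] : p \is a polyOver 1%AS := minPolyOver _ _.
have cE i : p`_i = (c`_i)%:A by rewrite pE coef_map.
pose s := [seq i <- enum 'I_(size p) | p`_(nat_of_ord i) != 0].
pose a (i : 'I_(size p)) := p`_i * z ^+ i.
have sE i : (i \in s) = (p`_i != 0) by rewrite mem_filter mem_enum andbT.
have a0 i : i \in s -> a i != 0 by rewrite sE => pi; rewrite mulf_neq0 ?expf_neq0.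
have sp0 : (0 < size p)%N by rewrite lt0n size_poly_eq0.
have sn0 : s != [::].
  have ltp : ((size p).-1 < size p)%N by rewrite prednK.
  apply/eqP => s0; have := sE (Ordinal ltp).
  by rewrite s0 in_nil /= -/(lead_coef p) lead_coef_eq0 pn0.
have [i0 i0s i0min] := min_ratio sn0 a0.
(* Division by a term of least value turns the algebraic equation into a sum equal to the unit
   [- 1]. Nonunits being closed under addition, another term has the same value. *)
have sum0 : \sum_(i | i != i0) a i / a i0 = - 1.
  have : p.[z] / a i0 = 0 by rewrite /p minPolyxx mul0r.
  rewrite horner_coef mulr_suml (bigD1 i0) //= -/(a i0) divff ?a0 // addrC => /eqP.
  by rewrite addr_eq0 => /eqP.
have [i ii0 [ins ui]] : exists2 i, i != i0 & i \in s /\ unit_of R (a i / a i0).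
  apply: contrapT => h.
  suff [_] : R (\sum_(i | i != i0) a i / a i0) /\ ~ unit_of R (\sum_(i | i != i0) a i / a i0).
    rewrite sum0; apply; case: unit_of1 => _ R1 _.
    by split; rewrite ?invrN ?invr1 ?oppr_eq0 ?oner_eq0 //; apply: subringN.
  elim/big_rec: _ => [|i u ii0 [Ru nu]].
    by split; [exact: subring0 | case; rewrite eqxx].
  have Ri : R (a i / a i0).
    have [/i0min//|nis] := boolP (i \in s).
    by move: nis; rewrite sE negbK /a => /eqP->; rewrite !mul0r; apply: subring0.
  split; first exact: subringD.
  apply: nonunitD => // ui; apply: h; exists i => //; split=> //.
  by case: ui => + _ _; rewrite mulf_eq0 negb_or sE /a mulf_eq0 negb_or => /andP[/andP[]].
have c0 j : j \in s -> c`_j != 0.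
  by rewrite sE cE; apply: contraNneq => ->; rewrite scale0r.
have [n ucn] := base_disc (c0 _ ins); have [n0 ucn0] := base_disc (c0 _ i0s).
have tz m : t ^ m != 0 by rewrite expfz_neq0.
have uz : unit_of R (z ^+ i / z ^+ i0 * t ^ (n - n0)).
  have := unit_ofM (unit_ofM ui (unit_ofV ucn)) ucn0.
  rewrite /a !cE expfzDr // -invr_expz; congr (unit_of R _).
  have ci : (c`_i)%:A != 0 :> L by rewrite -cE -sE.
  have ci0 : (c`_i0)%:A != 0 :> L by rewrite -cE -sE.
  have zi0 : z ^+ i0 != 0 by rewrite expf_neq0.
  by field; rewrite ?ci ?ci0 ?zi0 ?tz.
have sizep : (size p <= (\dim {:L}).+1)%N.
  rewrite size_minPoly ltnS adjoin_degreeE dimv1 divn1.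
  by apply: dimvS; apply: subvf.
have bound (j : 'I_(size p)) : (j <= \dim {:L})%N.
  by rewrite -ltnS; apply: leq_trans sizep.
have [lt|lt|eqi] := ltngtP i i0; last by rewrite (val_inj eqi) eqxx in ii0.
  exists (i0 - i)%N; split; rewrite ?subn_gt0 ?(leq_trans (leq_subr _ _)) //.
  exists (n - n0); move: (unit_ofV uz); congr (unit_of R _).
  rewrite -(subnK (ltnW lt)) exprD addnK; have zi0 : z ^+ i != 0 by rewrite expf_neq0.
  have zii0 : z ^+ (i0 - i) != 0 by rewrite expf_neq0.
  by field; rewrite zi0 zii0 tz.
exists (i - i0)%N; split; rewrite ?subn_gt0 ?(leq_trans (leq_subr _ _)) //.
exists (n0 - n); move: uz; congr (unit_of R _).
rewrite -(subnK (ltnW lt)) exprD addnK; have zi0 : z ^+ i0 != 0 by rewrite expf_neq0.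
by rewrite mulfK // invr_expz opprB.
Qed.

(** A common multiple of all the exponents given by [pow_disc], so that every nonzero [z ^+ D] is a
    unit times a power of [t]. *)
Let D := (\dim {:L})`!.

Let D_gt0 : (0 < D)%N. Proof. exact: fact_gt0. Qed.

Let preval z : exists n : int, z != 0 -> unit_of R (z ^+ D / t ^ n).
Proof.
have [->|z0] := eqVneq z 0; first by exists 0.
have [d [d0 dL [n un]]] := pow_disc z0.
have /dvdnP[e De] : (d %| D)%N by apply: dvdn_fact; rewrite d0.
exists (n * e%:Z) => _; have := unit_ofX e un.
by rewrite expr_div_n -exprM mulnC -De [(t ^ n) ^+ e]exprnP exprz_exp.
Qed.

(** The integer [v z] with [z ^+ D] equivalent to [t ^ v z] defines a valuation with ring [R]. Its
    value group contains [v t = D], hence is generated by its least positive element [g0], and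
    [v / g0] is normalized. *)
Lemma discrete_place : exists P : place iota, 0 < P t /\ forall w, R w -> 0 <= P w.
Proof.
have /choice[v vP] := preval.
have tn m : t ^ m != 0 by rewrite expfz_neq0.
have unit_t m : unit_of R (t ^ m) -> m = 0.
  case: m => [[//|m]|m] [_ Rtm RtmV].
    exfalso; apply: RtV; have -> : t^-1 = (t ^+ m.+1)^-1 * t ^+ m.
      by rewrite exprS invfM mulfVK ?expf_neq0.
    by apply: subringM => //; apply: subringX.
  exfalso; apply: RtV; move: Rtm; rewrite NegzE -exprnN => Rtm.
  have -> : t^-1 = t ^- m.+1 * t ^+ m by rewrite exprS invfM mulfVK ?expf_neq0.
  by apply: subringM => //; apply: subringX.
have vE z n : z != 0 -> unit_of R (z ^+ D / t ^ n) -> v z = n.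
  move=> z0 un; have := unit_ofM un (unit_ofV (vP z z0)).
  have zD : z ^+ D != 0 by rewrite expf_neq0.
  have -> : z ^+ D / t ^ n * (z ^+ D / t ^ v z)^-1 = t ^ (v z - n).
    by rewrite expfzDr // -invr_expz; field; rewrite !tn zD.
  by move=> /unit_t/eqP; rewrite subr_eq0 => /eqP.
have vM z w : z != 0 -> w != 0 -> v (z * w) = v z + v w.
  move=> z0 w0; apply: vE; first exact: mulf_neq0.
  have := unit_ofM (vP z z0) (vP w w0); rewrite mulrACA -exprMn -invfM.
  by rewrite expfzDr.
have v1 : v 1 = 0 by apply: vE; rewrite ?oner_eq0 // expr1n divr1; apply: unit_of1.
have vV z : z != 0 -> v z^-1 = - v z.
  move=> z0; apply/eqP; rewrite -addr_eq0 -vM ?invr_eq0 // mulVf // v1 //.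
have R_tpos n : R (t ^ n) -> 0 <= n.
  case: n => // n; rewrite NegzE -exprnN => Rtm; exfalso; apply: RtV.
  have -> : t^-1 = t ^- n.+1 * t ^+ n by rewrite exprS invfM mulfVK ?expf_neq0.
  by apply: subringM => //; apply: subringX.
have Rv z : z != 0 -> R z -> 0 <= v z.
  move=> z0 Rz; have [_ _ h] := vP z z0; apply: R_tpos.
  have := subringM sR h (subringX D sR Rz); rewrite invfM invrK.
  by rewrite mulrAC mulVf ?expf_neq0 // mul1r.
(* If [z] itself is not known to be in [R], then [z^-1] is and [v z = 0], so [z ^+ D] is a unit and
   [z = z ^+ D * z^-1 ^+ D.-1] lies in [R]. *)
have vR z : z != 0 -> 0 <= v z -> R z.
  move=> z0 vz; have [//|RzV] := Rtot z.
  have vz0 : v z = 0.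
    apply/eqP; rewrite eq_le vz andbT -oppr_ge0 -vV //; apply: Rv => //.
    by rewrite invr_eq0.
  have [_ + _] := vP z z0; rewrite vz0 expr0z divr1 => RzD.
  have -> : z = z ^+ D * z^-1 ^+ D.-1.
    rewrite -{1}(prednK D_gt0) exprS exprVn mulfK //.
    by rewrite expf_neq0.
  by apply: subringM => //; apply: subringX.
have vD z w : z != 0 -> w != 0 -> z + w != 0 -> Num.min (v z) (v w) <= v (z + w).
  have half a b : a != 0 -> b != 0 -> a + b != 0 -> v a <= v b -> v a <= v (a + b).
    move=> a0 b0 ab0 ab; have -> : a + b = a * (1 + b / a) by field.
    have ba0 : 1 + b / a != 0.
      by apply: contraNneq ab0 => h; rewrite (_ : a + b = a * (1 + b / a)); [rewrite h mulr0 | field].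
    rewrite vM // lerDl; apply: Rv => //; apply: subringD => //; first by case: sR.
    by apply: vR; rewrite ?mulf_neq0 ?invr_eq0 // vM ?invr_eq0 // vV // subr_ge0.
  move=> z0 w0 zw0; rewrite ge_min; have [h|h] := leP (v z) (v w).
    by rewrite half.
  by rewrite [z + w]addrC [X in _ || X]half ?orbT 1?addrC // ltW.
have vt : v t = D.
  by apply: vE => //; rewrite -exprnP divff ?expf_neq0 //; apply: unit_of1.
have vX z (n : nat) : z != 0 -> v (z ^+ n) = n%:Z * v z.
  move=> z0; elim: n => [|n IHn]; first by rewrite expr0 v1 mul0r.
  by rewrite exprS vM ?expf_neq0 // IHn intS mulrDl mul1r.
have vXz z (n : int) : z != 0 -> v (z ^ n) = n * v z.
  move=> z0; case: n => n; first exact: vX.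
  by rewrite NegzE -exprnN vV ?expf_neq0 // vX // mulNr.
have [g0 [z1 z10 [vz1 g0_gt0 g0min]]] : exists g0 : nat, exists2 z, z != 0 &
    [/\ v z = g0, (0 < g0)%N &
      forall z' (n : nat), z' != 0 -> v z' = n -> (0 < n)%N -> (g0 <= n)%N].
  pose Q n := `[< exists2 z, z != 0 & v z = n%:Z /\ (0 < n)%N >].
  have exQ : exists n, Q n by exists D; apply/asboolP; exists t.
  case: (ex_minnP exQ) => g /asboolP[z z0 [vz g_gt0]] gmin.
  exists g, z => //; split=> // z' n z'0 vz' n0; apply: gmin.
  by apply/asboolP; exists z'.
have g0n0 : g0%:Z != 0 by rewrite eqz_nat -lt0n.
have g0dvd z : z != 0 -> v z = (v z %/ g0)%Z * g0.
  move=> z0; have e := divz_eq (v z) g0; rewrite {1}e.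
  have r0 : (0 <= v z %% g0)%Z by rewrite modz_ge0.
  have rlt : ((v z %% g0)%Z < g0) by apply: ltz_pmod.
  have := g0min (z / z1 ^ (v z %/ g0)%Z) `|(v z %% g0)%Z|%N.
  rewrite mulf_neq0 ?invr_eq0 ?expfz_neq0 // vM ?invr_eq0 ?expfz_neq0 // vV ?expfz_neq0 //.
  rewrite vXz // vz1 {1}e addrAC subrr add0r gez0_abs // => /(_ isT erefl).
  lia.
pose f z : int := if z == 0 then 0 else (v z %/ g0)%Z.
have fE z : z != 0 -> v z = f z * g0 by move=> z0; rewrite /f (negPf z0) g0dvd // mulzK.
have g0pos : 0 < g0%:Z by [].
unshelve eexists (@Place _ _ iota f _ _ _ _ _).
- by rewrite /f eqxx.
- move=> z w z0 w0; apply: (mulIf g0n0).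
  by rewrite mulrDl -!fE ?mulf_neq0 // vM.
- move=> z w z0 w0 zw0; have := vD z w z0 w0 zw0; rewrite !fE //.
  by rewrite -minr_pMl ?ler_pM2r // ltW.
- move=> c; have [->|c0] := eqVneq c 0; first by rewrite /f rmorph0 eqxx.
  have ic0 : iota c != 0 by rewrite fmorph_eq0.
  have h1 := Rv _ ic0 (Riota c).
  have h2 : 0 <= v (iota c)^-1 by apply: Rv; rewrite ?invr_eq0 // -fmorphV.
  have vc : v (iota c) = 0 by move: h2; rewrite vV //; lia.
  by apply: (mulIf g0n0); rewrite -fE // vc mul0r.
- exists z1; split=> //; apply: (mulIf g0n0); by rewrite -fE // mul1r.
split=> /=.
  by rewrite -(pmulr_lgt0 _ g0pos) -fE // vt.
move=> w Rw; have [->|w0] := eqVneq w 0; first by rewrite /f eqxx.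
by rewrite -(pmulr_lge0 _ g0pos) -fE //; apply: Rv.
Qed.

End Discrete.

(* Chevalley's extension theorem, in the case of a discrete valuation ring [O]
   of [K] with uniformizer [t]. *)
Theorem place_above (k K : fieldType) (L : fieldExtType K)
    (iota : {rmorphism k -> L}) (O : set L) (t : L) :
  is_subring O -> O t -> ~ O t^-1 -> (forall c, O (iota c)) ->
  (forall c : K, c != 0 -> exists n : int, unit_of O (c%:A / t ^ n)) ->
  exists P : place iota, 0 < P t /\ forall w, O w -> 0 <= P w.
Proof.
move=> sO Ot OtV Oiota Od; have [R maxR OR] := maximal_subring sO Ot OtV.
have [sR Rt RtV _] := maxR.
have [|c c0|P [Pt PR]] := discrete_place (iota := iota) sR (max_subring_total maxR) Rt RtV.
- by move=> c; apply: OR.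
- have [n [u0 Ou OuV]] := Od c c0; exists n.
  by split=> //; apply: OR.
by exists P; split=> // w /OR; apply: PR.
Qed.

Local Opaque polyL const_emb.

(** * Places of the projective line and places above them *)

Section Polynomials.
Variable F : finFieldType.
Implicit Types h g r : {poly F}.

Lemma irreducible_decomp r h : irreducible_poly r -> h != 0 ->
  exists k h', h = r ^+ k * h' /\ coprimep r h'.
Proof.
move=> ir; have [n] := ubnP (size h); elim: n h => // n IH h /[!ltnS] shn h0.
have [rh|nrh] := boolP (r %| h); last first.
  by exists 0%N, h; rewrite mul1r (irreducible_poly_coprime _ ir).
have hE := divpK rh; set h1 := h %/ r in hE.
have h10 : h1 != 0 by apply: contraNneq h0 => e; rewrite -hE e mul0r.
have [|k [h' [h1E ch']]] := IH h1 _ h10; last first.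
  by exists k.+1, h'; rewrite -hE h1E exprS; split=> //; ring.
apply: leq_trans shn; rewrite -[in X in (_ < X)%N]hE size_mul // ?(irredp_neq0 ir) //.
have := ir.1; case: (size r) => [|[|sr]] // _; rewrite !addnS /= ltnS leq_addr //.
Qed.

Lemma irreducible_divisor h : (1 < size h)%N ->
  exists2 r, irreducible_poly r & r %| h.
Proof.
have [n] := ubnP (size h); elim: n h => // n IH h /[!ltnS] shn sh.
have [ih|nirr] := pselect (irreducible_poly h); first by exists h; rewrite ?dvdpp.
have [r rh [sr1 sr2]] : exists2 r, r %| h & size r != 1 /\ ~~ (r %= h).
  apply: contrapT => no; apply: nirr; split=> // r sr rh.
  by apply/negPn/negP => nrh; apply: no; exists r.
have h0 : h != 0 by rewrite -size_poly_eq0; case: size sh.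
have r0 : r != 0 by apply: contraTneq rh => ->; rewrite dvd0p.
have szr : (size r < size h)%N.
  by rewrite ltn_neqAle dvdp_leq // andbT (dvdp_size_eqp rh).
have [|q iq qr] := IH r (leq_trans szr shn).
  by move: sr1 r0; rewrite -size_poly_eq0; case: (size r) => [|[|]].
by exists q => //; apply: dvdp_trans rh.
Qed.

Lemma coprimep_irr_neq0 r b : irreducible_poly r -> coprimep r b -> b != 0.
Proof.
move=> ir; apply: contraTneq => ->; rewrite coprimep0 -size_poly_eq1.
by case: (size r) ir.1 => [|[]].
Qed.

End Polynomials.

Section LocalRings.
Variables (F : finFieldType) (E : fieldType) (phi : {rmorphism {poly F} -> E}).
Hypothesis phi_eq0 : forall a, (phi a == 0) = (a == 0).
Implicit Types a b r : {poly F}.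

Let phi_inj a b : phi a = phi b -> a = b.
Proof.
move=> e; apply/eqP; rewrite -subr_eq0 -phi_eq0 rmorphB e subrr eqxx //.
Qed.

(** For irreducible [r], the localization of F[x] at [r], embedded by [phi]. *)
Definition local_ring r : set E :=
  [set w | exists a b, coprimep r b /\ w = phi a / phi b].

(** The valuation ring of F(x) at infinity, with uniformizer [(phi 'X)^-1]. *)
Definition infinite_ring : set E :=
  [set w | exists a b, [/\ b != 0, (size a <= size b)%N & w = phi a / phi b]].

Lemma local_ring_poly r a : local_ring r (phi a).
Proof. by exists a, 1; rewrite coprimep1 rmorph1 divr1. Qed.

Section Finite.
Variable r : {poly F}.
Hypothesis ir : irreducible_poly r.

Let nz b : coprimep r b -> phi b != 0.
Proof. by move=> /(coprimep_irr_neq0 ir); rewrite phi_eq0. Qed.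

Let r0 : phi r != 0. Proof. by rewrite phi_eq0 irredp_neq0. Qed.

Lemma local_ring_subring : is_subring (local_ring r).
Proof.
split; first by rewrite -(rmorph1 phi); apply: local_ring_poly.
  move=> _ _ [a [b [cb ->]]] [a' [b' [cb' ->]]].
  exists (a * b' - a' * b), (b * b'); rewrite coprimepMr cb cb'; split=> //.
  have := nz cb; have := nz cb'; rewrite rmorphB !rmorphM.
  by move: (phi b) (phi b') => v v' v'0 v0; field; rewrite v0 v'0.
move=> _ _ [a [b [cb ->]]] [a' [b' [cb' ->]]].
by exists (a * a'), (b * b'); rewrite coprimepMr cb cb' !rmorphM mulf_div.
Qed.

Lemma local_ring_nV : ~ local_ring r (phi r)^-1.
Proof.
move=> [a [b [cb e]]]; have eb : b = r * a.
  apply: phi_inj; rewrite rmorphM; have := nz cb; move: e r0.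
  by move: (phi a) (phi b) (phi r) => u v w e w0 v0; rewrite -[v](mulKf w0) e; field.
by move: cb; rewrite eb coprimepMr coprimepp; case: (size r) ir.1 => [|[]].
Qed.

Lemma local_ring_disc a b : a != 0 -> b != 0 ->
  exists n : int, unit_of (local_ring r) (phi a / phi b / phi r ^ n).
Proof.
move=> a0 b0.
have [k [a' [aE ca']]] := irreducible_decomp ir a0.
have [l [b' [bE cb']]] := irreducible_decomp ir b0.
exists (k%:Z - l%:Z); rewrite aE bE !rmorphM !rmorphXn.
have -> : phi r ^+ k * phi a' / (phi r ^+ l * phi b') / phi r ^ (k%:Z - l%:Z) =
    phi a' / phi b'.
  have := nz cb'; rewrite expfzDr // -invr_expz -!exprnP.
  have := expf_neq0 k r0; have := expf_neq0 l r0.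
  move: (phi r ^+ k) (phi r ^+ l) (phi b') => x y v x0 y0 v0.
  by field; rewrite x0 y0 v0.
split; first by rewrite mulf_neq0 ?invr_eq0 ?nz.
  by exists a', b'.
by exists b', a'; rewrite invf_div.
Qed.

End Finite.

Let X0 : phi 'X != 0. Proof. by rewrite phi_eq0 polyX_eq0. Qed.

Lemma infinite_ring_const c : infinite_ring (phi c%:P).
Proof.
exists c%:P, 1; rewrite oner_eq0 rmorph1 divr1; split=> //.
by rewrite size_poly1 size_polyC leq_b1.
Qed.

Lemma infinite_ring_subring : is_subring infinite_ring.
Proof.
split; first by rewrite -(rmorph1 phi); apply: infinite_ring_const.
  move=> _ _ [a [b [b0 ab ->]]] [a' [b' [b'0 ab' ->]]].
  exists (a * b' - a' * b), (b * b'); rewrite mulf_neq0 //; split=> //; last first.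
    move: b0 b'0; rewrite -!phi_eq0 rmorphB !rmorphM.
    by move: (phi b) (phi b') => v v' v0 v'0; field; rewrite v0 v'0.
  apply: leq_trans (size_polyD _ _) _; rewrite size_polyN geq_max (size_mul b0 b'0).
  have h1 := size_polyMleq a b'; have h2 := size_polyMleq a' b.
  move: ab ab' h1 h2; move: (size (a * b')) (size (a' * b)).
  move: (size a) (size b) (size a') (size b') => *; apply/andP; split; lia.
move=> _ _ [a [b [b0 ab ->]]] [a' [b' [b'0 ab' ->]]].
exists (a * a'), (b * b'); rewrite mulf_neq0 // !rmorphM mulf_div; split=> //.
rewrite (size_mul b0 b'0); have := size_polyMleq a a'; move: (size (a * a')) ab ab'.
move: (size a) (size b) (size a') (size b') => *; lia.
Qed.

Lemma infinite_ring_XV : infinite_ring (phi 'X)^-1.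
Proof.
exists 1, 'X; rewrite polyX_eq0 rmorph1 div1r; split=> //.
by rewrite size_poly1 size_polyX.
Qed.

Lemma infinite_ring_nX : ~ infinite_ring (phi 'X)^-1^-1.
Proof.
rewrite invrK => -[a [b [b0 ab e]]]; have eb : 'X * b = a.
  by apply: phi_inj; rewrite rmorphM e divfK // phi_eq0.
by move: ab; rewrite -eb mulrC size_mulX // ltnn.
Qed.

Lemma infinite_ring_disc a b : a != 0 -> b != 0 ->
  exists n : int, unit_of infinite_ring (phi a / phi b / (phi 'X)^-1 ^ n).
Proof.
move=> a0 b0; exists ((size b)%:Z - (size a)%:Z).
have -> : phi a / phi b / (phi 'X)^-1 ^ ((size b)%:Z - (size a)%:Z) =
    phi (a * 'X^(size b)) / phi (b * 'X^(size a)).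
  rewrite exprz_inv opprB expfzDr // -invr_expz -!exprnP !rmorphM !rmorphXn.
  by rewrite invf_div mulf_div.
have Xn n : 'X^n != 0 :> {poly F} by rewrite -size_poly_eq0 size_polyXn.
have szE : size (a * 'X^(size b)) = size (b * 'X^(size a)).
  by rewrite !size_mul // !size_polyXn !addnS addnC.
have aX0 : a * 'X^(size b) != 0 by rewrite mulf_neq0.
have bX0 : b * 'X^(size a) != 0 by rewrite mulf_neq0.
move: (a * _) (b * _) szE aX0 bX0 => u v szE u0 v0; split.
- by rewrite mulf_neq0 ?invr_eq0 ?phi_eq0.
- by exists u, v; rewrite szE.
- by exists v, u; rewrite szE invf_div.
Qed.

End LocalRings.

Section LinePlaces.
Variables (F : finFieldType) (E : fieldType) (iota : {rmorphism F -> E}).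
Variable phi : {rmorphism {poly F} -> E}.
Hypothesis phi_eq0 : forall a, (phi a == 0) = (a == 0).
Hypothesis phiC : forall c, phi c%:P = iota c.
Implicit Types (P : place iota) (h g r : {poly F}).

Lemma phiE h : phi h = \sum_(i < size h) iota h`_i * phi 'X ^+ i.
Proof.
rewrite -{1}[h]coefK poly_def rmorph_sum.
by apply: eq_bigr => i _; rewrite -phiC -rmorphXn -rmorphM mul_polyC.
Qed.

Lemma ord_poly_ge0 P h : 0 <= P (phi 'X) -> 0 <= P (phi h).
Proof.
have [->|h0] := eqVneq h 0; first by rewrite rmorph0 Defs.ord0.
move=> PX; apply: ord_ge_nz; first by rewrite phi_eq0.
rewrite phiE; apply: ord_ge_sum => i _; rewrite -[0]add0r.
apply: ord_geM (ord_ge_const _ _) _; right; rewrite ordX; nia.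
Qed.

Lemma ord_poly_infinite P h : P (phi 'X) < 0 -> h != 0 ->
  P (phi h) = (size h).-1%:Z * P (phi 'X).
Proof.
move=> PX h0; have X0 : phi 'X != 0 by rewrite phi_eq0 polyX_eq0.
have sh : (0 < size h)%N by rewrite lt0n size_poly_eq0.
rewrite phiE -(prednK sh) big_ord_recr /= addrC.
have lc0 : iota h`_(size h).-1 != 0 by rewrite fmorph_eq0 lead_coef_eq0.
have lead : P (iota h`_(size h).-1 * phi 'X ^+ (size h).-1) =
    (size h).-1%:Z * P (phi 'X).
  by rewrite ordM ?expf_neq0 // ord_const add0r ordX.
have [|_ ->//] := @ord_addl _ _ _ P _ (\sum_(i < (size h).-1) iota h`_i * phi 'X ^+ i)
   (mulf_neq0 lc0 (expf_neq0 (size h).-1 X0)).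
rewrite lead; apply: ord_ge_sum => i _; rewrite -[_ + 1]add0r.
apply: ord_geM (ord_ge_const _ _) _; right; rewrite ordX.
have : (i < (size h).-1)%N := ltn_ord i.
move: (nat_of_ord i) => m; move: (size h).-1 (P (phi 'X)) PX => n x; nia.
Qed.

Lemma ord_coprime P h g : 0 <= P (phi 'X) -> coprimep h g ->
  0 < P (phi h) -> P (phi g) = 0.
Proof.
move=> PX /Bezout_eq1_coprimepP[[u v] /= uv] Ph.
have [-> //|g0] := eqVneq (P (phi g)) 0; exfalso.
have Pg : 0 < P (phi g) by rewrite lt_neqAle eq_sym g0 ord_poly_ge0.
have : ord_ge P 1 (phi 1).
  have Pu := ord_poly_ge0 u PX; have Pv := ord_poly_ge0 v PX.
  rewrite -uv rmorphD !rmorphM -[X in ord_ge P X]add0r.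
  by apply: ord_geD; apply: ord_geM; right.
by rewrite rmorph1 => /(ord_ge_nz (oner_neq0 _)); rewrite ord_1.
Qed.

Lemma ord_mult_irreducible P r h : 0 <= P (phi 'X) -> irreducible_poly r ->
  0 < P (phi r) -> h != 0 -> exists k : nat, P (phi h) = k%:Z * P (phi r).
Proof.
move=> PX ir Pr /(irreducible_decomp ir)[k [h' [-> ch']]]; exists k.
have r0 := irredp_neq0 ir.
have h'0 : h' != 0.
  by apply: contraTneq ch' => ->; rewrite coprimep0 -size_poly_eq1; case: (size r) ir.1 => [|[]].
by rewrite rmorphM rmorphXn ordM ?expf_neq0 ?phi_eq0 // ordX (ord_coprime PX ch' Pr) addr0.
Qed.

End LinePlaces.

Section PlacesOverLine.
Variables (F : finFieldType) (L : fieldExtType {fraction {poly F}}).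
Local Notation K := {fraction {poly F}}.
Local Notation "h %:F" := (@tofrac _ h).
Local Notation polyL := (@polyL F L).
Local Notation place := (place (const_emb L)).
Implicit Types (P : place) (h g r : {poly F}) (w z : L).

Lemma frac_quot_neq0 (c : K) : c != 0 ->
  exists a b : {poly F}, [/\ a != 0, b != 0 & c%:A = polyL a / polyL b :> L].
Proof.
have [a [b [b0 ->]]] := frac_num_den c => c0; exists a, b; split=> //.
  by apply: contraNneq c0 => ->; rewrite tofrac0 mul0r.
exact: polyL_frac.
Qed.

Lemma place_finite r : irreducible_poly r ->
  exists P, 0 < P (polyL r) /\ forall h, 0 <= P (polyL h).
Proof.
move=> ir; have inj := @polyL_eq0 F L.
have [|||c|c /frac_quot_neq0[a [b [a0 b0 ->]]]|P [Pr PO]] :=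
  @place_above _ _ _ (const_emb L) (local_ring polyL r) (polyL r).
- exact: local_ring_subring.
- exact: local_ring_poly.
- exact: local_ring_nV.
- rewrite const_embE; exact: local_ring_poly.
- exact: local_ring_disc.
by exists P; split=> // h; apply/PO/local_ring_poly.
Qed.

Lemma place_infinite : exists P, P (polyL 'X) < 0.
Proof.
have inj := @polyL_eq0 F L.
have [|||c|c /frac_quot_neq0[a [b [a0 b0 ->]]]|P [Pr PO]] :=
  @place_above _ _ _ (const_emb L) (infinite_ring polyL) (polyL 'X)^-1.
- exact: infinite_ring_subring.
- exact: infinite_ring_XV.
- exact: infinite_ring_nX.
- rewrite const_embE; exact: infinite_ring_const.
- exact: infinite_ring_disc.
by exists P; rewrite -oppr_gt0 -ordV.
Qed.

(** Otherwise [P] would be trivial on F(x). In the minimal polynomial of a uniformizer, the terms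
    would then have pairwise distinct orders, and the lowest one could not be cancelled. *)
Lemma finite_place_zero P : 0 <= P (polyL 'X) ->
  exists2 h, h != 0 & 0 < P (polyL h).
Proof.
move=> PX; apply: contrapT => none.
have Pge h : 0 <= P (polyL h).
  exact: (ord_poly_ge0 (phi := polyL) (@polyL_eq0 F L) (fun c => esym (@const_embE F L c)) h PX).
have Pz h : P (polyL h) = 0.
  have [->|h0] := eqVneq h 0; first by rewrite polyL0 Defs.ord0.
  apply/eqP/negPn/negP => Ph; apply: none; exists h => //.
  by rewrite lt_neqAle eq_sym Ph Pge.
have PK (c : K) : P (c%:A) = 0.
  have [a [b [b0 ->]]] := frac_num_den c; rewrite polyL_frac.
  have [->|a0] := eqVneq a 0; first by rewrite polyL0 mul0r Defs.ord0.
  by rewrite ord_div ?polyL_eq0 // !Pz subrr.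
have [t [t0 Pt]] := ord_unif P.
pose p := minPoly 1%AS t.
have pn0 : p != 0 by rewrite monic_neq0 ?monic_minPoly.
have /polyOver1P[c pE] : p \is a polyOver 1%AS := minPolyOver _ _.
have Pp i : P p`_i = 0 by rewrite pE coef_map PK.
have exi : exists i, p`_i != 0 by exists (size p).-1; rewrite -/(lead_coef p) lead_coef_eq0.
case: (ex_minnP exi) => i0 pi0 mini0.
have i0p : (i0 < size p)%N.
  by rewrite ltnNge; apply: contra pi0 => h; rewrite nth_default.
have : p.[t] = 0 by rewrite /p minPolyxx.
rewrite horner_coef (bigD1 (Ordinal i0p)) //= => sum0.
have lead0 : p`_i0 * t ^+ i0 != 0 by rewrite mulf_neq0 ?expf_neq0.
have [|] := @ord_addl _ _ _ P _ (\sum_(i < size p | i != Ordinal i0p) p`_i * t ^+ i) lead0.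
  rewrite ordM ?expf_neq0 // Pp add0r ordX Pt mulr1; apply: ord_ge_sum => i ii0.
  have [->|pi] := eqVneq p`_i 0; first by left; rewrite mul0r.
  right; rewrite ordM ?expf_neq0 // Pp add0r ordX Pt mulr1 lezD1.
  by rewrite ltz_nat ltn_neqAle eq_sym (mini0 i pi) andbT.
by rewrite sum0 eqxx.
Qed.

End PlacesOverLine.

(** * Riemann's genus *)

Section Scale.
Variables (F : finFieldType) (L : fieldType) (iota : {rmorphism F -> L}).

Lemma has_dimq_scale (V : set L) c n : c != 0 ->
  has_dimq iota V [set 0] n -> has_dimq iota [set u | V (c * u)] [set 0] n.
Proof.
move=> c0 /(has_dimqP _ _ (subsp_zero _))[b [Vb fb spb]].
apply/has_dimqP; first exact: subsp_zero.
have sumE (d : 'I_n -> F) : \sum_i iota (d i) * (b i / c) = (\sum_i iota (d i) * b i) / c.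
  by rewrite mulr_suml; apply: eq_bigr => i _; rewrite mulrA.
exists (fun i => b i / c); split=> [i|d|u /= /spb[d /= e]].
- by rewrite /= mulrC divfK.
- rewrite /= sumE => /eqP; rewrite mulf_eq0 invr_eq0 (negPf c0) orbF => /eqP.
  exact: fb.
exists d; rewrite sumE; apply: (mulfI c0); rewrite mulr0 mulrBr.
by rewrite [c * (_ / c)]mulrC divfK.
Qed.

End Scale.

Section Divisors.
Variables (F : finFieldType) (L : fieldType) (iota : {rmorphism F -> L}).
Implicit Types (P : place iota) (D : divisor iota) (S : seq (place iota)).

Lemma div_degE D S : uniq S -> (forall P, P \in finsupp D -> P \in S) ->
  div_deg D = \sum_(P <- S) D P * (place_deg P)%:Z.
Proof.
move=> uS sub; rewrite (bigID (fun P => P \in finsupp D)) /= [X in _ + X]big1.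
  rewrite addr0 -big_filter; apply: perm_big; apply: uniq_perm => [||P].
  - exact: fset_uniq.
  - exact: filter_uniq.
  - by rewrite mem_filter andb_idr // => /sub.
by move=> P; rewrite memNfinsupp => /eqP->; rewrite mul0r.
Qed.

Lemma RRspaceE D : RRspace D = val_ge setT (fun P => - D P).
Proof. by apply/seteqP; split=> z Dz P; [move=> _|]; apply: Dz. Qed.

Lemma subsp_RRspace D : subsp iota (RRspace D).
Proof. by rewrite RRspaceE; exact: subsp_val_ge. Qed.

Lemma ellE D d : has_dimq iota (RRspace D) [set 0] d -> ell D = d.
Proof. by apply: dimqE; [exact: subsp_RRspace | exact: subsp_zero]. Qed.

(** Each place removed from [D'] lowers the degree by its residue degree and the dimension by at
    most as much. *)
Lemma riemann_mono D D' d' : (forall P, has_res_deg P (place_deg P)) ->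
  (forall P, D P <= D' P) -> has_dimq iota (RRspace D') [set 0] d' ->
  exists2 d, has_dimq iota (RRspace D) [set 0] d &
    div_deg D - d%:Z <= div_deg D' - d'%:Z.
Proof.
move=> resP leD; pose S := undup (finsupp D ++ finsupp D' : seq (place iota)).
pose l := multiset S (fun P => `|D' P - D P|%N).
have uS : uniq S by apply: undup_uniq.
have memS P : (P \in S) = (P \in finsupp D) || (P \in finsupp D').
  by rewrite mem_undup mem_cat.
rewrite !RRspaceE => /(val_ge_chain_le (l := l))[|d dd le].
  by move=> P _; split=> //; exact: resP.
exists d.
  rewrite (_ : (fun P => - D P) = add_places (fun P => - D' P) l) //.
  apply/funext => P; rewrite /add_places count_multiset //.
  case: ifP => [_|]; first by rewrite gez0_abs ?subr_ge0 //; ring.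
  move=> /negbT; rewrite memS negb_or => /andP[].
  by rewrite !memNfinsupp => /eqP-> /eqP->; rewrite addr0.
rewrite !(@div_degE _ S) // => [|P PD|P PD]; rewrite ?memS ?PD ?orbT //.
have key : \sum_(P <- S) D' P * (place_deg P)%:Z - \sum_(P <- S) D P * (place_deg P)%:Z =
    (\sum_(P <- l) place_deg P)%N%:Z.
  rewrite sum_multiset -sumrB -natz natr_sum; apply: eq_bigr => P _.
  by rewrite natz PoszM gez0_abs ?subr_ge0 // mulrBl.
move: key le; move: (\sum_(P <- S) D' P * _) (\sum_(P <- S) D P * _) (\sum_(P <- l) _)%N.
by move=> u v w; lia.
Qed.

End Divisors.

Section GenusCriterion.
Variables (F : finFieldType) (L : fieldType) (iota : {rmorphism F -> L}).
Variable phi : {rmorphism {poly F} -> L}.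
Hypothesis phi_eq0 : forall a, (phi a == 0) = (a == 0).
Hypothesis phiC : forall c, phi c%:P = iota c.
Variable n : nat.
Hypothesis growth : forall (h g : {poly F}) m, h != 0 -> g != 0 ->
  (size h <= m.+1)%N -> (size g <= m.+1)%N -> bounded_growth iota (phi h / phi g) (n * m).
Hypothesis finite_zero : forall P : place iota, 0 <= P (phi 'X) ->
  exists2 h, h != 0 & 0 < P (phi h).
Implicit Types (P : place iota) (h g r : {poly F}) (D : divisor iota).

Let X0 : phi 'X != 0. Proof. by rewrite phi_eq0 polyX_eq0. Qed.

Let gePh P h : 0 <= P (phi 'X) -> 0 <= P (phi h).
Proof. exact: (ord_poly_ge0 phi_eq0 phiC). Qed.

(** Some element of F(x) vanishes at [P]: a polynomial if [P] is finite, [1 / x] at infinity. Its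
    growth bound makes the residue field finite-dimensional. *)
Lemma curve_res_deg P : has_res_deg P (place_deg P).
Proof.
have [PX|PX] := leP 0 (P (phi 'X)).
  have [h h0 Ph] := finite_zero PX.
  apply: (growth_res_deg (growth (m := size h) h0 (oner_neq0 _) _ _)) => //.
  - by rewrite size_poly1.
  - by rewrite rmorph1 divr1 phi_eq0.
  - by rewrite rmorph1 divr1.
have X0' : 'X != 0 :> {poly F} by rewrite polyX_eq0.
apply: (growth_res_deg (growth (m := 1) (oner_neq0 _) X0' _ _)) => //.
- by rewrite size_poly1.
- by rewrite size_polyX.
- by rewrite rmorph1 div1r invr_eq0.
- by rewrite rmorph1 div1r ordV oppr_gt0.
Qed.

(** Each zero contributes at least 1 to the fundamental inequality, so lists of distinct zeros have
    length at most [B]; a longest one is complete. *)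
Lemma zeros_seq z B : bounded_growth iota z B -> z != 0 ->
  exists2 S : seq (place iota), uniq S & forall P, (P \in S) = (0 < P z).
Proof.
move=> gz z0.
pose Q k := `[< exists S : seq (place iota), [/\ uniq S, size S = k & forall P, P \in S -> 0 < P z] >].
have exQ : exists k, Q k by exists 0%N; apply/asboolP; exists [::].
have bQ k : Q k -> (k <= B)%N.
  move=> /asboolP[S [uS <- SP]].
  have := fundamental_ineq gz z0 uS (fun P PS => ltW (SP P PS)); apply: leq_trans.
  rewrite -sum1_size big_seq [X in (_ <= X)%N]big_seq; apply: leq_sum => P PS.
  have := res_deg_gt0 (curve_res_deg P); have := SP P PS; case: (P z) => // -[|k'] //= _.
  by move: (place_deg P) => [|d] // _; rewrite mulnS.
case: (ex_maxnP exQ bQ) => k /asboolP[S [uS sS SP]] maxk; exists S => // P.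
apply/idP/idP => [/SP//|Pz]; apply/negPn/negP => PS.
suff /maxk : Q k.+1 by rewrite ltnn.
apply/asboolP; exists (P :: S); split; rewrite /= ?PS ?sS // => P'.
by rewrite inE => /orP[/eqP->//|/SP].
Qed.

(** The space L(D) for [D] equal to [M] times the pole divisor of x, defined by inequalities so that
    no finitely supported divisor has to be built first. *)
Definition pole_space (M : nat) : set L :=
  [set u | forall P, ord_ge P (M%:Z * Num.min (P (phi 'X)) 0) u].

Variables (genus : int) (M0 : nat) (dim : nat -> nat).
Hypothesis dimE : forall M, (M0 <= M)%N -> (dim M)%:Z = (n * M)%N%:Z + 1 - genus.
Hypothesis pole_space_dim : forall M, (M0 <= M)%N ->
  has_dimq iota (pole_space M) [set 0] (dim M).

(** The hypothesis on [Num.max] says that the zero divisor of [h / g] is div(h) plus [G] times the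
    poles of x. Multiplication by [phi h ^+ N] therefore identifies the space of [N] times this
    divisor with [pole_space (N * G)]. *)
Lemma zero_divisor h g G N : h != 0 -> g != 0 ->
  (size h <= G.+1)%N -> (size g <= G.+1)%N ->
  (forall P, Num.max (P (phi h / phi g)) 0 =
     P (phi h) - G%:Z * Num.min (P (phi 'X)) 0) ->
  (M0 <= N * G)%N ->
  exists D : divisor iota,
    [/\ forall P, D P = N%:Z * Num.max (P (phi h / phi g)) 0,
        has_dimq iota (RRspace D) [set 0] (dim (N * G)%N),
        div_deg D <= (n * (N * G))%N%:Z &
        forall S, uniq S -> (forall P, P \in S -> 0 < P (phi h / phi g)) ->
          (N * size S)%N%:Z <= div_deg D].
Proof.
move=> h0 g0 sh sg maxE MNG; set z := phi h / phi g.
have hL0 : phi h != 0 by rewrite phi_eq0.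
have z0 : z != 0 by rewrite mulf_neq0 ?invr_eq0 ?phi_eq0.
have gz := growth h0 g0 sh sg; have [S uS SE] := zeros_seq gz z0.
pose D : divisor iota := [fsfun P in [fset P in S]%fset => N%:Z * P z].
have DE P : D P = N%:Z * Num.max (P z) 0.
  rewrite fsfunE in_fset /=; case: ifPn; rewrite SE => h'.
    by rewrite max_l // ltW.
  by rewrite max_r ?mulr0 // leNgt.
have degE : div_deg D = \sum_(P <- S) D P * (place_deg P)%:Z.
  apply: div_degE => // P; rewrite SE mem_finsupp DE; case: ltP => // _.
  by rewrite mulr0 eqxx.
have degE' : div_deg D = (N * \sum_(P <- S) `|P z| * place_deg P)%N%:Z.
  rewrite degE PoszM -[(\sum_(P <- S) _)%N%:Z]natz natr_sum mulr_sumr.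
  apply: eq_big_seq => P.
  rewrite SE => Pz; rewrite DE max_l ?ltW // natz PoszM gtz0_abs //; ring.
exists D; split=> //.
- have -> : RRspace D = [set u | pole_space (N * G) (phi h ^+ N * u)].
    have key P u : ord_ge P ((N * G)%N%:Z * Num.min (P (phi 'X)) 0) (phi h ^+ N * u) <->
        ord_ge P (- D P) u.
      rewrite [_ * u]mulrC (propext (ord_geM_eq _ _ _ (expf_neq0 N hL0))) ordX DE maxE PoszM.
      by rewrite (_ : _ - _ = - (N%:Z * (P (phi h) - G%:Z * Num.min (P (phi 'X)) 0))); last ring.
    by apply/seteqP; split=> u uD P; apply/key; apply: uD.
  by apply: has_dimq_scale; [exact: expf_neq0 | exact: pole_space_dim].
- rewrite degE' lez_nat mulnCA leq_mul2l; apply/orP; right.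
  by apply: fundamental_ineq gz z0 uS _ => P; rewrite SE => /ltW.
move=> T uT TP; rewrite degE' lez_nat leq_mul2l; apply/orP; right.
have sTS : (size T <= size S)%N by apply: uniq_leq_size => // P /TP; rewrite SE.
apply: leq_trans sTS _; rewrite -sum1_size big_seq [X in (_ <= X)%N]big_seq.
apply: leq_sum => P; rewrite SE => Pz.
have := res_deg_gt0 (curve_res_deg P); case: (P z) Pz => // -[|k'] //= _.
by move: (place_deg P) => [|d] // _; rewrite mulnS.
Qed.

Hypothesis split_fibre : exists S : seq (place iota),
  [/\ uniq S, size S = n & forall P, P \in S -> 0 < P (phi ('X - 1))].

Lemma ord_infinite P h : P (phi 'X) < 0 -> h != 0 ->
  P (phi h) = (size h).-1%:Z * P (phi 'X).
Proof. exact: (ord_poly_infinite phi_eq0 phiC). Qed.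

(* [h / g] with [g = 'X * h ^+ 2 + 1] vanishes at the zeros of [h] and at every
   place at infinity. *)
Lemma dominating_divisor D : exists D' d',
  [/\ forall P, D P <= D' P, has_dimq iota (RRspace D') [set 0] d' &
    div_deg D' - d'%:Z + 1 <= genus].
Proof.
have /choice[hP hPP] : forall P, exists h, h != 0 /\ (0 <= P (phi 'X) -> 0 < P (phi h)).
  move=> P; have [/finite_zero[h h0 Ph]|_] := leP 0 (P (phi 'X)); first by exists h.
  by exists 1; rewrite oner_neq0.
pose h := \prod_(P <- finsupp D) hP P.
have h0 : h != 0.
  by rewrite /h prodf_seq_neq0; apply/allP => P _; case: (hPP P).
have Ph P : P \in finsupp D -> 0 <= P (phi 'X) -> 0 < P (phi h).
  move=> PD PX; rewrite /h (big_fsetD1 P) //= rmorphM ordM ?phi_eq0.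
  - by apply: ltr_wpDr; [exact: gePh | exact: (hPP P).2].
  - by case: (hPP P).
  - by rewrite prodf_seq_neq0; apply/allP => Q _ /=; case: (hPP Q).
pose g : {poly F} := 'X * h ^+ 2 + 1.
have sh0 : (0 < size h)%N by rewrite lt0n size_poly_eq0.
pose G := ((size h).-1 * 2).+1.
have sg : size g = G.+1.
  have sh2 : size ('X * h ^+ 2) = G.+1.
    rewrite mulrC size_mulX ?expf_neq0 // -[size (h ^+ 2)]prednK.
      by rewrite size_exp.
    by rewrite lt0n size_poly_eq0 expf_neq0.
  by rewrite size_polyDl sh2 // size_poly1.
have cop : coprimep h g.
  apply/Bezout_eq1_coprimepP; exists (- ('X * h), 1) => /=; rewrite /g; ring.
have g0 : g != 0 by rewrite -size_poly_eq0 sg.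
(* At finite places coprimality makes the zeros of [h / g] those of [h]; at infinity the orders are
   proportional to degrees, and [G], the degree of [g], exceeds that of [h]. *)
have maxE P : Num.max (P (phi h / phi g)) 0 = P (phi h) - G%:Z * Num.min (P (phi 'X)) 0.
  rewrite ord_div ?phi_eq0 //; have [PX|PX] := leP 0 (P (phi 'X)).
    rewrite mulr0 subr0; have [Phz|Pnz] := ltP 0 (P (phi h)).
      rewrite (_ : P (phi g) = 0) ?subr0 ?max_l // ?ltW //.
      exact: (ord_coprime phi_eq0 phiC PX cop).
    have -> : P (phi h) = 0 by apply/eqP; rewrite eq_le Pnz gePh.
    by rewrite sub0r max_r // oppr_le0 gePh.
  have Phi := ord_infinite PX h0; have Pgi := ord_infinite PX g0.
  rewrite Phi Pgi sg /= -mulrBl max_l // mulr_le0 // ?(ltW PX) //.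
  by rewrite /G; move: (size h).-1 => k; lia.

(* Large enough both to reach the range [M0 <= N * G] and to exceed each coefficient of [D], since
   [h / g] has order at least 1 on the support of [D]. *)
pose N := (M0 + \sum_(P <- finsupp D) `|D P|)%N.
have [|||D' [D'E dd' degD' _]] := @zero_divisor h g G N h0 g0 _ _ maxE.
- by rewrite /G -(prednK sh0) /=; move: (size h).-1 => k; lia.
- by rewrite sg.
- by rewrite /N /G; move: (size h).-1 (\sum_(P <- _) _)%N => k l; nia.
exists D', (dim (N * G)%N); split=> // [P|]; last first.
  rewrite dimE; last by rewrite /N /G; move: (size h).-1 (\sum_(P <- _) _)%N => k l; nia.
  by move: (div_deg D') (n * (N * G))%N degD' => u v; lia.
rewrite D'E; have [PD|] := boolP (P \in finsupp D); last first.
  by rewrite memNfinsupp => /eqP->; rewrite mulr_ge0 // le_max lexx orbT.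
have leN : (`|D P| <= N)%N.
  by rewrite /N (big_fsetD1 P) //= addnCA leq_addr.
suff : 1 <= Num.max (P (phi h / phi g)) 0 by nia.
rewrite maxE; have := Ph P PD; case: (leP 0 (P (phi 'X))) => PX.
  by move=> /(_ isT); lia.
by move=> _; rewrite ord_infinite //; nia.
Qed.

(** The bound is attained by [M0] times the zero divisor of x - 1: the [n] places of the split fibre
    give it degree at least [n * M0], and its dimension is [dim M0]. *)
Theorem genus_criterion : is_genus iota genus.
Proof.
have upper D : div_deg D - (ell D)%:Z + 1 <= genus.
  have [D' [d' [leD dd' degD']]] := dominating_divisor D.
  have [d dd le] := riemann_mono curve_res_deg leD dd'.
  by rewrite (ellE dd); lia.
split=> //; have [S [uS sS SP]] := split_fibre.
have X1 : 'X - 1 != 0 :> {poly F} by rewrite -polyC1 polyXsubC_eq0.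
have sX1 : size ('X - 1 : {poly F}) = 2 by rewrite -polyC1 size_XsubC.
have X1E : phi ('X - 1) / phi 1 = phi ('X - 1) by rewrite rmorph1 divr1.
have maxE P : Num.max (P (phi ('X - 1) / phi 1)) 0 =
    P (phi ('X - 1)) - 1%:Z * Num.min (P (phi 'X)) 0.
  rewrite X1E mul1r; have [PX|PX] := leP 0 (P (phi 'X)).
    by rewrite subr0 max_l // gePh.
  by rewrite ord_infinite // sX1 mul1r subrr max_r // ltW.
have [|||D [DE dd degD Dge]] := @zero_divisor ('X - 1) 1 1 M0 X1 (oner_neq0 _) _ _ maxE.
- by rewrite sX1.
- by rewrite size_poly1.
- by rewrite muln1.
exists D; apply/eqP; rewrite eq_le upper /= (ellE dd) dimE ?muln1 //.
have := Dge S uS; rewrite X1E => /(_ SP); rewrite sS; lia.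
Qed.

End GenusCriterion.

(** * The Kummer extension *)

Section Weights.
Variable t : nat.
Hypothesis t_gt0 : (0 < t)%N.
Let n := (t * t.+2)%N.
Implicit Types i M : nat.

(* With [s = t + 1] and [n = s^2 - 1], these are the ceilings of [i / (s + 1)]
   and [i s / n] for [i < n]. *)
Definition expX i := ((i + t.+1) %/ t.+2)%N.
Definition expb i := if i == 0%N then 0%N else (i %/ t.+1).+1.

Lemma expX_lo i : (i <= t.+2 * expX i)%N.
Proof.
have := divn_eq (i + t.+1) t.+2; rewrite -/(expX i).
have := ltn_pmod (i + t.+1) (isT : 0 < t.+2)%N; nia.
Qed.

Lemma expX_hi i : (t.+2 * expX i <= i + t.+1)%N.
Proof. by rewrite mulnC leq_divM. Qed.

(** Write [i = u * s + v] with [s = t.+1]. Then [i * s = u * n + (u + v * s)], and [u, v <= t] gives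
    [u + v * s <= n]; for [i > 0] this remainder is positive, so the ceiling is [u + 1]. *)
Lemma expb_lo i : (i < n)%N -> (i * t.+1 <= n * expb i)%N.
Proof.
rewrite /expb; case: eqVneq => [->|_] // lt_in.
have := divn_eq i t.+1; have := ltn_pmod i (isT : 0 < t.+1)%N.
move: (i %/ t.+1)%N (i %% t.+1)%N => u v vt e.
have ut : (u <= t)%N by move: lt_in; rewrite /n; nia.
rewrite /n; nia.
Qed.

Lemma expb_hi i : (i < n)%N -> (n * expb i < i * t.+1 + n)%N.
Proof.
have n0 : (0 < n)%N by rewrite muln_gt0 t_gt0.
rewrite /expb; case: eqVneq => [->|i0] lt_in; first by rewrite muln0.
have := divn_eq i t.+1; have := ltn_pmod i (isT : 0 < t.+1)%N.
move: (i %/ t.+1)%N (i %% t.+1)%N => u v vt e.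
have uv : (0 < u + v)%N by nia.
rewrite /n; nia.
Qed.

(** Number of coefficients of a polynomial whose product with the weight of index [i] has poles
    bounded by [M]: the degree bound at infinity is [M - A_i - t * B_i] plus the floor of
    [i (t + 1) / (t + 2)], and that floor is [i - A_i], whence the factor 2. *)
Definition dim_at M i := (M + 1 + i - (2 * expX i + t * expb i))%N.

(** From here on the subtraction in [dim_at] is not truncated, since [expX i <= t] and
    [expb i <= t.+1] for [i < n]. *)
Definition dim_bound := (2 * t + t * t.+1)%N.

Lemma dim_atE M i : (dim_bound <= M)%N -> (i < n)%N ->
  (dim_at M i)%:Z = M%:Z + 1 + i%:Z - (2 * expX i + t * expb i)%N%:Z.
Proof.
move=> MM lt_in; rewrite /dim_at.
have h1 := expX_hi i; have h2 := expb_hi lt_in.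
have e1 : (expX i <= t)%N by move: h1 lt_in; rewrite /n; nia.
have e2 : (expb i <= t.+1)%N.
  have n0 : (0 < n)%N by rewrite muln_gt0 t_gt0.
  have : (n * expb i < n * t.+2)%N.
    by apply: leq_trans h2 _; rewrite [(n * t.+2)%N]mulnS addnC leq_add2l leq_mul2r ltnW ?orbT.
  by rewrite ltn_mul2l n0.
have : (2 * expX i + t * expb i <= M)%N.
  by apply: leq_trans MM; rewrite /dim_bound leq_add // leq_mul2l ?e1 ?e2 ?orbT.
lia.
Qed.

Lemma sum_expX k : (2 * \sum_(i < k * t.+2) expX i = t.+2 * (k * (k - 1)) + 2 * (t.+1 * k))%N.
Proof.
elim: k => [|k IHk]; first by rewrite big_ord0 !muln0.
have -> : (\sum_(i < k.+1 * t.+2) expX i =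
  \sum_(i < k * t.+2) expX i + (t.+2 * k + t.+1))%N.
  rewrite mulSn addnC big_split_ord /=; congr addn.
  rewrite big_ord_recl /= addn0.
  have -> : expX (k * t.+2) = k by rewrite /expX divnMDl // divn_small ?addn0.
  rewrite (eq_bigr (fun=> k.+1)) ?sum_nat_const ?card_ord; first lia.
  move=> i _; rewrite /expX /bump /= -addnA divnMDl //.
  have -> : (1 + i + t.+1 = 1 * t.+2 + i)%N by lia.
  by rewrite divnMDl // divn_small ?addn0 ?addn1 // ltnS ltnW // ltn_ord.
by rewrite mulnDr IHk; case: k {IHk} => [|k]; rewrite ?subSS ?subn0; nia.
Qed.

Lemma sum_divn k : (2 * \sum_(i < k * t.+1) i %/ t.+1 = t.+1 * (k * (k - 1)))%N.
Proof.
elim: k => [|k IHk]; first by rewrite big_ord0 !muln0.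
have -> : (\sum_(i < k.+1 * t.+1) i %/ t.+1 =
  \sum_(i < k * t.+1) i %/ t.+1 + t.+1 * k)%N.
  rewrite mulSn addnC big_split_ord /=; congr addn.
  rewrite (eq_bigr (fun=> k)) ?sum_nat_const ?card_ord // => i _.
  by rewrite divnMDl // divn_small ?addn0.
by rewrite mulnDr IHk; case: k {IHk} => [|k]; rewrite ?subSS ?subn0; nia.
Qed.

(** Since [n + 1] is the square of [t.+1], the floors of [i / t.+1] over [i <= n] fill complete
    blocks; the last term is [t], and the shift by 1 occurs for the [n - 1] positive indices. *)
Lemma sum_expb : (2 * \sum_(i < n) expb i = (n - 1) * t.+2)%N.
Proof.
have nS : n.+1 = (t.+1 * t.+1)%N by rewrite /n; nia.
have := sum_divn t.+1; rewrite -nS big_ord_recr /=.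
have -> : (n %/ t.+1 = t)%N.
  have -> : n = (t * t.+1 + t)%N by rewrite /n; nia.
  by rewrite divnMDl // divn_small // addn0.
have n0 : (0 < n)%N by rewrite muln_gt0 t_gt0.
have -> : (\sum_(i < n) expb i = \sum_(i < n) (i %/ t.+1) + (n - 1))%N.
  rewrite -(prednK n0) !big_ord_recl /= div0n !add0n.
  rewrite (eq_bigr (fun i : 'I_n.-1 => (lift ord0 i %/ t.+1) + 1)%N); last first.
    by move=> i _; rewrite /expb lift0 addn1.
  by rewrite big_split /= sum_nat_const card_ord muln1 subSS subn0.
move: nS n0; rewrite !subSS !subn0; move: (\sum_(i < n) (i %/ t.+1))%N => S.
case: n => [|n'] // nS _ e; rewrite subSS subn0; nia.
Qed.

Lemma sum_dim_at M : (dim_bound <= M)%N ->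
  (\sum_(i < n) dim_at M i)%N%:Z =
  (n * M)%N%:Z + 1 - ((t.+1%:Z - 1) * ((t.+1 * t.+1)%N%:Z - 2) - t.+1%:Z + 2).
Proof.
move=> MM; have sA := sum_expX t; have sB := sum_expb.
have sI : (2 * \sum_(i < n) i = n * (n - 1))%N.
  rewrite -(big_mkord xpredT id) bin2_sum mul2n.
  by case: (n) => // n'; rewrite bin2 subSS subn0 /= -[RHS]odd_double_half oddM /= andNb add0n.
have -> : (\sum_(i < n) dim_at M i)%N%:Z =
   (n * (M + 1))%N%:Z + (\sum_(i < n) i)%N%:Z
   - (2 * \sum_(i < n) expX i + t * \sum_(i < n) expb i)%N%:Z.
  transitivity (\sum_(i < n) (M%:Z + 1 + i%:Z - (2 * expX i + t * expb i)%N%:Z)).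
    by rewrite -natz natr_sum; apply: eq_bigr => i _; rewrite natz dim_atE.
  rewrite sumrB big_split /= sumr_const card_ord; congr (_ + _ - _).
  - by rewrite -mulr_natl natz PoszM PoszD.
  - by rewrite -[RHS]natz natr_sum; apply: eq_bigr => i _; rewrite natz.
  rewrite !big_distrr -big_split /= -[RHS]natz natr_sum.
  by apply: eq_bigr => i _; rewrite natz.
move: sA sB sI; rewrite -/n.
move: (\sum_(i < n) expX i)%N (\sum_(i < n) expb i)%N (\sum_(i < n) i)%N => SA SB SI.
have [k tE] : exists k, t = k.+1 by exists t.-1; rewrite prednK.
rewrite /n tE; rewrite subSS subn0 => sA sB sI.
have : (k.+1 * k.+3)%N = (k.+1 * k.+3 - 1).+1 by nia.
set w := (k.+1 * k.+3 - 1)%N in sB sI * => wE.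
have e1 : (2 * (k.+1 * SB) = w * (k.+1 * k.+3))%N by nia.
nia.
Qed.

End Weights.

Lemma pred_add_leq (k l : nat) (c m : int) :
  (0 < k)%N -> k.-1%:Z + c <= m -> l%:Z = m + 1 - c -> (k <= l)%N.
Proof. case: k => // k _ /=; lia. Qed.

(** After division by [t], this is the rounding of [i (t + 1) / (t + 2)] down to [i - x], with [x]
    bounded above by the ceiling of [i / (t + 2)]. *)
Lemma degree_bound (t d x y i M : nat) : (0 < t)%N ->
  (t * t.+2)%N%:Z * d%:Z + ((t * t.+2 * x + t * t.+2 * (t * y))%N%:Z
    - (i * (t * t.+1))%N%:Z) <= (t * t.+2)%N%:Z * M%:Z ->
  (t.+2 * x <= i + t.+1)%N -> d%:Z + (2 * x + t * y)%N%:Z <= M%:Z + i%:Z.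
Proof.
move=> t0 le2 Ahi.
have t0' : 0 < t%:Z by [].
have le3 : t.+2%:Z * (d + x + t * y)%N%:Z <= t.+2%:Z * M%:Z + i%:Z * t.+1%:Z.
  rewrite -(ler_pM2l t0'); move: le2; rewrite !PoszD !PoszM.
  by move: (t.+2%:Z) (t.+1%:Z) t%:Z d%:Z x%:Z y%:Z i%:Z M%:Z => *; lra.
move: le3; rewrite -!PoszM -!PoszD lez_nat => le3.
suff : (d + x + t * y + x <= M + i)%N by lia.
rewrite leqNgt; apply/negP => lt2.
have lt3 : (t.+2 * (M + i).+1 <= t.+2 * (d + x + t * y + x))%N by rewrite leq_mul2l lt2 orbT.
move: le3 lt3 Ahi; move: (d + x + t * y)%N => T; rewrite !mulnDr => le3 lt3 Ahi.
have e : (t.+2 * i = i * t.+1 + i)%N by ring.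
move: lt3; rewrite mulnS mulnDr e.
move: le3 Ahi; move: (t.+2 * x)%N (t.+2 * T)%N (t.+2 * M)%N (i * t.+1)%N; lia.
Qed.

Section FreeIndexed.
Variables (F : finFieldType) (L : fieldType) (iota : {rmorphism F -> L}).

Lemma has_dimq_indexed (V W : set L) (I : finType) (b : I -> L) : subsp iota W ->
  (forall i, V (b i)) -> free_mod iota W b ->
  (forall z, V z -> exists c : I -> F, W (z - \sum_i iota (c i) * b i)) ->
  has_dimq iota V W #|I|.
Proof.
move=> sW Vb fb spb; apply/has_dimqP => //.
have sumE (c : 'I_#|I| -> F) : \sum_k iota (c k) * b (enum_val k) =
    \sum_i iota (c (enum_rank i)) * b i.
  rewrite (reindex enum_rank) /=; last exact/onW_bij/enum_rank_bij.
  by apply: eq_bigr => i _; rewrite enum_rankK.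
exists (fun k => b (enum_val k)); split=> [k|c|z /spb[c Wc]]; first exact: Vb.
  by rewrite sumE => /fb ck k; rewrite -(enum_valK k).
exists (fun k => c (enum_val k)); rewrite sumE.
by under eq_bigr do rewrite enum_rankK.
Qed.

Lemma distinct_ord_sum (P : place iota) (I : finType) (f : I -> L) :
  (forall i j, f i != 0 -> f j != 0 -> P (f i) = P (f j) -> i = j) ->
  \sum_i f i = 0 -> forall i, f i = 0.
Proof.
move=> inj sum0 i; apply/eqP/negPn/negP => fi0; move: sum0.
have [i0 fi00 mini0] := @arg_minP _ _ _ i (fun i => f i != 0) (fun i => P (f i)) fi0.
rewrite (bigD1 i0) //=.
have [|+ _] := @ord_addl _ _ _ P (f i0) (\sum_(j | j != i0) f j) fi00.
  apply: ord_ge_sum => j ji0; have [->|fj0] := eqVneq (f j) 0; first by left.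
  right; rewrite lezD1 lt_neqAle mini0 // andbT.
  by apply: contraNneq ji0 => e; rewrite (inj i0 j).
by move=> nz e; rewrite e eqxx in nz.
Qed.

Lemma coprimep_const (p q u v : {poly F}) (k : F) :
  k != 0 -> u * p + v * q = k%:P -> coprimep p q.
Proof.
move=> k0 e; apply/Bezout_eq1_coprimepP; exists (k^-1 *: u, k^-1 *: v) => /=.
by rewrite -!scalerAl -scalerDr e -mul_polyC -polyCM mulVf.
Qed.

(** ['X^k - 1] has at most [k] roots, so some [w] has [w ^+ k != 1]; the substitution [z |-> w * z]
    multiplies the sum by [w ^+ k]. *)
Lemma sum_char (k : nat) : (0 < k < #|F|.-1)%N -> \sum_(z : F | z != 0) z ^+ k = 0.
Proof.
move=> /andP[k0 kF].
have [w w0 wk] : exists2 w : F, w != 0 & w ^+ k != 1.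
  apply: contrapT => none; pose s := enum (predC1 (0 : F)).
  have us : uniq s by apply: enum_uniq.
  have : all (root ('X^k - 1)) s.
    apply/allP => z; rewrite mem_enum => z0.
    rewrite rootE !hornerE subr_eq0; apply/negPn/negP => zk; apply: none; by exists z.
  have p0 : 'X^k - 1 != 0 :> {poly F} by rewrite -size_poly_eq0 -polyC1 size_XnsubC.
  move=> /(max_poly_roots p0)-/(_ us); rewrite -polyC1 size_XnsubC // ltnS.
  have -> : size s = #|F|.-1 by rewrite -cardE cardC1.
  by rewrite leqNgt kF.
set S := \sum_(z | _) _; have e : S = w ^+ k * S.
  rewrite /S mulr_sumr (reindex_inj (mulfI w0)) /=; apply: eq_big => z.
    by rewrite mulf_eq0 (negPf w0).
  by rewrite exprMn.
have : (w ^+ k - 1) * S = 0 by rewrite mulrBl -e mul1r subrr.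
by move/eqP; rewrite mulf_eq0 subr_eq0 (negPf wk) => /eqP.
Qed.

End FreeIndexed.

(** * Orders and spaces of functions on the Kummer curve *)

Section Kummer.
Variables (F : finFieldType) (L : fieldType) (iota : {rmorphism F -> L}).
Variable phi : {rmorphism {poly F} -> L}.
Hypothesis phi_eq0 : forall h, (phi h == 0) = (h == 0).
Hypothesis phiC : forall c, phi c%:P = iota c.
Implicit Types (P : place iota) (h g r : {poly F}).

Variable t : nat.
Hypothesis t_gt0 : (0 < t)%N.
Hypothesis cardF : #|F| = (t.+1 * t.+1)%N.
Hypothesis sF : t.+1%:R = 0 :> F.
Let n := (t * t.+2)%N.

Variable a : F.
Hypothesis a0 : a != 0.
Hypothesis a_npow : a ^+ t.+2 != 1.

(* With [t = s - 1], the equation of the curve reads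
   [y ^+ n = - x ^+ t * polb ^+ s / polc]; [Y] stands for [y^-1]. *)
Definition polb : {poly F} := 'X^t - (a ^+ t.+1)%:P.
Definition polc : {poly F} := a%:P * 'X^t - 1.

Variable Y : L.
Hypothesis Y0 : Y != 0.
Hypothesis YE : Y ^+ n * phi ('X^t * polb ^+ t.+1) = - phi polc.

Hypothesis place_fin : forall r, irreducible_poly r ->
  exists P : place iota, 0 < P (phi r) /\ forall h, 0 <= P (phi h).
Hypothesis place_inf : exists P : place iota, P (phi 'X) < 0.
Hypothesis expansion : forall z, exists (d : {poly F}) (N : 'I_n -> {poly F}),
  d != 0 /\ phi d * z = \sum_i phi (N i) * Y ^+ i.
Hypothesis aut : forall z : F, z != 0 -> exists f : {rmorphism L -> L},
  (forall h, f (phi h) = phi h) /\ f Y = iota z * Y.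

Let n_gt0 : (0 < n)%N. Proof. by rewrite muln_gt0 t_gt0. Qed.
Let X0 : phi 'X != 0. Proof. by rewrite phi_eq0 polyX_eq0. Qed.
Let gePh P h : 0 <= P (phi 'X) -> 0 <= P (phi h).
Proof. exact: (ord_poly_ge0 phi_eq0 phiC). Qed.
Let ord_inf P h : P (phi 'X) < 0 -> h != 0 ->
  P (phi h) = (size h).-1%:Z * P (phi 'X).
Proof. exact: (ord_poly_infinite phi_eq0 phiC). Qed.
Let ord_cop P h g : 0 <= P (phi 'X) -> coprimep h g ->
  0 < P (phi h) -> P (phi g) = 0.
Proof. exact: (ord_coprime phi_eq0 phiC). Qed.

Let size_polb : size polb = t.+1.
Proof. by rewrite /polb size_XnsubC. Qed.
Let size_polc : size polc = t.+1.
Proof.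
rewrite /polc size_polyDl mul_polyC size_scale // size_polyXn //.
by rewrite size_polyN size_poly1.
Qed.
Let polb0 : polb != 0. Proof. by rewrite -size_poly_eq0 size_polb. Qed.
Let polc0 : polc != 0. Proof. by rewrite -size_poly_eq0 size_polc. Qed.

Let tS : t = t.-1.+1. Proof. by rewrite prednK. Qed.
Let coprimeXb : coprimep 'X polb.
Proof.
apply: (@coprimep_const _ _ _ ('X^(t.-1)) (-1) (a ^+ t.+1)); first by rewrite expf_neq0.
by rewrite /polb {2}tS exprS; ring.
Qed.
Let coprimeXc : coprimep 'X polc.
Proof.
apply: (@coprimep_const _ _ _ (a%:P * 'X^(t.-1)) (-1) 1); first by rewrite oner_eq0.
by rewrite /polc {2}tS exprS polyC1; ring.
Qed.
(** [polc - a * polb] is the constant [a ^+ t.+2 - 1], nonzero by the assumption on [a]. *)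
Let coprimebc : coprimep polb polc.
Proof.
apply: (@coprimep_const _ _ _ (- a%:P) 1 (a ^+ t.+2 - 1)); first by rewrite subr_eq0.
rewrite /polb /polc polyCB [a ^+ t.+2]exprS polyCM polyC1; ring.
Qed.

Lemma ord_Y P : n%:Z * P Y = P (phi polc) - t%:Z * P (phi 'X) - t.+1%:Z * P (phi polb).
Proof.
have Xt0 : phi 'X ^+ t != 0 by rewrite expf_neq0.
have bs0 : phi polb ^+ t.+1 != 0 by rewrite expf_neq0 ?phi_eq0.
have Yn0 : Y ^+ n != 0 by rewrite expf_neq0.
have := congr1 (ord P) YE; rewrite ordN rmorphM !rmorphXn.
rewrite (ordM P Yn0 (mulf_neq0 Xt0 bs0)) (ordM P Xt0 bs0) !ordX => <-; ring.
Qed.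

(** A nonvanishing derivative lets [r] divide [f] at most once. Simplicity is relative to [r], whose
    order at [P] is the ramification index over the line. *)
Lemma simple_zero P r f : 0 <= P (phi 'X) -> irreducible_poly r -> 0 < P (phi r) ->
  f != 0 -> ~ ord_ge P 1 (phi f^`()) -> P (phi f) = 0 \/ P (phi f) = P (phi r).
Proof.
move=> PX ir Pr f0 Pf'; have [rf|nrf] := boolP (r %| f); last first.
  by left; apply: ord_cop PX _ Pr; rewrite (irreducible_poly_coprime _ ir).
right; have fE := divpK rf; set f1 := f %/ r in fE.
have f10 : f1 != 0 by apply: contraNneq f0 => e; rewrite -fE e mul0r.
have r0 := irredp_neq0 ir.
have Pf1 : P (phi f1) = 0.
  apply/eqP; rewrite eq_le gePh // andbT leNgt; apply/negP => Pf1; apply: Pf'.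
  have g1 h : ord_ge P 0 (phi h) by right; apply: gePh.
  rewrite -fE derivM rmorphD !rmorphM; apply: ord_geD.
    by rewrite -[X in ord_ge P X]add0r; apply: ord_geM (g1 _) _; right.
  by rewrite -[X in ord_ge P X]addr0; apply: ord_geM _ (g1 _); right.
by rewrite -fE rmorphM ordM ?phi_eq0 // Pf1 add0r.
Qed.

Let tF : t%:R = -1 :> F.
Proof. by move/eqP: sF; rewrite -natr1 addr_eq0 => /eqP. Qed.

Let n1 P : ~ ord_ge P 1 1.
Proof. by move=> /(ord_ge_nz (oner_neq0 _)); rewrite ord_1. Qed.

Let ge1_const P c : c != 0 -> ~ ord_ge P 1 (iota c).
Proof.
move=> c0 /ord_ge_nz; rewrite fmorph_eq0 => /(_ c0).
by rewrite ord_const.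
Qed.

Let ge1_cX P c m : P (phi 'X) = 0 -> c != 0 -> ~ ord_ge P 1 (phi (c%:P * 'X^m)).
Proof.
move=> PX c0; have cL0 : iota c != 0 by rewrite fmorph_eq0.
move=> /ord_ge_nz; rewrite rmorphM rmorphXn phiC ordM ?expf_neq0 //.
by rewrite ord_const ordX PX mulr0 => /(_ (mulf_neq0 cL0 (expf_neq0 m X0))).
Qed.

Section Local.
Variables (P : place iota) (r : {poly F}).
Hypotheses (PX : 0 <= P (phi 'X)) (ir : irreducible_poly r) (Pr : 0 < P (phi r)).

Lemma ord_X_local : P (phi 'X) = 0 \/ P (phi 'X) = P (phi r).
Proof.
apply: simple_zero => //; first by rewrite polyX_eq0.
by rewrite derivX rmorph1; apply: n1.
Qed.

Let ord_cases g : 0 < P (phi g) \/ P (phi g) = 0.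
Proof. by have := gePh g PX; rewrite le_eqVlt => /orP[/eqP<-|]; [right | left]. Qed.

Lemma ord_polb_local : P (phi polb) = 0 \/ P (phi polb) = P (phi r).
Proof.
have [PXp|PX0] := ord_cases 'X; first by left; apply: ord_cop PX coprimeXb PXp.
apply: simple_zero => //.
(* As [t = -1] in [F], the derivative is [- 'X^(t.-1)], a unit away from x = 0. *)
rewrite /polb derivB derivC subr0 derivXn -mulr_natl -polyC_natr tF.
by apply: ge1_cX => //; rewrite oppr_eq0 oner_eq0.
Qed.

Lemma ord_polc_local : P (phi polc) = 0 \/ P (phi polc) = P (phi r).
Proof.
have [PXp|PX0] := ord_cases 'X; first by left; apply: ord_cop PX coprimeXc PXp.
apply: simple_zero => //.
rewrite /polc derivB derivC subr0 derivM derivC mul0r add0r derivXn.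
rewrite -mulr_natl -polyC_natr tF mulrA -polyCM.
by apply: ge1_cX => //; rewrite mulrN1 oppr_eq0.
Qed.

(** At most one of ['X], [polb], [polc] vanishes at [P], and then with the order of [r]; a single
    term remains. *)
Lemma ord_local_lt (u v w : int) : u < n%:Z -> v < n%:Z -> w < n%:Z ->
  u * P (phi 'X) + v * P (phi polb) + w * P (phi polc) < n%:Z * P (phi r).
Proof.
move=> un vn wn; have n0 : 0 < n%:Z by [].
have main (e : int) : e < n%:Z -> e * P (phi r) < n%:Z * P (phi r).
  by move=> en; rewrite ltr_pM2r.
have z : 0 < n%:Z * P (phi r) by apply: mulr_gt0.
have [PXp|PX0] := ord_cases 'X.
  rewrite (ord_cop PX coprimeXb PXp) (ord_cop PX coprimeXc PXp) !mulr0 !addr0.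
  by case: ord_X_local => ->; rewrite ?mulr0 // main.
rewrite PX0 mulr0 add0r; have [Pbp|Pb0] := ord_cases polb.
  rewrite (ord_cop PX coprimebc Pbp) mulr0 addr0.
  by case: ord_polb_local => ->; rewrite ?mulr0 // main.
by rewrite Pb0 mulr0 add0r; case: ord_polc_local => ->; rewrite ?mulr0 // main.
Qed.

End Local.

(* For [u] in [F(x)], [u * Y ^+ i] is regular at the finite places exactly when
   [u] is a polynomial multiple of [monom i]. *)
Definition monom i : {poly F} := 'X^(expX t i) * polb ^+ expb t i.
Definition weight i : L := phi (monom i) * Y ^+ i.

Let monom0 i : monom i != 0.
Proof. by rewrite mulf_neq0 ?expf_neq0 ?polyX_eq0. Qed.
Let weight0 i : weight i != 0.
Proof. by rewrite mulf_neq0 ?expf_neq0 ?phi_eq0. Qed.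

Lemma ord_weight P i : n%:Z * P (weight i) =
  (n * expX t i)%N%:Z * P (phi 'X) - (i * t)%N%:Z * P (phi 'X)
  + ((n * expb t i)%N%:Z * P (phi polb) - (i * t.+1)%N%:Z * P (phi polb))
  + i%:Z * P (phi polc).
Proof.
have mi0 : phi (monom i) != 0 by rewrite phi_eq0.
rewrite /weight (ordM P mi0 (expf_neq0 i Y0)) ordX mulrDr.
rewrite [n%:Z * (i%:Z * _)]mulrCA ord_Y.
have -> : phi (monom i) = phi 'X ^+ expX t i * phi polb ^+ expb t i.
  by rewrite /monom rmorphM !rmorphXn.
have Xt0 : phi 'X ^+ expX t i != 0 by rewrite expf_neq0.
have bs0 : phi polb ^+ expb t i != 0 by rewrite expf_neq0 ?phi_eq0.
rewrite (ordM P Xt0 bs0) !ordX !PoszM; ring.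
Qed.

Let ord_inf_bc P : P (phi 'X) < 0 ->
  P (phi polb) = t%:Z * P (phi 'X) /\ P (phi polc) = t%:Z * P (phi 'X).
Proof.
move=> PX; rewrite (ord_inf PX polb0) (ord_inf PX polc0) size_polb size_polc.
by split.
Qed.

Lemma ord_weight_infinite P i : P (phi 'X) < 0 -> n%:Z * P (weight i) =
  ((n * expX t i + n * (t * expb t i))%N%:Z - (i * (t * t.+1))%N%:Z) * P (phi 'X).
Proof.
move=> PX; have [Pb Pc] := ord_inf_bc PX; rewrite ord_weight Pb Pc !PoszD !PoszM.
ring.
Qed.

(** At finite places the ceilings make every coefficient in [ord_weight] nonnegative; at infinity
    the condition is the degree bound behind [dim_at]. *)
Lemma weight_pole_space (i : 'I_n) (u : {poly F}) M :
  (dim_bound t <= M)%N -> (size u <= dim_at t M i)%N ->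
  pole_space iota phi M (phi u * weight i).
Proof.
move=> MM su P; have [->|u0] := eqVneq u 0; first by left; rewrite rmorph0 mul0r.
have uL0 : phi u != 0 by rewrite phi_eq0.
right; rewrite (ordM P uL0 (weight0 i)).
have n0 : 0 < n%:Z by [].
rewrite -(ler_pM2l n0) mulrDr; have lt_in := ltn_ord i.
have Alo := expX_lo t_gt0 i; have Blo := expb_lo t_gt0 lt_in.
have [PX|PX] := leP 0 (P (phi 'X)).
  have hb := gePh polb PX; have hc := gePh polc PX; have hu := gePh u PX.
  rewrite !mulr0; apply: addr_ge0; first exact: mulr_ge0.
  rewrite ord_weight; apply: addr_ge0; last exact: mulr_ge0.
  apply: addr_ge0; rewrite -mulrBl; apply: mulr_ge0; rewrite ?subr_ge0 ?lez_nat //.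
  by rewrite mulnC /n -mulnA leq_mul2l Alo orbT.
rewrite (ord_weight_infinite _ PX) (ord_inf PX u0) !mulrA -mulrDl (ler_nM2r PX).
have su0 : (0 < size u)%N by rewrite lt0n size_poly_eq0.
have dE := dim_atE t_gt0 MM lt_in.
have h : (size u).-1%:Z + (2 * expX t i + t * expb t i)%N%:Z <= M%:Z + i%:Z.
  by move: su su0 dE; clear; move: (size u) (dim_at t M i) => [|k] // l; lia.
move: h Alo; rewrite /n; move: (size u).-1 (expX t i) (expb t i) => d x y.
move: (nat_of_ord i) => j h1 h2.
have h3 : (t * t.+2)%N%:Z * (d%:Z + (2 * x + t * y)%N%:Z) <= (t * t.+2)%N%:Z * (M%:Z + j%:Z).
  by apply: ler_wpM2l.
have h4 : (t * j)%N%:Z <= (t * (t.+2 * x))%N%:Z by rewrite lez_nat leq_mul2l h2 orbT.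
move: h3 h4; rewrite !PoszD !PoszM -[t.+2]addn2 -[t.+1]addn1 !PoszD.
by move: t%:Z d%:Z x%:Z y%:Z j%:Z M%:Z => t' d' x' y' j' M' h3 h4; lra.
Qed.

(** At a place above a zero of [polc], [n%:Z * P Y] is the order of the irreducible [r]. A nonzero
    term of index [i] then has order [(k * n + i) * P Y], so the orders differ modulo [n] and
    nothing cancels. *)
Lemma powers_free (h : 'I_n -> {poly F}) :
  \sum_i phi (h i) * Y ^+ i = 0 -> forall i, h i = 0.
Proof.
have [r ir /dvdpP[c1 cE]] : exists2 r, irreducible_poly r & r %| polc.
  by apply: irreducible_divisor; rewrite size_polc ltnS.
have [P [Pr PX]] := place_fin ir.
have c10 : c1 != 0 by apply: contraNneq polc0 => e; rewrite cE e mul0r.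
have r0 := irredp_neq0 ir.
have Pc : 0 < P (phi polc).
  rewrite cE rmorphM ordM ?phi_eq0 //; apply: ltr_wpDl Pr; exact: PX.
have PcE : P (phi polc) = P (phi r).
  by case: (ord_polc_local (PX _) ir Pr) => // e; rewrite e in Pc.
have PX0 : P (phi 'X) = 0.
  by apply: ord_cop (PX _) _ Pc; rewrite coprimep_sym.
have Pb0 : P (phi polb) = 0.
  by apply: ord_cop (PX _) _ Pc; rewrite coprimep_sym.
have := ord_Y P; rewrite PX0 Pb0 !mulr0 !subr0 PcE => nY.
have PY : 0 < P Y by move: Pr; rewrite -nY pmulr_rgt0.
move=> sum0; have fi0 := @distinct_ord_sum _ _ _ P _ (fun i => phi (h i) * Y ^+ i) _ sum0.
have Yi0 k : Y ^+ k != 0 by rewrite expf_neq0.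
move=> i; have := fi0 _ i => /(_ _)/eqP; rewrite mulf_eq0 (negPf (Yi0 _)) orbF phi_eq0.
move=> /(_ _)/eqP; apply=> {}i j.
rewrite !mulf_eq0 !(negPf (Yi0 _)) !orbF !phi_eq0 => hi hj.
rewrite !ordM ?phi_eq0 // !ordX.
have [ki ->] := ord_mult_irreducible phi_eq0 phiC (PX _) ir Pr hi.
have [kj ->] := ord_mult_irreducible phi_eq0 phiC (PX _) ir Pr hj.
rewrite -nY !mulrA -!mulrDl => /(mulIf (lt0r_neq0 PY)) e.
apply: val_inj; rewrite /= -[LHS](modn_small (ltn_ord i)) -[RHS](modn_small (ltn_ord j)).
rewrite -[in LHS](modnMDl ki) -[in RHS](modnMDl kj); congr (_ %% _)%N.
by move: e; rewrite -!PoszM -!PoszD => -[].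
Qed.

Lemma aut_inv (f f' : {rmorphism L -> L}) z : z != 0 ->
  (forall h, f (phi h) = phi h) -> f Y = iota z * Y ->
  (forall h, f' (phi h) = phi h) -> f' Y = iota z^-1 * Y -> forall u, f (f' u) = u.
Proof.
move=> z0 fphi fY f'phi f'Y u; have [d [N [d0 uE]]] := expansion u.
have dL0 : phi d != 0 by rewrite phi_eq0.
apply: (mulfI dL0); rewrite -{1}[phi d]fphi -[X in f X * _]f'phi -!rmorphM uE.
rewrite !rmorph_sum; apply: eq_bigr => i _; rewrite !rmorphM f'phi fphi !rmorphXn.
rewrite f'Y rmorphM fY -{1}[iota z^-1]phiC fphi phiC mulrA -rmorphM mulVf //.
by rewrite rmorph1 mul1r.
Qed.

(** The place is composed with the automorphism [Y |-> z * Y]; its inverse carries a uniformizer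
    back. *)
Lemma twist_place P z : z != 0 -> exists P',
  (forall h, P' (phi h) = P (phi h)) /\ exists f : {rmorphism L -> L},
  [/\ forall h, f (phi h) = phi h, f Y = iota z * Y & forall u, P' u = P (f u)].
Proof.
move=> z0; have [f [fphi fY]] := aut z0.
have zV0 : z^-1 != 0 by rewrite invr_eq0.
have [f' [f'phi f'Y]] := aut zV0.
have fK := aut_inv z0 fphi fY f'phi f'Y.
unshelve eexists (@Place _ _ iota (fun u => P (f u)) _ _ _ _ _).
- by rewrite /= rmorph0 Defs.ord0.
- by move=> u w u0 w0; rewrite /= rmorphM ordM ?fmorph_eq0.
- by move=> u w u0 w0 uw0; rewrite /= rmorphD ordD -?rmorphD ?fmorph_eq0.
- by move=> c; rewrite /= -phiC fphi phiC ord_const.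
- have [v [v0 Pv]] := ord_unif P; exists (f' v); rewrite /= fK; split=> //.
  by rewrite fmorph_eq0.
by split=> [h|]; [rewrite /= fphi | exists f].
Qed.

Lemma pole_space_aut M u (f : {rmorphism L -> L}) z : z != 0 ->
  (forall h, f (phi h) = phi h) -> f Y = iota z * Y ->
  pole_space iota phi M u -> pole_space iota phi M (f u).
Proof.
move=> z0 fphi fY uM P; have [P' [P'phi [g [gphi gY P'E]]]] := twist_place P z0.
(* [twist_place] supplies its own automorphism [g], which agrees with [f] because both are
   determined on polynomials and [Y]. *)
have fg v : f v = g v.
  have [d [N [d0 vE]]] := expansion v; have dL0 : phi d != 0 by rewrite phi_eq0.
  have : f (phi d * v) = g (phi d * v).
    rewrite vE !rmorph_sum; apply: eq_bigr => i _.
    by rewrite !rmorphM fphi gphi !rmorphXn fY gY.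
  by rewrite !rmorphM fphi gphi => /(mulfI dL0).
have := uM P'; rewrite P'phi => -[->|]; first by left; rewrite rmorph0.
by right; rewrite fg -P'E.
Qed.

Lemma subsp_pole_space M : subsp iota (pole_space iota phi M).
Proof.
split=> [P|c u v uM vM P]; first exact: ord_ge0.
by have [_] := subsp_ord_ge P (M%:Z * Num.min (P (phi 'X)) 0); apply; [apply: uM | apply: vM].
Qed.

Let cardF1 : #|F|.-1 = n.
Proof. by rewrite cardF (_ : (t.+1 * t.+1)%N = n.+1) // /n; ring. Qed.

Let nF : n%:R != 0 :> F.
Proof.
by rewrite /n natrM -[t.+2]addn1 natrD sF tF add0r mulr1 oppr_eq0 oner_eq0.
Qed.

(* Averaging over the automorphisms [Y |-> z Y] projects onto the component of
   index [j]. *)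
Lemma pole_space_component M u (d : {poly F}) (N : 'I_n -> {poly F}) j : d != 0 ->
  phi d * u = \sum_i phi (N i) * Y ^+ i -> pole_space iota phi M u ->
  pole_space iota phi M (phi (N j) / phi d * Y ^+ j).
Proof.
move=> d0 uE uM; have dL0 : phi d != 0 by rewrite phi_eq0.
have /choice[f fP] : forall z : F, exists f : {rmorphism L -> L}, z != 0 ->
    (forall h, f (phi h) = phi h) /\ f Y = iota z * Y.
  move=> z; have [->|z0] := eqVneq z 0; first by exists idfun.
  by have [f fP] := aut z0; exists f.
have sub := subsp_pole_space M.
have avgM : pole_space iota phi M (\sum_(z | z != 0) iota (z ^- j) * f z u).
  elim/big_rec: _ => [|z v z0 vM]; first by case: sub.
  case: sub => _; apply=> //; have [fphi fY] := fP z z0.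
  exact: (pole_space_aut z0 fphi fY).
have avgE : phi d * \sum_(z | z != 0) iota (z ^- j) * f z u = iota n%:R * (phi (N j) * Y ^+ j).
  rewrite mulr_sumr.
  transitivity (\sum_(z : F | z != 0) \sum_(i < n) iota (z ^- j * z ^+ i) * (phi (N i) * Y ^+ i)).
    apply: eq_bigr => z z0; have [fphi fY] := fP z z0.
    rewrite mulrCA -[X in _ * (X * _)]fphi -rmorphM uE rmorph_sum mulr_sumr.
    apply: eq_bigr => i _; rewrite rmorphM fphi rmorphXn fY exprMn rmorphM rmorphXn.
    by rewrite -!mulrA; congr (_ * _); rewrite mulrCA.
  rewrite exchange_big (bigD1 j) //= [X in _ + X]big1 ?addr0 => [|i ij].
    rewrite -mulr_suml -rmorph_sum; congr (iota _ * _).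
    rewrite (eq_bigr (fun=> 1)) => [|z z0]; last by rewrite mulVf ?expf_neq0.
    by rewrite sumr_const -cardF1 -(cardC1 (0 : F)).
  rewrite -mulr_suml -rmorph_sum; set S := \sum_(z | _) _.
  suff -> : S = 0 by rewrite rmorph0 mul0r.
  have [ltij|ltji|/val_inj eqij] := ltngtP i j; last by rewrite eqij eqxx in ij.
    rewrite /S (reindex_inj invr_inj) /=.
    rewrite (eq_big (fun z => z != 0) (fun z => z ^+ (j - i))) => [|z|z].
    - by rewrite sum_char // subn_gt0 ltij cardF1 (leq_ltn_trans (leq_subr _ _)).
    - by rewrite invr_eq0.
    rewrite invr_eq0 => z0; rewrite exprVn invrK -{1}(subnK (ltnW ltij)) exprD exprVn.
    by rewrite mulfK // expf_neq0.
  rewrite /S (eq_bigr (fun z => z ^+ (i - j))) => [|z z0].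
    by rewrite sum_char // subn_gt0 ltji cardF1 (leq_ltn_trans (leq_subr _ _)).
  by rewrite -{1}(subnK (ltnW ltji)) exprD mulrCA mulVf ?mulr1 ?expf_neq0.
have -> : phi (N j) / phi d * Y ^+ j =
    iota n%:R^-1 * \sum_(z | z != 0) iota (z ^- j) * f z u.
  have nL0 : iota n%:R != 0 by rewrite fmorph_eq0.
  apply: (mulfI dL0); rewrite [RHS]mulrCA avgE [RHS]mulrA -rmorphM mulVf // rmorph1 mul1r.
  by rewrite mulrA [phi d * _]mulrC divfK.
exact: (subspZ _ sub).
Qed.

(* Every pole of the quotient by [monom j] would be visible at a place above it. *)
Lemma component_poly M (N d : {poly F}) (j : 'I_n) : d != 0 ->
  pole_space iota phi M (phi N / phi d * Y ^+ j) ->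
  exists h, phi N / phi d * Y ^+ j = phi h * weight j.
Proof.
move=> d0 wM; have dL0 : phi d != 0 by rewrite phi_eq0.
have [->|N0] := eqVneq N 0; first by exists 0; rewrite rmorph0 !mul0r.
(* Reduction of [N / (d * monom j)] to lowest terms [u / v]; the goal is that [v] is constant. *)
pose e := d * monom j; have e0 : e != 0 by rewrite mulf_neq0.
pose g := gcdp N e; have g0 : g != 0 by rewrite gcdp_eq0 negb_and N0.
have NE := divpK (dvdp_gcdl N e); have eE := divpK (dvdp_gcdr N e).
have cop : coprimep (N %/ g) (e %/ g) by apply: coprimep_div_gcd; rewrite N0.
rewrite -/g in NE eE; move: (N %/ g) (e %/ g) NE eE cop => u v NE eE cop.
have v0 : v != 0 by apply: contraNneq e0 => v0; rewrite -eE v0 mul0r.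
have u0 : u != 0 by apply: contraNneq N0 => u0; rewrite -NE u0 mul0r.
have gL0 : phi g != 0 by rewrite phi_eq0.
have vL0 : phi v != 0 by rewrite phi_eq0.
have uL0 : phi u != 0 by rewrite phi_eq0.
have wE : phi N / phi d * Y ^+ j = phi u / phi v * weight j.
  have mL0 : phi (monom j) != 0 by rewrite phi_eq0.
  rewrite /weight mulrA; congr (_ * _).
  apply: (mulfI (mulf_neq0 dL0 vL0)).
  have : phi N * phi v = phi d * phi u * phi (monom j).
    have eL : phi v * phi g = phi d * phi (monom j) by rewrite -!rmorphM eE.
    have NL : phi u * phi g = phi N by rewrite -rmorphM NE.
    apply: (mulIf gL0); transitivity (phi N * (phi v * phi g)); first ring.
    rewrite eL -NL; ring.
  move=> e1; transitivity (phi N * phi v); first by field.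
  by rewrite e1; field.
have [s1|s1] := leqP (size v) 1.
  have vC := size1_polyC s1; exists ((v`_0)^-1 *: u); rewrite wE; congr (_ * _).
  have vc0 : v`_0 != 0 by apply: contraNneq v0 => vc; rewrite vC vc polyC0.
  rewrite -mul_polyC rmorphM {1}vC phiC phiC mulrC fmorphV.
  by [].
have [r ir /dvdpP[v1 vE]] := irreducible_divisor s1.
have [P [Pr PX]] := place_fin ir.
have v10 : v1 != 0 by apply: contraNneq v0 => v10; rewrite vE v10 mul0r.
have r0 := irredp_neq0 ir.
have Pv : P (phi r) <= P (phi v).
  by rewrite vE rmorphM ordM ?phi_eq0 // lerDr; apply: PX.
have Pu : P (phi u) = 0.
  by apply: ord_cop (PX _) _ (lt_le_trans Pr Pv); rewrite coprimep_sym.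
exfalso; have := wM P; rewrite wE min_r; last exact: PX.
have q0 : phi u / phi v != 0 by rewrite mulf_neq0 ?invr_eq0.
move=> /(ord_ge_nz (mulf_neq0 q0 (weight0 j))).
rewrite mulr0 (ordM P q0 (weight0 j)) ord_div // Pu sub0r => Pge.
have n0 : 0 < n%:Z by [].
have : 0 <= n%:Z * (- P (phi v) + P (weight j)) by apply: mulr_ge0.
rewrite mulrDr ord_weight -!mulrBl; apply/negP; rewrite -ltNge.
have lt_jn := ltn_ord j; have Ahi := expX_hi t j; have Bhi := expb_hi t_gt0 lt_jn.
(* A ceiling exceeds its fraction by less than 1, so all three coefficients are below [n]. The
   weight thus has order less than that of [r], too small to compensate the pole created by [v]. *)
have := @ord_local_lt P r (PX _) ir Pr ((n * expX t j)%N%:Z - (j * t)%N%:Z)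
  ((n * expb t j)%N%:Z - (j * t.+1)%N%:Z) j%:Z.
have h : n%:Z * P (phi r) <= n%:Z * P (phi v) by apply: ler_wpM2l.
move=> /(_ _ _ _) k; rewrite mulrN addrC subr_lt0; apply: lt_le_trans h; apply: k.
- rewrite ltrBlDr -PoszD ltz_nat /n -!mulnA.
  have : (t * (t.+2 * expX t j) <= t * (j + t.+1))%N by rewrite leq_mul2l Ahi orbT.
  move=> /leq_ltn_trans; apply; rewrite mulnDr addnC [(j * t)%N]mulnC ltn_add2r.
  by rewrite ltn_mul2l t_gt0 ltnSn.
- by rewrite ltrBlDr -PoszD ltz_nat addnC.
- by rewrite ltz_nat.
Qed.

Lemma component_degree M h (j : 'I_n) : (dim_bound t <= M)%N ->
  pole_space iota phi M (phi h * weight j) -> (size h <= dim_at t M j)%N.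
Proof.
move=> MM hM; have [->|h0] := eqVneq h 0; first by rewrite size_poly0.
have hL0 : phi h != 0 by rewrite phi_eq0.
have [P PX] := place_inf; have := hM P; rewrite min_l ?ltW //.
move=> /(ord_ge_nz (mulf_neq0 hL0 (weight0 j))).
rewrite (ordM P hL0 (weight0 j)) (ord_inf PX h0) => le1.
have n0 : 0 <= n%:Z by [].
have := ler_wpM2l n0 le1; rewrite mulrDr (ord_weight_infinite _ PX) !mulrA -mulrDl (ler_nM2r PX).
move=> le2; have sh : (0 < size h)%N by rewrite lt0n size_poly_eq0.
apply: (pred_add_leq sh (degree_bound t_gt0 le2 (expX_hi t j))).
by rewrite (dim_atE t_gt0 MM (ltn_ord j)); ring.
Qed.

Theorem pole_space_dim M : (dim_bound t <= M)%N ->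
  has_dimq iota (pole_space iota phi M) [set 0] (\sum_(i < n) dim_at t M i).
Proof.
move=> MM; pose I := {i : 'I_n & 'I_(dim_at t M i)}.
have -> : (\sum_(i < n) dim_at t M i)%N = #|{: I}|.
  by rewrite card_tagged sumnE big_map big_enum; apply: eq_bigr => i _; rewrite card_ord.
pose b (ik : I) := phi 'X^(tagged ik) * weight (tag ik).
pose coefs (c : I -> F) (i : 'I_n) : {poly F} :=
  \sum_(k < dim_at t M i) c (Tagged (fun i : 'I_n => 'I_(dim_at t M i)) k) *: 'X^k.
have sumE c : \sum_ik iota (c ik) * b ik = \sum_i phi (coefs c i) * weight i.
  transitivity (\sum_(i < n) \sum_(k < dim_at t M i)
      iota (c (Tagged (fun i : 'I_n => 'I_(dim_at t M i)) k)) * (phi 'X^k * weight i)).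
    rewrite sig_big_dep /=; apply: eq_bigr => -[i k] _ //.
  apply: eq_bigr => i _; rewrite /coefs rmorph_sum mulr_suml; apply: eq_bigr => k _.
  by rewrite -mul_polyC rmorphM phiC mulrA.
apply: (has_dimq_indexed (b := b)); first exact: subsp_zero.
- move=> [i k]; apply: weight_pole_space => //.
  by rewrite size_polyXn /=; apply: ltn_ord.
- move=> c /=; rewrite sumE => sum0.
  have c0 : forall i, coefs c i * monom i = 0.
    apply: powers_free; rewrite -[RHS]sum0; apply: eq_bigr => i _.
    by rewrite /weight mulrA -rmorphM.
  move=> [i k]; have /eqP := c0 i; rewrite mulf_eq0 (negPf (monom0 i)) orbF => /eqP.
  move=> /(congr1 (fun p : {poly F} => p`_k)); rewrite coef0 /coefs coef_sum.
  rewrite (bigD1 k) //= coefZ coefXn eqxx mulr1 big1 ?addr0 // => l lk.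
  by rewrite coefZ coefXn eq_sym (_ : (l == k :> nat) = false) ?mulr0 //; apply/negbTE.
move=> u uM; have [d [N [d0 uE]]] := expansion u.
have dL0 : phi d != 0 by rewrite phi_eq0.
have /choice[h hE] : forall i, exists h,
    phi (N i) / phi d * Y ^+ i = phi h * weight i /\ (size h <= dim_at t M i)%N.
  move=> i; have wM := pole_space_component i d0 uE uM.
  have [h hE] := component_poly d0 wM; exists h; split=> //.
  by apply: component_degree => //; rewrite -hE.
exists (fun ik : I => (h (tag ik))`_(tagged ik)); rewrite sumE /=.
apply/eqP; rewrite subr_eq0; apply/eqP; apply: (mulfI dL0); rewrite uE mulr_sumr.
apply: eq_bigr => i _; have [hiE si] := hE i.
have -> : coefs (fun ik : I => (h (tag ik))`_(tagged ik)) i = h i.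
  rewrite /coefs /= -(poly_def _ (fun k => (h i)`_k)); apply/polyP => k.
  by rewrite coef_poly; case: ltnP => // lek; rewrite nth_default // (leq_trans si).
by rewrite -hiE mulrA [phi d * _]mulrC divfK.
Qed.

(** * Rational points *)

Hypothesis frobB : forall g h, (g - h) ^+ t.+1 = g ^+ t.+1 - h ^+ t.+1.
Hypothesis growth : forall (h g : {poly F}) m, h != 0 -> g != 0 ->
  (size h <= m.+1)%N -> (size g <= m.+1)%N -> bounded_growth iota (phi h / phi g) (n * m).
Hypothesis finite_zero : forall P : place iota, 0 <= P (phi 'X) ->
  exists2 h, h != 0 & 0 < P (phi h).

(** The constant [a ^+ t.+1] in [polb] is chosen for this: its power of exponent [t.+1] is
    [a ^+ #|F| = a]. *)
Let polb_pow : polb ^+ t.+1 = 'X^(t * t.+1) - a%:P.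
Proof. by rewrite /polb frobB -exprM -polyC_exp -exprM -cardF expf_card. Qed.

Let pow_n (c : F) : c != 0 -> c ^+ n = 1.
Proof.
move=> c0; apply: (mulfI c0); rewrite -exprS mulr1 -[RHS]expf_card cardF.
by congr (_ ^+ _); rewrite /n; ring.
Qed.

Let not_pow (c : F) : c != 0 -> (c ^+ t) ^+ t.+2 = 1.
Proof. by move=> c0; rewrite -exprM pow_n. Qed.

(** A zero [c] would make [a ^+ t.+1 = c ^+ t] trivial under the exponent [t.+2]; raising to the
    power [t.+1] once more returns this property to [a]. *)
Let polb_eval (c : F) : c != 0 -> polb.[c] != 0.
Proof.
move=> c0; rewrite /polb !hornerE subr_eq0; apply/eqP => e.
have := not_pow c0; rewrite e -exprM mulnC exprM => e1.
move: a_npow; rewrite -[a ^+ t.+2]expf_card cardF exprM e1 expr1n.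
by rewrite eqxx.
Qed.

Let polc_eval (c : F) : c != 0 -> polc.[c] != 0.
Proof.
move=> c0; rewrite /polc !hornerE subr_eq0; apply/eqP => e.
have : (a * c ^+ t) ^+ t.+2 = 1 by rewrite e expr1n.
by rewrite exprMn not_pow // mulr1 => /eqP; rewrite (negPf a_npow).
Qed.

Let neg_pow : (- 1) ^+ t.+2 = 1 :> F.
Proof.
have := expf_card (-1 : F); rewrite cardF -[LHS]signr_odd oddM /= => e.
rewrite -[LHS]signr_odd /=; case: (odd t) e => /= e; last by rewrite expr0.
by rewrite expr1 -e expr0.
Qed.

Lemma not_power_neg (c : F) : c ^+ t = - a -> False.
Proof.
move=> e; have c0 : c != 0.
  apply: contraTneq a0 => c0; move: e; rewrite c0 expr0n (gtn_eqF t_gt0) => /eqP.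
  by rewrite eq_sym oppr_eq0 negbK.
have := not_pow c0; rewrite e -mulN1r exprMn neg_pow mul1r => /eqP.
by rewrite (negPf a_npow).
Qed.

Lemma poly_eval_ge1 P (c : F) h : 0 < P (phi ('X - c%:P)) ->
  0 <= P (phi 'X) -> ord_ge P 1 (phi h - iota h.[c]).
Proof.
move=> Pc PX; have : root (h - (h.[c])%:P) c by rewrite rootE !hornerE subrr.
move=> /factor_theorem[g hE]; rewrite -phiC -rmorphB hE rmorphM.
have Pg := gePh g PX.
by rewrite -[X in ord_ge P X]add0r; apply: ord_geM; right.
Qed.

Lemma ord_eval_neq0 P (c : F) h : 0 < P (phi ('X - c%:P)) ->
  0 <= P (phi 'X) -> h.[c] != 0 -> P (phi h) = 0.
Proof.
move=> Pc PX hc; have ge1 := poly_eval_ge1 h Pc PX.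
apply/eqP; rewrite eq_le gePh // andbT leNgt; apply/negP => Ph.
apply: (ge1_const (P := P) hc).
have -> : iota h.[c] = phi h - (phi h - iota h.[c]) by ring.
by apply: ord_geB ge1; right.
Qed.

Lemma ord_X_ge0 P (c : F) : 0 < P (phi ('X - c%:P)) -> 0 <= P (phi 'X).
Proof.
move=> Pc; apply: ord_ge_nz => //; rewrite -['X](subrK c%:P) rmorphD phiC.
apply: ord_geD; last exact: ord_ge_const.
by right; apply: ltW.
Qed.

(** [u ^+ #|F| - u] is the product of the [u - iota z]; if no factor vanished at [P], the product
    would have order 0. *)
Lemma frob_residue P u : ord_ge P 0 u -> ord_ge P 1 (u ^+ #|F| - u) ->
  exists z, ord_ge P 1 (u - iota z).
Proof.
move=> u0; have -> : u ^+ #|F| - u = \prod_(z : F) (u - iota z).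
  have := congr1 (fun p => (map_poly iota p).[u]) (finField_genPoly F).
  rewrite rmorphB rmorphXn /= map_polyX !hornerE => ->.
  rewrite rmorph_prod horner_prod; apply: eq_bigr => z _.
  by rewrite rmorphB /= map_polyX map_polyC hornerXsubC.
move=> ge1; apply: contrapT => none.
have fz z : u - iota z != 0 /\ P (u - iota z) = 0.
  have nz : u - iota z != 0.
    by apply/eqP => e; apply: none; exists z; rewrite e; left.
  split=> //; have : ord_ge P 0 (u - iota z) by apply: ord_geB => //; apply: ord_ge_const.
  move=> /(ord_ge_nz nz) ge0; apply/eqP; rewrite eq_le ge0 andbT leNgt.
  by apply/negP => gt0; apply: none; exists z; right.
have p0 : \prod_(z : F) (u - iota z) != 0 by apply/prodf_neq0 => z _; case: (fz z).
move: (ord_ge_nz p0 ge1); rewrite ord_prod => [|z _]; last by case: (fz z).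
by rewrite big1 // => z _; case: (fz z).
Qed.

(** The key identity is ['X^t * polb ^+ t.+1 + polc = 'X^n - 1]: it turns [Y ^+ n - 1] into
    [- ('X^n - 1)] over a unit, and every [c] of [F] other than 0 is a root of the numerator. *)
Lemma ord_Y_pow P (c : F) : c != 0 -> 0 < P (phi ('X - c%:P)) ->
  P Y = 0 /\ ord_ge P 1 (Y ^+ n - 1).
Proof.
move=> c0 Pc; have PX := ord_X_ge0 Pc.
have PX0 : P (phi 'X) = 0 by apply: (ord_eval_neq0 Pc PX); rewrite hornerX.
have Pb0 := ord_eval_neq0 Pc PX (polb_eval c0).
have Pc0 := ord_eval_neq0 Pc PX (polc_eval c0).
have PY : P Y = 0.
  have := ord_Y P; rewrite PX0 Pb0 Pc0 !mulr0 !subr0 => /eqP.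
  by rewrite mulf_eq0 eqz_nat (gtn_eqF n_gt0) => /eqP.
split=> //; pose g := 'X^t * polb ^+ t.+1.
have gL0 : phi g != 0 by rewrite phi_eq0 mulf_neq0 ?expf_neq0 ?polyX_eq0.
have Pg : P (phi g) = 0.
  apply: (ord_eval_neq0 Pc PX); rewrite hornerM !horner_exp hornerX.
  by rewrite mulf_neq0 ?expf_neq0 ?polb_eval.
have e : (Y ^+ n - 1) * phi g = phi (- ('X^n - 1)).
  rewrite mulrBl mul1r YE -rmorphN -rmorphB; congr (phi _).
  have -> : n = (t + t * t.+1)%N by rewrite /n; ring.
  by rewrite /g polb_pow /polc exprD; ring.
have h : ord_ge P 1 ((Y ^+ n - 1) * phi g).
  have := poly_eval_ge1 (- ('X^n - 1)) Pc PX.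
  by rewrite e !hornerE pow_n // subrr oppr0 rmorph0 subr0.
by move: h => /(ord_geM_eq _ _ _ gL0); rewrite Pg subr0.
Qed.

Definition at_point P (c z : F) := 0 < P (phi ('X - c%:P)) /\ ord_ge P 1 (Y - iota z).

Let XsubC0 (c : F) : phi ('X - c%:P) != 0.
Proof. by rewrite phi_eq0 polyXsubC_eq0. Qed.

Let const_eq P u (c z : F) : ord_ge P 1 (u - iota c) -> ord_ge P 1 (u - iota z) -> c = z.
Proof.
move=> uc uz; apply/eqP/negPn/negP => cz; apply: (ge1_const (P := P) (c := c - z)).
  by rewrite subr_eq0.
have -> : iota (c - z) = (u - iota z) - (u - iota c) by rewrite rmorphB; ring.
exact: ord_geB.
Qed.

Lemma at_point_inj P c z c' z' : at_point P c z -> at_point P c' z' -> c = c' /\ z = z'.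
Proof.
move=> [Pc Pz] [Pc' Pz']; split; last exact: const_eq Pz Pz'.
by apply: (@const_eq P (phi 'X)); right; rewrite -phiC -rmorphB.
Qed.

Lemma at_point_intro P c : c != 0 -> 0 < P (phi ('X - c%:P)) ->
  exists2 z, z != 0 & at_point P c z.
Proof.
move=> c0 Pc; have [PY Yn] := ord_Y_pow c0 Pc.
have [||z Pz] := @frob_residue P Y; first by right; rewrite PY.
  have -> : Y ^+ #|F| - Y = (Y ^+ n - 1) * Y.
    rewrite cardF mulrBl mul1r -exprSr; congr (_ ^+ _ - _); rewrite /n; ring.
  by rewrite -[X in ord_ge P X]addr0; apply: ord_geM Yn _; right; rewrite PY.
exists z => //; apply/eqP => z0; move: Pz; rewrite z0 rmorph0 subr0.
by move=> /(ord_ge_nz Y0); rewrite PY.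
Qed.

(** Any place above [c] sees [Y] with some residue [w]; twisting by [z / w] changes the residue to
    [z]. *)
Lemma at_point_exists c z : c != 0 -> z != 0 -> exists P, at_point P c z.
Proof.
move=> c0 z0; have [P [Pc _]] := place_fin (irredp_XsubC c).
have [w w0 [_ Pw]] := at_point_intro c0 Pc.
have wz0 : z / w != 0 by rewrite mulf_neq0 ?invr_eq0.
have [P' [P'phi [f [fphi fY P'E]]]] := twist_place P wz0.
exists P'; split; first by rewrite P'phi.
have e : f (Y - iota z) = iota (z / w) * (Y - iota w).
  have fi v : f (iota v) = iota v by rewrite -phiC fphi.
  by rewrite rmorphB fY fi mulrBr -rmorphM divfK.
have zw0 : iota (z / w) != 0 by rewrite fmorph_eq0.
case: Pw => [Yw|Pw]; [left | right].
  by apply/eqP; rewrite -(fmorph_eq0 f) e Yw mulr0.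
have [Yw|Yw] := eqVneq (Y - iota w) 0; first by rewrite Yw Defs.ord0 in Pw.
by rewrite P'E e ordM // ord_const add0r.
Qed.

Lemma fundamental_ineq_fibre (c : F) (S : seq (place iota)) : uniq S ->
  (forall P, P \in S -> 0 < P (phi ('X - c%:P))) ->
  (\sum_(P <- S) `|P (phi ('X - c%:P)%R)| * place_deg P <= n)%N.
Proof.
move=> uS SP; have Xc0 : 'X - c%:P != 0 by rewrite polyXsubC_eq0.
have := growth (m := 1) Xc0 (oner_neq0 _) _ _; rewrite size_XsubC size_poly1 => /(_ isT isT).
rewrite rmorph1 divr1 muln1 => gX.
by apply: (fundamental_ineq gX (XsubC0 c) uS) => P PS; apply/ltW/SP.
Qed.

Let res_deg P : has_res_deg P (place_deg P).
Proof. exact: (curve_res_deg phi_eq0 growth finite_zero). Qed.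

Lemma points_choice : exists pt : F -> F -> place iota,
  forall c z, c != 0 -> z != 0 -> at_point (pt c z) c z.
Proof.
have /choice[pt ptP] : forall cz : F * F, exists P : place iota,
    cz.1 != 0 -> cz.2 != 0 -> at_point P cz.1 cz.2.
  move=> [c z]; have [P0 _] := place_inf.
  have [->|c0] := eqVneq c 0; first by exists P0 => /eqP.
  have [->|z0] := eqVneq z 0; first by exists P0 => _ /eqP.
  by have [P Pcz] := at_point_exists c0 z0; exists P.
by exists (fun c z => pt (c, z)) => c z; exact: (ptP (c, z)).
Qed.

Lemma residue_of_deg1 P u : place_deg P = 1%N -> ord_ge P 0 u ->
  exists z, ord_ge P 1 (u - iota z).
Proof.
move=> P1 u0; have := res_deg P; rewrite P1 => /(has_dimqP _ _ (subsp_ord_ge P 1))[b [_ _ spb]].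
have O1 : ord_ge P 0 1 by right; rewrite ord_1.
(* The basis vector of the residue field need not be 1; the coordinate [c1] of 1 serves to
   rescale. *)
have [c1] := spb 1 O1.
have [c] := spb u u0; rewrite !big_ord1 => uc oc.
have c10 : c1 ord0 != 0.
  by apply/eqP => e; move: oc; rewrite e rmorph0 mul0r subr0; apply: n1.
exists (c ord0 / c1 ord0).
have -> : u - iota (c ord0 / c1 ord0) =
   (u - iota (c ord0) * b ord0) - iota (c ord0 / c1 ord0) * (1 - iota (c1 ord0) * b ord0).
  have e : iota (c ord0 / c1 ord0) * iota (c1 ord0) = iota (c ord0) by rewrite -rmorphM divfK.
  by move: (iota (c ord0 / c1 ord0)) e => v e; rewrite mulrBr mulrA e mulr1; ring.
apply: ord_geB uc _; rewrite -[X in ord_ge P X]add0r.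
exact: ord_geM (ord_ge_const _ _) oc.
Qed.

Let residueX P u z k : ord_ge P 0 u -> ord_ge P 1 (u - iota z) ->
  ord_ge P 1 (u ^+ k - iota (z ^+ k)).
Proof.
move=> u0 uz; rewrite rmorphXn subrXX -[X in ord_ge P X]addr0; apply: ord_geM uz _.
apply: ord_ge_sum => i _; rewrite -[X in ord_ge P X]addr0; apply: ord_geM.
  by rewrite -(mulr0 (k.-1 - i)%N%:Z); apply: ord_geX.
by rewrite -(mulr0 (i : nat)%:Z); apply/ord_geX/ord_ge_const.
Qed.

Let Yt : (Y ^+ t.+2) ^+ t = Y ^+ n.
Proof. by rewrite -exprM mulnC. Qed.

Let YE' : Y ^+ n * (phi 'X ^+ t * phi (polb ^+ t.+1)) = - phi polc.
Proof. by rewrite -YE rmorphM [phi 'X^t]rmorphXn. Qed.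

Let bs0 : phi (polb ^+ t.+1) != 0.
Proof. by rewrite phi_eq0 expf_neq0. Qed.

(* A point at infinity would give [Z = Y ^+ t.+2 * x ^+ t.+1] a residue [z] in [F]
   with [z ^+ t = - a]; above [x = 0], [Z = Y ^+ t.+2 * x] leads to [- a^-1]. *)
Lemma rational_not_infinite P : place_deg P = 1%N -> 0 <= P (phi 'X).
Proof.
move=> P1; rewrite leNgt; apply/negP => PX.
have [Pb Pc] := ord_inf_bc PX; have := ord_Y P; rewrite Pb Pc => nPY.
pose Z := Y ^+ t.+2 * phi 'X ^+ t.+1.
have t0 : t%:Z != 0 by rewrite eqz_nat -lt0n.
have PZ : P Z = 0.
  rewrite /Z ordM ?expf_neq0 // !ordX; apply: (mulfI t0).
  by rewrite mulr0 mulrDr mulrA -PoszM -/n nPY; ring.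
have Z0 : ord_ge P 0 Z by right; rewrite PZ.
have [z Zz] := residue_of_deg1 P1 Z0.
apply: (@not_power_neg z).
have zt := residueX t Z0 Zz. apply: (const_eq zt).
rewrite rmorphN opprK; pose h : {poly F} := 'X^(t * t) - (a ^+ 2)%:P.
(* By the curve equation the product is [x ^ (t * t) - a ^ 2]. Against [polb ^+ t.+1], of degree
   [t * t.+1], this leaves [Z ^+ t + a] an order of at least [- t * P x > 0]. *)
have e : (Z ^+ t + iota a) * phi (polb ^+ t.+1) = phi h.
  have Xt0 : phi 'X ^+ t != 0 by rewrite expf_neq0.
  apply: (mulIf Xt0); rewrite mulrDl mulrDl.
  have -> : Z ^+ t * phi (polb ^+ t.+1) * phi 'X ^+ t =
      Y ^+ n * (phi 'X ^+ t * phi (polb ^+ t.+1)) * phi 'X ^+ (t.+1 * t).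
    by rewrite /Z exprMn Yt -exprM; ring.
  rewrite YE' polb_pow -phiC /h /polc polyC_exp; rewrite -!rmorphXn -rmorphN -!rmorphM -rmorphD.
  congr (phi _); have -> : 'X^(t.+1 * t) = 'X^(t * t) * 'X^t :> {poly F}.
    by rewrite -exprD; congr (_ ^+ _); ring.
  have -> : 'X^(t * t.+1) = 'X^(t * t) * 'X^t :> {poly F}.
    by rewrite -exprD; congr (_ ^+ _); ring.
  ring.
have sh : size h = (t * t).+1 by rewrite /h size_XnsubC // muln_gt0 t_gt0.
have h0 : h != 0 by rewrite -size_poly_eq0 sh.
have : ord_ge P ((t * t)%N%:Z * P (phi 'X)) (phi h) by right; rewrite (ord_inf PX h0) sh.
rewrite -e => /(ord_geM_eq _ _ _ bs0); apply: ord_geW.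
rewrite rmorphXn ordX Pb mulrA -mulrBl -!PoszM.
have t0' : 0 < t%:Z by [].
rewrite (_ : _ - _ = - t%:Z); last by rewrite mulSn PoszD; ring.
rewrite mulNr -mulrN; apply: mulr_ege1; first by [].
by rewrite -gtz0_ge1 oppr_gt0.
Qed.

Lemma rational_not_zero P : place_deg P = 1%N -> ~ 0 < P (phi 'X).
Proof.
move=> P1 PX; have PX0 := ltW PX.
have Pb := ord_cop PX0 coprimeXb PX; have Pc := ord_cop PX0 coprimeXc PX.
have := ord_Y P; rewrite Pb Pc => nPY.
pose Z := Y ^+ t.+2 * phi 'X.
have t0 : t%:Z != 0 by rewrite eqz_nat -lt0n.
have PZ : P Z = 0.
  rewrite /Z ordM ?expf_neq0 // !ordX; apply: (mulfI t0).
  by rewrite mulr0 mulrDr mulrA -PoszM -/n nPY; ring.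
have Z0 : ord_ge P 0 Z by right; rewrite PZ.
have [z Zz] := residue_of_deg1 P1 Z0.
suff e : z ^+ t = - a^-1.
  by apply: (@not_power_neg z^-1); rewrite exprVn e invrN invrK.
have zt := residueX t Z0 Zz; apply: (const_eq zt); rewrite rmorphN opprK.
(* The constant terms of [- polc] and [a^-1 * polb ^+ t.+1] are [1] and [- 1]; they cancel, and the
   factor ['X] shows that [Z ^+ t + a^-1] vanishes at [P]. *)
pose h : {poly F} := 'X * (- (a%:P * 'X^(t.-1)) + (a^-1)%:P * 'X^((t * t.+1).-1)).
have e : (Z ^+ t + iota a^-1) * phi (polb ^+ t.+1) = phi h.
  rewrite mulrDl.
  have -> : Z ^+ t * phi (polb ^+ t.+1) = Y ^+ n * (phi 'X ^+ t * phi (polb ^+ t.+1)).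
    by rewrite /Z exprMn Yt; ring.
  rewrite YE' polb_pow -phiC -rmorphN -rmorphM -rmorphD; congr (phi _).
  have e1 : 'X * 'X^(t.-1) = 'X^t :> {poly F} by rewrite -exprS prednK.
  have e2 : 'X * 'X^((t * t.+1).-1) = 'X^(t * t.+1) :> {poly F}.
    by rewrite -exprS prednK // muln_gt0 t_gt0.
  have -> : h = - (a%:P * ('X * 'X^(t.-1))) + (a^-1)%:P * ('X * 'X^((t * t.+1).-1)).
    by rewrite /h; ring.
  rewrite e1 e2.
  rewrite /polc mulrBr -polyCM mulVf // polyC1; ring.
have : ord_ge P 1 (phi h).
  rewrite /h rmorphM -[X in ord_ge P X]addr0; apply: ord_geM; first by right.
  by right; apply: gePh.
rewrite -e => /(ord_geM_eq _ _ _ bs0).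
by rewrite rmorphXn ordX Pb mulr0 subr0.
Qed.

Lemma rational_finite P : place_deg P = 1%N ->
  exists2 c, c != 0 & 0 < P (phi ('X - c%:P)).
Proof.
move=> P1; have PX := rational_not_infinite P1.
have [c Pc] := residue_of_deg1 P1 (or_intror PX : ord_ge P 0 (phi 'X)).
have Pc' : 0 < P (phi ('X - c%:P)).
  by move: Pc; rewrite -phiC -rmorphB => /(ord_ge_nz (XsubC0 c)).
exists c => //; apply/eqP => c0; apply: (rational_not_zero P1).
by move: Pc'; rewrite c0 subr0.
Qed.

Section Points.
Variable pt : F -> F -> place iota.
Hypothesis ptP : forall c z, c != 0 -> z != 0 -> at_point (pt c z) c z.

Let Fstar := enum (predC1 (0 : F)).
Let FstarP z : (z \in Fstar) = (z != 0). Proof. by rewrite mem_enum. Qed.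
Let size_Fstar : size Fstar = n. Proof. by rewrite -cardE cardC1 cardF1. Qed.

Definition fibre c := [seq pt c z | z <- Fstar].

Lemma fibre_uniq c : c != 0 -> uniq (fibre c).
Proof.
move=> c0; rewrite map_inj_in_uniq ?enum_uniq // => z w; rewrite !FstarP => z0 w0 e.
by have := ptP c0 w0; rewrite -e => /(at_point_inj (ptP c0 z0))[].
Qed.

Lemma size_fibre c : size (fibre c) = n.
Proof. by rewrite size_map. Qed.

Lemma fibre_ord c P : c != 0 -> P \in fibre c -> 0 < P (phi ('X - c%:P)).
Proof. by move=> c0 /mapP[z]; rewrite FstarP => z0 ->; case: (ptP c0 z0). Qed.

Let term_gt0 c P : 0 < P (phi ('X - c%:P)) ->
  (place_deg P <= `|P (phi ('X - c%:P)%R)| * place_deg P)%N.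
Proof. by move=> Pc; rewrite leq_pmull // absz_gt0 gt_eqF. Qed.

Let deg_gt0 P : (0 < place_deg P)%N. Proof. exact: res_deg_gt0 (res_deg P). Qed.

Lemma size_fibre_leq c (S : seq (place iota)) :
  (forall P, P \in S -> 0 < P (phi ('X - c%:P))) ->
  (size S <= \sum_(P <- S) `|P (phi ('X - c%:P)%R)| * place_deg P)%N.
Proof.
move=> SP; rewrite -sum1_size big_seq [X in (_ <= X)%N]big_seq; apply: leq_sum => P PS.
exact: leq_trans (deg_gt0 P) (term_gt0 (SP P PS)).
Qed.

(** One more place would give [n + 1] positive contributions to a sum bounded by [n]. *)
Lemma fibre_complete c P : c != 0 -> 0 < P (phi ('X - c%:P)) -> P \in fibre c.
Proof.
move=> c0 Pc; apply/negPn/negP => PS; pose S := P :: fibre c.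
have uS : uniq S by rewrite /= PS fibre_uniq.
have SP Q : Q \in S -> 0 < Q (phi ('X - c%:P)).
  by rewrite inE => /orP[/eqP->//|]; apply: fibre_ord.
have := leq_trans (size_fibre_leq SP) (fundamental_ineq_fibre uS SP).
by rewrite /= size_fibre ltnn.
Qed.

(** [n] positive contributions with sum at most [n] are all equal to 1. *)
Lemma fibre_deg c P : c != 0 -> P \in fibre c -> place_deg P = 1%N.
Proof.
move=> c0 PS; have SP Q : Q \in fibre c -> 0 < Q (phi ('X - c%:P)) by apply: fibre_ord.
have := fundamental_ineq_fibre (fibre_uniq c0) SP; rewrite (big_rem P) //=.
have SP' Q : Q \in rem P (fibre c) -> 0 < Q (phi ('X - c%:P)) by move=> /mem_rem/SP.
have := size_fibre_leq SP'; rewrite size_rem // size_fibre.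
have := term_gt0 (SP P PS); have := deg_gt0 P.
move: (`|P (phi ('X - c%:P)%R)| * place_deg P)%N
  (\sum_(Q <- rem P (fibre c)) `|Q (phi ('X - c%:P)%R)| * place_deg Q)%N.
by move: (place_deg P) n_gt0; clear; move: n => k w k0 u v; lia.
Qed.

Lemma rational_points_card : rational_points iota #= `I_(n * n).
Proof.
pose R := [seq pt c z | c <- Fstar, z <- Fstar].
have uR : uniq R.
  apply: allpairs_uniq; rewrite ?enum_uniq // => -[c z] [c' z'].
  move=> /allpairsP[[c1 z1] /= [+ + [-> ->]]] /allpairsP[[c2 z2] /= [+ + [-> ->]]].
  rewrite !FstarP => c10 z10 c20 z20 e; have := ptP c20 z20.
  by rewrite -e => /(at_point_inj (ptP c10 z10))[-> ->].
have memR P : (P \in R) = (place_deg P == 1%N).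
  apply/allpairsP/eqP => [[[c z] /= []]|P1].
    rewrite !FstarP => c0 z0 ->; apply: (fibre_deg c0).
    by apply: map_f; rewrite FstarP.
  have [c c0 Pc] := rational_finite P1.
  have /mapP[z zF ->] := fibre_complete c0 Pc.
  by exists (c, z); split => //=; rewrite FstarP.
have -> : rational_points iota = [set` [fset P in R]%fset].
  apply/seteqP; split=> P /=; first by rewrite in_fset memR => /eqP.
  by rewrite in_fset memR => /eqP.
by apply/card_eq_fsetP; rewrite card_fseq undup_id // size_allpairs size_Fstar.
Qed.

End Points.

Theorem kummer_rational_points : rational_points iota #= `I_(n * n).
Proof. by have [pt ptP] := points_choice; exact: (rational_points_card ptP). Qed.

Theorem kummer_genus :
  is_genus iota ((t.+1%:Z - 1) * ((t.+1 * t.+1)%N%:Z - 2) - t.+1%:Z + 2).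
Proof.
apply: (genus_criterion phi_eq0 phiC growth finite_zero (M0 := dim_bound t)
  (dim := fun M => (\sum_(i < n) dim_at t M i)%N)).
- by move=> M MM; rewrite sum_dim_at.
- exact: pole_space_dim.
have [pt ptP] := points_choice; exists (fibre pt 1).
have one0 : 1 != 0 :> F by apply: oner_neq0.
split; [exact: fibre_uniq | exact: size_fibre |].
by move=> P /(fibre_ord ptP one0); rewrite polyC1.
Qed.


End Kummer.

(** * Kummer theory and specialization to the function field *)

Section SimpleKummer.
Variables (K : fieldType) (L : fieldExtType K) (n : nat) (Y : L) (c : K).
Hypothesis n_gt0 : (0 < n)%N.
Hypothesis Yn : Y ^+ n = c%:A.
Hypothesis genY : <<1; Y>>%VS = fullv.

Let p : {poly L} := 'X^n - (c%:A)%:P.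

Let pE : p \is a polyOver 1%AS.
Proof. by rewrite rpredB ?rpredX ?polyOverX // polyOverC rpredZ // mem1v. Qed.

Let pY : root p Y.
Proof. by rewrite rootE !hornerE Yn subrr. Qed.

Let sizep : size p = n.+1. Proof. exact: size_XnsubC. Qed.

Let degree_le : (adjoin_degree 1%AS Y <= n)%N.
Proof.
have := minPoly_dvdp pE pY; move=> /dvdp_leq; rewrite -size_poly_eq0 sizep => /(_ isT).
by rewrite size_minPoly ltnS.
Qed.

Lemma kummer_span (z : L) : exists u : 'I_n -> K, z = \sum_i u i *: Y ^+ i.
Proof.
have /polyOver1P[u uE] := Fadjoin_polyOver 1%AS Y z.
have zY : z \in <<1; Y>>%VS by rewrite genY memvf.
exists (fun i => u`_i); rewrite -{1}(Fadjoin_poly_eq zY).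
rewrite (@horner_coef_wide _ n); last exact: leq_trans (size_Fadjoin_poly _ _ _) degree_le.
by apply: eq_bigr => i _; rewrite uE coef_map /= mulr_algl.
Qed.

Hypothesis freeY : forall u : 'I_n -> K, \sum_i u i *: Y ^+ i = 0 -> forall i, u i = 0.

(** The minimal polynomial divides [p]; a smaller degree would be a linear relation between the
    first [n] powers of [Y]. *)
Lemma kummer_minPoly : minPoly 1%AS Y = p.
Proof.
have mdvd := minPoly_dvdp pE pY; apply/eqP.
rewrite -eqp_monic ?monic_minPoly // ?monicXnsubC //.
rewrite -dvdp_size_eqp // sizep size_minPoly eqSS eqn_leq degree_le leqNgt.
apply/negP => lt_dn; have /polyOver1P[u uE] := minPolyOver 1%AS Y.
have sm : (size (minPoly 1%AS Y) <= n)%N by rewrite size_minPoly.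
have sum0 : \sum_(i < n) u`_i *: Y ^+ i = 0.
  rewrite -[RHS](minPolyxx 1%AS Y) (horner_coef_wide _ sm).
  by apply: eq_bigr => i _; rewrite uE coef_map /= mulr_algl.
have u0 := freeY sum0.
have : minPoly 1%AS Y = 0.
  apply/polyP => i; rewrite coef0 uE coef_map /=; have [lt_in|le_ni] := ltnP i n.
    by rewrite (u0 (Ordinal lt_in)) scale0r.
  have := uE => /(congr1 (fun q : {poly L} => q`_i)); rewrite coef_map /= => <-.
  by rewrite nth_default // (leq_trans sm).
by apply/eqP; rewrite monic_neq0 // monic_minPoly.
Qed.

Lemma kummer_aut (z : K) : z ^+ n = 1 -> exists f : {rmorphism L -> L},
  (forall u : K, f u%:A = u%:A) /\ f Y = z%:A * Y.
Proof.
move=> zn; pose f := kHomExtend 1%AS \1%VF Y (z%:A * Y).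
have root_zY : root (map_poly \1%VF (minPoly 1%AS Y)) (z%:A * Y).
  rewrite (eq_map_poly (g := id)) ?map_poly_id // => [|u]; last by rewrite lfunE.
  rewrite kummer_minPoly rootE !hornerE exprMn Yn.
  by rewrite -in_algE -rmorphXn zn rmorph1 mul1r subrr.
have homf : kHom 1%AS {:L} f.
  by rewrite -genY; apply: kHomExtendP (subvv _) (kHom1 _ _) root_zY.
have fM : monoid_morphism f by apply/kHom_monoid_morphism.
pose fM' := GRing.isMonoidMorphism.Build _ _ f fM.
pose fR : {rmorphism L -> L} := HB.pack (fun_of_lfun f) fM'.
exists fR; split=> [u|].
  have /kHomP_tmp[fid _] := homf.
  by apply: fid; rewrite rpredZ // mem1v.
by apply: (kHomExtend_val (kHom1 1%AS 1%AS)).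
Qed.

End SimpleKummer.

(** The multiplicative group is cyclic of order [k * l]: for a generator [w] and [a = w ^+ i], the
    condition [a ^+ l = 1] means that [k] divides [i]. *)
Lemma finField_power (F : finFieldType) (k l : nat) (a : F) : (0 < l)%N ->
  #|F|.-1 = (k * l)%N -> a != 0 -> a ^+ l = 1 -> exists2 b, b != 0 & a = b ^+ k.
Proof.
move=> l0 cF a0 al; set n := #|F|.-1 in cF.
have n0 : (0 < n)%N by rewrite /n -subn1 subn_gt0 finNzRing_gt1.
have F1 : #|F| = n.+1 by rewrite /n prednK // (ltnW (finNzRing_gt1 F)).
have powF (z : F) : z != 0 -> z ^+ n = 1.
  by move=> z0; apply: (mulfI z0); rewrite -exprS -F1 expf_card mulr1.
have /hasP[w _ prw] : has n.-primitive_root (enum (predC1 (0 : F))).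
  apply: cyclic.has_prim_root => //.
  - by apply/allP => z; rewrite mem_enum => z0; rewrite unity_rootE powF.
  - exact: enum_uniq.
  - by rewrite -cardE cardC1.
have [[i /= _] aE] := prim_rootP prw (powF a a0).
have w0 : w != 0.
  apply/eqP => w0; move: (prim_expr_order prw); rewrite w0 expr0n (gtn_eqF n0) => /eqP.
  by rewrite eq_sym oner_eq0.
have /eqP : w ^+ (i * l) = 1 by rewrite exprM -aE.
rewrite -(prim_order_dvd prw) cF dvdn_pmul2r // => /dvdnP[j iE].
by exists (w ^+ j); rewrite ?expf_neq0 // aE iE exprM.
Qed.

Lemma pchar_exprB (p m : nat) (R : comNzRingType) (u v : R) :
  p \in [pchar R] -> (u - v) ^+ (p ^ m)%N = u ^+ (p ^ m)%N - v ^+ (p ^ m)%N.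
Proof.
move=> pR; have pnat : [pchar R].-nat (p ^ m)%N.
  rewrite pnatX; apply/orP; left.
  by rewrite pnatE ?(pcharf_prime pR).
have D (x y : R) := exprDn_pchar x y pnat.
rewrite D; congr (_ + _); apply/eqP; rewrite -subr_eq0 opprK addrC -D subrr.
by rewrite expr0n gtn_eqF // expn_gt0 prime_gt0 ?(pcharf_prime pR).
Qed.

Section KummerFunctionField.
Variables (F : finFieldType) (L : fieldExtType {fraction {poly F}}).
Local Notation K := {fraction {poly F}}.
Local Notation "h %:F" := (@tofrac _ h).
Local Notation phi := (@polyL F L).

Variable t : nat.
Hypothesis t_gt0 : (0 < t)%N.
Hypothesis cardF : #|F| = (t.+1 * t.+1)%N.
Hypothesis sF : t.+1%:R = 0 :> F.
Let n := (t * t.+2)%N.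

Variable a : F.
Hypothesis a0 : a != 0.
Hypothesis a_npow : a ^+ t.+2 != 1.
Hypothesis frobB : forall g h : {poly F}, (g - h) ^+ t.+1 = g ^+ t.+1 - h ^+ t.+1.

Variable Y : L.
Hypothesis Y0 : Y != 0.
Hypothesis YE : Y ^+ n * phi ('X^t * polb t a ^+ t.+1) = - phi (polc t a).
Hypothesis genY : <<1; Y>>%VS = fullv.

Let phi_eq0 : forall h, (phi h == 0) = (h == 0). Proof. exact: polyL_eq0. Qed.
Let phiC : forall c, phi c%:P = const_emb L c.
Proof. by move=> c; rewrite const_embE. Qed.

Let n_gt0 : (0 < n)%N. Proof. by rewrite muln_gt0 t_gt0. Qed.

Let scaleE (g d : {poly F}) (u : L) : d != 0 -> phi d * ((g%:F / d%:F) *: u) = phi g * u.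
Proof.
move=> d0; have dL0 : phi d != 0 by rewrite phi_eq0.
by rewrite -mulr_algl polyL_frac mulrA mulrCA divff // mulr1.
Qed.

Let Yn : exists c : K, Y ^+ n = c%:A.
Proof.
pose g := 'X^t * polb t a ^+ t.+1; have YE' : Y ^+ n * phi g = - phi (polc t a) := YE.
have g0 : g != 0.
  rewrite mulf_neq0 ?expf_neq0 ?polyX_eq0 //.
  by rewrite -size_poly_eq0 size_XnsubC.
have gL0 : phi g != 0 by rewrite phi_eq0.
exists ((- polc t a)%:F / g%:F); rewrite polyL_frac polyLN -YE'.
by rewrite mulfK.
Qed.

Let span (z : L) : exists u : 'I_n -> K, z = \sum_i u i *: Y ^+ i.
Proof. by have [c Yc] := Yn; exact: (kummer_span n_gt0 Yc genY). Qed.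

Let expansion (z : L) : exists (d : {poly F}) (N : 'I_n -> {poly F}),
  d != 0 /\ phi d * z = \sum_i phi (N i) * Y ^+ i.
Proof.
have [u ->] := span z; have [d [N [d0 uE]]] := common_den u.
exists d, N; split=> //; rewrite mulr_sumr; apply: eq_bigr => i _.
by rewrite uE; apply: scaleE.
Qed.

Let place_fin := @place_finite F L.
Let place_inf := @place_infinite F L.

(** Irreducibility of the Kummer equation over F(x), obtained from ramification above a zero of
    [polc]. It must come before [aut], which is built on it. *)
Let freeY (u : 'I_n -> K) : \sum_i u i *: Y ^+ i = 0 -> forall i, u i = 0.
Proof.
move=> sum0; have [d [N [d0 uE]]] := common_den u.
have N0 : forall i, N i = 0.
  apply: (powers_free phi_eq0 phiC t_gt0 sF a0 a_npow Y0 YE place_fin).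
  rewrite -[RHS](mulr0 (phi d)) -[X in _ = phi d * X]sum0 mulr_sumr.
  by apply: eq_bigr => i _; rewrite uE; symmetry; apply: scaleE.
by move=> i; rewrite uE N0 tofrac0 mul0r.
Qed.

Let aut (z : F) : z != 0 -> exists f : {rmorphism L -> L},
  (forall h, f (phi h) = phi h) /\ f Y = const_emb L z * Y.
Proof.
move=> z0; have [c Yc] := Yn.
have zn : ((z%:P)%:F : K) ^+ n = 1.
  rewrite -tofracXn -polyC_exp (_ : z ^+ n = 1) ?tofrac1 //.
  apply: (mulfI z0); rewrite -exprS mulr1 -[RHS]expf_card cardF.
  by congr (_ ^+ _); rewrite /n; ring.
have [f [fK fY]] := kummer_aut n_gt0 Yc genY freeY zn.
exists f; split=> [h|]; first exact: fK.
by rewrite const_embE fY.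
Qed.

Let growth (h g : {poly F}) m : h != 0 -> g != 0 ->
  (size h <= m.+1)%N -> (size g <= m.+1)%N ->
  bounded_growth (const_emb L) (phi h / phi g) (n * m).
Proof. exact: (rational_growth span). Qed.

Let finite_zero := @finite_place_zero F L.

Lemma function_field_genus : is_genus (const_emb L)
  ((t.+1%:Z - 1) * ((t.+1 * t.+1)%N%:Z - 2) - t.+1%:Z + 2).
Proof.
exact: (kummer_genus phi_eq0 phiC t_gt0 cardF sF a0 a_npow Y0 YE place_fin place_inf
  expansion aut frobB growth finite_zero).
Qed.

Lemma function_field_rational_points : rational_points (const_emb L) #= `I_(n * n).
Proof.
exact: (kummer_rational_points phi_eq0 phiC t_gt0 cardF a0 a_npow Y0 YE place_fin
  place_inf expansion aut frobB growth finite_zero).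
Qed.

End KummerFunctionField.

(** The numerator is ['X * ('X^t * polb ^+ t.+1)] and the denominator ['X * polc]; the common factor
    ['X] cancels and the fraction is inverted. *)
Lemma inverse_equation (F : finFieldType) (L : fieldExtType {fraction {poly F}})
    (t n : nat) (a : F) (y : L) (x := ratX F) (A := ratC F a) : (0 < t)%N -> (0 < n)%N ->
  polb t a ^+ t.+1 = 'X^(t * t.+1) - a%:P ->
  y ^+ n = (- ((x ^+ (t.+1 * t.+1) - A * x ^+ t.+1) / (A * x ^+ t.+1 - x)))%:A ->
  y != 0 /\ y^-1 ^+ n * polyL L ('X^t * polb t a ^+ t.+1) = - polyL L (polc t a).
Proof.
move=> t0 n0 bE; pose g := 'X^t * polb t a ^+ t.+1.
have b0 : polb t a != 0 by rewrite -size_poly_eq0 size_XnsubC.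
have c0 : polc t a != 0.
  apply/eqP => /(congr1 (fun p : {poly F} => p.[0])); rewrite !hornerE expr0n gtn_eqF // mulr0 sub0r.
  by apply/eqP; rewrite oppr_eq0 oner_eq0.
have X0 : 'X != 0 :> {poly F} by rewrite polyX_eq0.
have g0 : g != 0 by rewrite mulf_neq0 ?expf_neq0.
have numE : x ^+ (t.+1 * t.+1) - A * x ^+ t.+1 = tofrac ('X * g).
  rewrite /x /A /ratX /ratC /= -!tofracXn -tofracM -tofracB; congr tofrac.
  rewrite /g bE -[(t.+1 * t.+1)%N]/(t.+1 + t * t.+1)%N exprD [in RHS]mulrA -exprS; ring.
have denE : A * x ^+ t.+1 - x = tofrac ('X * polc t a).
  rewrite /x /A /ratX /ratC /= -!tofracXn -tofracM -tofracB; congr tofrac.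
  by rewrite /polc exprS; ring.
rewrite numE denE -mulNr -tofracN polyL_frac => yn.
have XL0 : polyL L 'X != 0 by rewrite polyL_eq0.
have gL0 : polyL L g != 0 by rewrite polyL_eq0.
have cL0 : polyL L (polc t a) != 0 by rewrite polyL_eq0.
have {}yn : y ^+ n = - polyL L g / polyL L (polc t a).
  rewrite yn polyLN !polyLM mulNr mulNr -mulf_div divff // mul1r.
  by [].
split.
  apply/eqP => y0; move/eqP: yn; rewrite y0 expr0n gtn_eqF // eq_sym mulf_eq0.
  by rewrite oppr_eq0 invr_eq0 (negPf gL0) (negPf cL0).
by rewrite -/g exprVn yn invf_div invrN mulrN mulNr divfK.
Qed.

Theorem mainTheorem5 (p m : nat) (F : finFieldType) (a : F)
    (q := (p ^ m)%N) (s := (p ^ m./2)%N)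
    (x := ratX F) (A := ratC F a)
    (f : {fraction {poly F}} :=
       - ((x ^+ q - A * x ^+ s) / (A * x ^+ s - x)))
    (L : fieldExtType {fraction {poly F}}) (y : L) :
  prime p -> (0 < m)%N -> ~~ odd m -> #|F| = q ->
  a != 0 ->
  ~ (exists2 b : F, b != 0 & a = b ^+ (s - 1)%N) ->
  is_function_field (q - 1)%N f y ->
  is_genus (const_emb L) ((s%:Z - 1) * (q%:Z - 2) - s%:Z + 2) /\
  rational_points (const_emb L) #= `I_((q - 1) ^ 2).
Proof.
move=> pp m0 om cF a0 npow [yn geny].
have mE : m = (m./2 + m./2)%N by rewrite addnn -[LHS]odd_double_half (negPf om).
have qE : q = (s * s)%N by rewrite /q /s {1}mE expnD.
have s1 : (1 < s)%N.
  apply: leq_trans (prime_gt1 pp) _; rewrite -{1}[p]expn1 leq_exp2l ?prime_gt1 //.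
  by move: m0; rewrite {1}mE addnn double_gt0.
have pF : p \in [pchar F] by apply: card_finPcharP cF pp.
have [t sE t0] : exists2 t, s = t.+1 & (0 < t)%N.
  by exists s.-1; [rewrite prednK // ltnW | rewrite -ltnS prednK // ltnW].
have sF : t.+1%:R = 0 :> F.
  rewrite -sE /s natrX (pcharf0 pF) expr0n gtn_eqF //.
  by move: m0; rewrite {1}mE addnn double_gt0.
have frobB (g h : {poly F}) : (g - h) ^+ t.+1 = g ^+ t.+1 - h ^+ t.+1.
  rewrite -sE; apply: pchar_exprB.
  by rewrite (rmorph_pchar (polyC : {rmorphism F -> {poly F}}) pF).
have qt : q = (t.+1 * t.+1)%N by rewrite qE sE.
have n1 : (t.+1 * t.+1 = (t * t.+2).+1)%N by ring.
have nE : (q - 1 = t * t.+2)%N by rewrite qt n1 subn1.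
have cardF : #|F| = (t.+1 * t.+1)%N by rewrite cF.
have n0 : (0 < t * t.+2)%N by rewrite muln_gt0 t0.
(* Since the multiplicative group is cyclic of order [t * t.+2], an element killed by the exponent
   [t.+2 = s + 1] would be a power of exponent [t = s - 1]. *)
have a_npow : a ^+ t.+2 != 1.
  apply/eqP => a1; apply: npow; rewrite sE subn1 /=.
  apply: (@finField_power F t t.+2) => //.
  by rewrite cardF n1.
have bE : polb t a ^+ t.+1 = 'X^(t * t.+1) - a%:P.
  by rewrite /polb frobB -exprM -polyC_exp -exprM -cardF expf_card.
have [y0 YE] : y != 0 /\
    y^-1 ^+ (t * t.+2) * polyL L ('X^t * polb t a ^+ t.+1) = - polyL L (polc t a).
  by apply: inverse_equation => //; move: yn; rewrite nE /f qt sE.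
have genY : <<1; y^-1>>%VS = fullv.
  apply/eqP; rewrite eqEsubv subvf -geny /=; apply/FadjoinP; split; first exact: subv_adjoin.
  by rewrite -memvV memv_adjoin.
have yV0 : y^-1 != 0 by rewrite invr_eq0.
rewrite qt sE n1 subn1 /= -mulnn -n1; split.
  exact: (function_field_genus t0 cardF sF a0 a_npow frobB yV0 YE genY).
exact: (function_field_rational_points t0 cardF sF a0 a_npow frobB yV0 YE genY).
Qed.
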